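(* Let $n>1$ and let $M\subset\mathbb{C}^n$ be a real quadratic cone which admits two-sided support at $0$. Then one of the following holds. (i) $M$ is biholomorphic to $M'\times\mathbb{C}^{n-2}$, where $M'\subset\mathbb{C}^2$ has one of the following normal forms: type $\mathcal{M}_{(1,1)}^1$ with $0\le B\le A\le1$ or with $A=B$; type $\mathcal{M}_{(1,1)}^2$; type $\mathcal{M}_{(1,1)}^3$; type $\mathcal{M}_{(1,1)}^4$; type $\mathcal{M}_{(1,0)}^2$; or type $\mathcal{M}_{(0,0)}^1$. (ii) $M$ is biholomorphic either to $\{\operatorname{Re}(z_1^2+\cdots+z_k^2)=0\}$ for some $2<k\le n$, or to $\{\operatorname{Re}(z_1z_2+z_1\overline{z_3})=0\}$.
   Context: A (real) quadratic cone in $\mathbb{C}^n$, $n>1$, is an irreducible real algebraic set $M\subset\mathbb{C}^n$ of pure dimension $2n-1$ of the form $M=\{z\in\mathbb{C}^n:\rho(z)=0\}$, where $\rho$ is a real-valued homogeneous polynomial of degree two in $x_j,y_j$ ($z_j=x_j+iy_j$). The function $\rho$ is taken to be a defining function of $M$, i.e. $d\rho(z)\ne0$ for some $z\in M$ (equivalently, the real quadratic form $\rho$ has at least one positive and at least one negative eigenvalue). $M$ admits two-sided support at $0$ if there exist germs at $0$ of complex analytic hypersurfaces $A^+$, $A^-$ (passing through $0$) with $A^{\pm}\subset\overline{\Omega^{\pm}}$, where $\Omega$ is a neighbourhood of $0$ and $\Omega^{\pm}=\{z\in\Omega:\pm\rho(z)>0\}$. Normal forms: a cone in $\mathbb{C}^2$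 has the indicated normal form if it equals $\{\rho=0\}$ with $\rho$ as follows. - $\mathcal{M}_{(1,1)}^1$ ($0\le B\le A$): $\rho=\operatorname{Re}(Az_1^2+Bz_2^2)+|z_1|^2-|z_2|^2$. - $\mathcal{M}_{(1,1)}^2$ ($A\in\mathbb{C}$, $\operatorname{Re}A>0$, $\operatorname{Im}A\ge0$): $\rho=\operatorname{Re}(Az_1^2+\overline{A}z_2^2)+\operatorname{Im}(z_1\overline{z_2})$. - $\mathcal{M}_{(1,1)}^3$: $\rho=\operatorname{Re}(z_1^2)+\operatorname{Im}(z_1\overline{z_2})$. - $\mathcal{M}_{(1,1)}^4$ ($A>0$): $\rho=\operatorname{Re}(z_1^2+iAz_1z_2)+\operatorname{Im}(z_1\overline{z_2})$. - $\mathcal{M}_{(1,0)}^2$: $\rho=\operatorname{Re}(z_1z_2)+|z_1|^2$. - $\mathcal{M}_{(0,0)}^1$: $\rho=\operatorname{Re}(z_1^2+z_2^2)$. ''Biholomorphic'' refers to germs at the origin: $M$ and $M''$ are biholomorphic if there is a germ of biholomorphism $F:(\mathbb{C}^n,0)\to(\mathbb{C}^n,0)$ with $F(M)=M''$. *)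

(* Defs.v *)
From HB Require Import structures.
From mathcomp Require Import all_boot all_order all_algebra.
From mathcomp Require Import all_classical all_reals all_analysis.
From mathcomp Require Import complex.
(* The notations of [mpoly] clash with those of MathComp-Analysis. *)
From mathcomp Require Import -(notations) mpoly.

Set Implicit Arguments.
Unset Strict Implicit.
Unset Printing Implicit Defensive.
Import Order.TTheory GRing.Theory Num.Theory.
Import numFieldNormedType.Exports.
Local Open Scope classical_set_scope.
Local Open Scope ring_scope.

(* Complex numbers over [R].  The declared type [numClosedFieldType] makes
   MathComp-Analysis attach its topology and norm to them, so that
   [differentiable] on ['rV[Cplx R]_n] is complex differentiability. *)
Definition Cplx (R : realType) : numClosedFieldType := complex.complex R.

Definition ofReal (R : realType) (a : R) : Cplx R := complex.Complex a 0.

(* The point (x_1, ..., x_n, y_1, ..., y_n) of R^{2n}, where z_j = x_j + i y_j,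
   and the inverse identification. *)
Definition real_coords (R : realType) (n : nat) (z : 'rV[Cplx R]_n) :
    'rV[R]_(n + n) :=
  row_mx (\row_j complex.Re (z 0 j)) (\row_j complex.Im (z 0 j)).

Definition of_real_coords (R : realType) (n : nat) (x : 'rV[R]_(n + n)) :
    'rV[Cplx R]_n :=
  \row_j (complex.Complex (x 0 (lshift n j)) (x 0 (rshift n j)) : Cplx R).

Definition rpoly (R : realType) (n : nat) := mpoly.mpoly (n + n) R.

Definition reval (R : realType) (n : nat) (p : rpoly R n)
    (z : 'rV[Cplx R]_n) : R :=
  mpoly.meval (fun k => real_coords z 0 k) p.

Definition real_algebraic (R : realType) (n : nat) (S : set 'rV[Cplx R]_n) :=
  exists (k : nat) (p : 'I_k -> rpoly R n),
    S = [set z | forall i, reval (p i) z = 0].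

Definition irreducible_real_algebraic (R : realType) (n : nat)
    (S : set 'rV[Cplx R]_n) :=
  [/\ real_algebraic S, S !=set0 &
      forall S1 S2 : set 'rV[Cplx R]_n,
        real_algebraic S1 -> real_algebraic S2 ->
        S = S1 `|` S2 -> S = S1 \/ S = S2].

(* Near [x], [S] is an embedded C^1 submanifold of R^m of dimension [d] (for
   [d <= m]), cut out by [m - d] equations with independent differentials. *)
Definition submanifold_at (R : realType) (m d : nat) (S : set 'rV[R]_m)
    (x : 'rV[R]_m) :=
  exists (U : set 'rV[R]_m) (g : 'rV[R]_m -> 'rV[R]_(m - d)),
    [/\ open U, U x,
        (forall y, U y -> [/\ differentiable g y,
                              {for y, continuous (jacobian g)} &
                              row_full (jacobian g y)]) &
        S `&` U = [set y | U y /\ g y = 0]].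

(* The dimension of a real algebraic set at a point [a] is the largest [e] such
   that [a] is a limit of points near which the set is an [e]-dimensional
   submanifold.  As [e] is locally constant along such points, the dimension
   is [d] at every point of [S] exactly when the [d]-dimensional ones are dense
   in [S]. *)
Definition pure_dimensional (R : realType) (n d : nat)
    (S : set 'rV[Cplx R]_n) :=
  let SR := @of_real_coords R n @^-1` S in
  SR `<=` closure [set x | SR x /\ submanifold_at d SR x].

(* [M] is a real quadratic cone in C^n with defining function [rho]. *)
Definition quadratic_cone (R : realType) (n : nat) (M : set 'rV[Cplx R]_n)
    (rho : rpoly R n) :=
  [/\ rho \is mpoly.ishomog1 2 mpoly.mdeg,
      M = [set z | reval rho z = 0],
      irreducible_real_algebraic M,
      pure_dimensional (2 * n - 1) M &
      exists2 z, M z & exists k, reval (mpoly.mderiv k rho) z != 0].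

Definition holomorphic_on (R : realType) (n : nat) (V : normedModType (Cplx R))
    (U : set 'rV[Cplx R]_n) (f : 'rV[Cplx R]_n -> V) :=
  forall z, U z -> differentiable f z.

(* [A] represents the germ at 0 of a complex analytic hypersurface through 0;
   such a germ is the zero locus of one nonzero germ of holomorphic function. *)
Definition hypersurface_germ (R : realType) (n : nat)
    (A : set 'rV[Cplx R]_n) :=
  exists (U : set 'rV[Cplx R]_n) (f : 'rV[Cplx R]_n -> Cplx R),
    [/\ open U /\ U 0, holomorphic_on U f, f 0 = 0,
        ~ (\forall z \near (0 : 'rV[Cplx R]_n), f z = 0) &
        A `&` U = [set z | U z /\ f z = 0]].

Definition two_sided_support (R : realType) (n : nat) (rho : rpoly R n) :=
  exists Omega Ap Am : set 'rV[Cplx R]_n,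
    [/\ open Omega /\ Omega 0,
        hypersurface_germ Ap,
        hypersurface_germ Am,
        Ap `&` Omega `<=` closure [set z | Omega z /\ 0 < reval rho z] &
        Am `&` Omega `<=` closure [set z | Omega z /\ reval rho z < 0]].

(* A germ of biholomorphism F : (C^n, 0) -> (C^n, 0), with inverse G, maps the
   germ of M at 0 onto the germ of M'' at 0. *)
Definition biholomorphic (R : realType) (n : nat) (M M'' : set 'rV[Cplx R]_n) :=
  exists (U V : set 'rV[Cplx R]_n) (F G : 'rV[Cplx R]_n -> 'rV[Cplx R]_n),
    [/\ [/\ open U, U 0, open V & V 0],
        holomorphic_on U F /\ holomorphic_on V G,
        (forall z, U z -> V (F z) /\ G (F z) = z) /\
        (forall w, V w -> U (G w) /\ F (G w) = w),
        F 0 = 0 &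
        F @` (M `&` U) = M'' `&` V].

(* S x C^{n-m} inside C^n. *)
Definition cylinder (R : realType) (m n : nat) (le_mn : (m <= n)%N)
    (S : set 'rV[Cplx R]_m) : set 'rV[Cplx R]_n :=
  [set z | S (\row_j z 0 (widen_ord le_mn j))].

Section NormalForms.
Variable R : realType.
Local Notation C := (Cplx R).
Implicit Type z : 'rV[C]_2.

(* The index set ['I_2] is {0, 1}: z_1 is [z 0 0] and z_2 is [z 0 1]. *)
Definition M11_1 (A B : R) : set 'rV[C]_2 :=
  [set z | 'Re (ofReal A * z 0 0 ^+ 2 + ofReal B * z 0 1 ^+ 2)
           + `|z 0 0| ^+ 2 - `|z 0 1| ^+ 2 = 0].

Definition M11_2 (A : C) : set 'rV[C]_2 :=
  [set z | 'Re (A * z 0 0 ^+ 2 + A^* * z 0 1 ^+ 2)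
           + 'Im (z 0 0 * (z 0 1)^*) = 0].

Definition M11_3 : set 'rV[C]_2 :=
  [set z | 'Re (z 0 0 ^+ 2) + 'Im (z 0 0 * (z 0 1)^*) = 0].

Definition M11_4 (A : R) : set 'rV[C]_2 :=
  [set z | 'Re (z 0 0 ^+ 2 + 'i * ofReal A * z 0 0 * z 0 1)
           + 'Im (z 0 0 * (z 0 1)^*) = 0].

Definition M10_2 : set 'rV[C]_2 :=
  [set z | 'Re (z 0 0 * z 0 1) + `|z 0 0| ^+ 2 = 0].

Definition M00_1 : set 'rV[C]_2 :=
  [set z | 'Re (z 0 0 ^+ 2 + z 0 1 ^+ 2) = 0].

End NormalForms.

(* {Re (z_1^2 + ... + z_k^2) = 0} in C^n. *)
Definition re_sum_squares (R : realType) (n k : nat) : set 'rV[Cplx R]_n :=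
  [set z | 'Re (\sum_(j < n | (j < k)%N) z 0 j ^+ 2) = 0].

(* {Re (z_1 z_2 + z_1 \bar{z_3}) = 0} in C^3. *)
Definition re_z1z2_z1cz3 (R : realType) : set 'rV[Cplx R]_3 :=
  [set z | 'Re (z 0 0 * z 0 1 + z 0 0 * (z 0 2%:R)^*) = 0].

(* Main.v *)
Require Import Defs.
From mathcomp Require Import all_boot all_order all_algebra.
From mathcomp Require Import all_classical all_reals all_analysis.
From mathcomp Require Import complex ring lra.
From mathcomp Require Import -(notations) mpoly.
Set Implicit Arguments.
Unset Strict Implicit.
Unset Printing Implicit Defensive.
Import Order.TTheory GRing.Theory Num.Theory.
Import numFieldNormedType.Exports.
Local Open Scope classical_set_scope.
Local Open Scope ring_scope.

(** Write the defining form as [rho z = Re (B z z) + S z z] with [B] complex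
symmetric and [S] hermitian.

The analytic half turns two-sided support into linear algebra.  If a
holomorphic [f] vanishes at 0 and all its zeros lie in [rho >= 0], then every
complex plane through 0 contains a vector [w <> 0] with [|B w w| <= S w w],
that is, [rho >= 0] on the whole complex line of [w] ([supports_of_germ]).
Suppose not: [S w w < |B w w|] on the plane minus 0.  In suitable coordinates
[(s, t)] of the plane, [B] is either [a s^2] with [a <= 0] or [s t]; the discs
[s = e], respectively the annuli [s t = - e^2], are analytic curves on which
[B w w] is a real number [<= 0], so that [rho = B w w + S w w < 0] there and
[f] has no zero on them.  Near their boundaries they stay close to fixed
circles in [rho < 0], where [|f|] is bounded below independently of [e]; by the
maximum principle for [1 / f] the bound holds along the whole curves
([curve_lower_bound]).  But the curves pass arbitrarily close to 0, where [f]
vanishes.  The maximum principle comes from the mean value property, which is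
Goursat's theorem on rectangles ([goursat]) in logarithmic polar coordinates:
no continuity of the derivative is required.

The algebraic half uses this criterion for [rho] and for [- rho].  Diagonalise
[S].  A plane on which [S] is negative definite violates the criterion for
[rho], so [S] has at most one negative, and likewise at most one positive,
square.
- If [S = 0], diagonalising [B] gives [Re (z_1^2 + ... + z_k^2)].
- If [S = |x_1|^2] up to sign, the criterion forces [B] to vanish on [x_1 = 0],
  so [B = x_1 l], and [rho] is [Re (x_1 l) + |x_1|^2].
- If [S = |x_1|^2 - |x_2|^2], then [B] vanishes on [x_1 = x_2 = 0], and the
  couplings of this subspace with [x_1] and [x_2] have equal moduli
  ([coupling_le]).  Either both are 0, and [rho] lives on a plane; or they are
  proportional, and [B = u l + c v^2] with [u = x_1 + mu x_2],
  [v = x_1 - mu x_2], where the criterion yields [c = 0]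
  ([no_residual_square]): this is [Re (u l + u (conj v))].

On a plane, bring [S] to [Im (s (conj t))].  The real matrices of determinant 1
preserve it, and [B] is apolar to a nonzero real binary quadratic form
([real_apolar]); the three types of roots of that form (real and distinct,
double, complex conjugate) lead to the normal forms.  Only in the last case, a
diagonal pair, does the criterion restrict the coefficients.

Forms of one complex variable, which would escape the list, are either
semidefinite, so that the differential of [rho] vanishes on the cone, or
products of two real linear forms, so that the cone is reducible
([cone_not_one_variable]).  All equivalences found are linear. *)

(** * Integrals of continuous functions over segments *)

Section Integral.
Variable R : realType.
Implicit Types (f g : R -> R) (a b c : R).

Definition itg f a b := Rintegral lebesgue_measure `[a, b]%classic f.

Definition cont_on f a b := forall x, a <= x <= b -> {for x, continuous f}.

Lemma cont_on_integrable f a b : cont_on f a b ->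
  lebesgue_measure.-integrable `[a, b]%classic (EFin \o f).
Proof.
move=> cf; apply: continuous_compact_integrable.
  exact: segment_compact.
apply: continuous_in_subspaceT => x; rewrite inE /= in_itv /=; exact: cf.
Qed.

Lemma itg_cat f a b c : a <= c -> c <= b -> cont_on f a b ->
  itg f a b = itg f a c + itg f c b.
Proof.
move=> ac cb cf.
have i1 := cont_on_integrable cf.
have sqr_i : cont_on f c b by move=> x /andP[h1 h2]; apply: cf; rewrite h2 (le_trans ac h1).
have := @Rintegral_itvB R f (BLeft a) (BRight b) c i1.
rewrite !bnd_simp => /(_ ac cb).
rewrite Rintegral_itv_obnd_cbnd; first by rewrite /itg => <-; ring.
apply: integrableS (cont_on_integrable sqr_i) => //.
by apply: subset_itvr; rewrite bnd_simp.
Qed.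

Lemma itgB f g a b : cont_on f a b -> cont_on g a b ->
  itg (fun x => f x - g x) a b = itg f a b - itg g a b.
Proof.
by move=> cf cg; rewrite /itg RintegralB//; apply: cont_on_integrable.
Qed.

Lemma itg_cst c a b : a <= b -> itg (fun=> c) a b = c * (b - a).
Proof.
move=> ab; rewrite /itg Rintegral_cst//.
have -> : fine (lebesgue_measure `[a, b]%classic) = b - a :> R.
  by rewrite lebesgue_measure_itv /= lte_fin; case: ltgtP ab => //= -> _; rewrite subrr.
by [].
Qed.

Lemma cont_on_cst c a b : cont_on (fun=> c) a b.
Proof. by move=> x _; apply: cvg_cst. Qed.

Lemma cont_onB f g a b : cont_on f a b -> cont_on g a b ->
  cont_on (fun x => f x - g x) a b.
Proof. by move=> cf cg x hx; apply: cvgB; [exact: cf|exact: cg]. Qed.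

Lemma itg_le f g a b : cont_on f a b -> cont_on g a b ->
  (forall x, a <= x <= b -> f x <= g x) -> itg f a b <= itg g a b.
Proof.
by move=> cf cg h; apply: le_Rintegral => //; exact: cont_on_integrable.
Qed.

Lemma itg_near_cst f c M a b : a <= b -> cont_on f a b ->
  (forall x, a <= x <= b -> `|f x - c| <= M) -> `|itg f a b - c * (b - a)| <= M * (b - a).
Proof.
move=> ab cf h.
have c1 := @cont_on_cst (c - M) a b.
have c2 := @cont_on_cst (c + M) a b.
have := itg_le c1 cf; have := itg_le cf c2; rewrite !itg_cst// => h1 h2.
rewrite ler_norml; apply/andP; split.
  have := h2 _; have hh x : a <= x <= b -> c - M <= f x.
    by move/h; rewrite ler_norml => /andP[? ?]; lra.
  move=> /(_ hh); lra.
have hh x : a <= x <= b -> f x <= c + M.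
  by move/h; rewrite ler_norml => /andP[? ?]; lra.
move: (h1 hh); lra.
Qed.

End Integral.

(** * Goursat's theorem on rectangles *)

Section Goursat.
Variable R : realType.
Implicit Types (u v : R -> R -> R) (x y a b : R).

(** Differentiability of [u + i v] at [x + i y], with derivative [p + i q]. *)
Definition cauchy_riemann u v x y := exists p q : R, forall e : R, 0 < e ->
  exists2 d : R, 0 < d & forall s t, `|s| <= d -> `|t| <= d ->
    `|u (x + s) (y + t) - u x y - (p * s - q * t)| <= e * (`|s| + `|t|) /\
    `|v (x + s) (y + t) - v x y - (q * s + p * t)| <= e * (`|s| + `|t|).

Lemma lip_continuous (f : R -> R) x (C d : R) : 0 < d -> 0 <= C ->
  (forall s, `|s| <= d -> `|f (x + s) - f x| <= C * `|s|) -> {for x, continuous f}.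
Proof.
move=> d0 C0 h; apply/cvgrPdist_le => /= e e0.
have e' : 0 < Num.min d (e / (C + 1)).
  by rewrite lt_min d0 divr_gt0//; lra.
near=> z.
have zd : `|z - x| <= Num.min d (e / (C + 1)).
  rewrite distrC; near: z; exact: (@cvgr_dist_le _ _ _ (nbhs x) _ id x).
have /andP[z1 z2] : (`|z - x| <= d) && (`|z - x| <= e / (C + 1)) by rewrite -le_min.
have := h (z - x) z1; have -> : x + (z - x) = z by ring.
rewrite distrC => /le_trans; apply.
apply: (@le_trans _ _ (C * (e / (C + 1)))); first exact: ler_wpM2l.
rewrite mulrA ler_pdivrMr; last lra.
nra.
Unshelve. all: by end_near. Qed.

Lemma cauchy_riemann_continuous u v x y : cauchy_riemann u v x y ->
  [/\ {for x, continuous (u ^~ y)}, {for x, continuous (v ^~ y)},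
      {for y, continuous (u x)} & {for y, continuous (v x)}].
Proof.
move=> [p [q h]]; have [d d0 {}h] := h 1 ltr01.
have C0 : 0 <= 1 + (`|p| + `|q|) by rewrite !addr_ge0.
have key : forall (w l : R), `|w - l| <= `|w| + `|l| by move=> w l; exact: ler_normB.
have fin (A l s k : R) : `|A - l * s| <= 1 * `|s| -> `|l| <= k -> `|A| <= (1 + k) * `|s|.
  move=> h1 h2; have -> : A = (A - l * s) + l * s by ring.
  apply: le_trans (ler_normD _ _) _; rewrite normrM mulrDl; apply: lerD => //.
  exact: ler_wpM2r.
have z0 : `|0 : R| <= d by rewrite normr0 ltW.
split; apply: (lip_continuous d0 C0) => s sd.
- have [+ _] := h s 0 sd z0; rewrite normr0 !addr0 mulr0 subr0.
  by move/fin; apply; rewrite lerDl.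
- have [_ +] := h s 0 sd z0; rewrite normr0 !addr0 mulr0 addr0.
  by move/fin; apply; rewrite lerDr.
- have [+ _] := h 0 s z0 sd.
  rewrite normr0 !(addr0, mulr0, add0r) -mulNr.
  by move/fin; apply; rewrite normrN lerDr.
- have [_ +] := h 0 s z0 sd.
  rewrite normr0 !(addr0, mulr0, add0r).
  by move/fin; apply; rewrite lerDl.
Qed.

(** The imaginary part of the integral of [(u + i v) dz] round the rectangle
with corner [(x, y)] and sides [a], [b].  The real part is, up to sign, the same
integral for [(v, - u)]. *)
Definition bdry_integral u v x y a b :=
  (itg (v ^~ y) x (x + a) - itg (v ^~ (y + b)) x (x + a)) +
  (itg (u (x + a)) y (y + b) - itg (u x) y (y + b)).

Definition cauchy_riemann_on u v x y a b :=
  forall s t, x <= s <= x + a -> y <= t <= y + b -> cauchy_riemann u v s t.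

Lemma cauchy_riemann_on_cont u v x y a b : cauchy_riemann_on u v x y a b ->
  (forall t, y <= t <= y + b -> cont_on (u ^~ t) x (x + a) /\ cont_on (v ^~ t) x (x + a)) /\
  (forall s, x <= s <= x + a -> cont_on (u s) y (y + b) /\ cont_on (v s) y (y + b)).
Proof.
move=> h; split=> t tb; split=> s sb.
- by have [] := cauchy_riemann_continuous (h _ _ sb tb).
- by have [] := cauchy_riemann_continuous (h _ _ sb tb).
- by have [] := cauchy_riemann_continuous (h _ _ tb sb).
- by have [] := cauchy_riemann_continuous (h _ _ tb sb).
Qed.

Lemma bdry_integral_split u v x y a b : 0 <= a -> 0 <= b ->
  cauchy_riemann_on u v x y (a + a) (b + b) ->
  bdry_integral u v x y (a + a) (b + b) =
    bdry_integral u v x y a b + bdry_integral u v (x + a) y a b +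
    (bdry_integral u v x (y + b) a b + bdry_integral u v (x + a) (y + b) a b).
Proof.
move=> a0 b0 /cauchy_riemann_on_cont[h1 h2]; rewrite /bdry_integral !addrA.
rewrite !addrA in h1 h2.
have X t : y <= t <= y + b + b ->
  itg (v ^~ t) x (x + a + a) = itg (v ^~ t) x (x + a) + itg (v ^~ t) (x + a) (x + a + a).
  move=> tb; apply: itg_cat; [lra|lra|]; exact: (h1 _ tb).2.
have Y s : x <= s <= x + a + a ->
  itg (u s) y (y + b + b) = itg (u s) y (y + b) + itg (u s) (y + b) (y + b + b).
  move=> tb; apply: itg_cat; [lra|lra|]; exact: (h2 _ tb).1.
rewrite !X; [|lra|lra]. rewrite !Y; [|lra|lra].
ring.
Qed.

(** On a small rectangle [u] and [v] may be replaced by their affine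
approximations, whose boundary integral vanishes by the Cauchy-Riemann
equations; the error is of smaller order than the squared diameter. *)
Lemma bdry_integral_local u v x y : cauchy_riemann u v x y -> forall e : R, 0 < e ->
  exists2 d : R, 0 < d & forall x0 y0 a b, 0 <= a -> 0 <= b -> a + b <= d ->
    x0 <= x <= x0 + a -> y0 <= y <= y0 + b -> cauchy_riemann_on u v x0 y0 a b ->
    `|bdry_integral u v x0 y0 a b| <= e * (a + b) ^+ 2.
Proof.
move=> [p [q h]] e e0.
have e2 : 0 < e / 2 by lra.
have [d d0 {}h] := h _ e2; exists d => // x0 y0 a b a0 b0 abd hx hy /cauchy_riemann_on_cont[h1 h2].
have ea : 0 <= e * (a + b) by nra.
have key s t : x0 <= s <= x0 + a -> y0 <= t <= y0 + b ->
    `|u s t - u x y - (p * (s - x) - q * (t - y))| <= e / 2 * (a + b) /\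
    `|v s t - v x y - (q * (s - x) + p * (t - y))| <= e / 2 * (a + b).
  move=> hs ht.
  have sd : `|s - x| <= a by rewrite ler_norml; lra.
  have td : `|t - y| <= b by rewrite ler_norml; lra.
  have sd' : `|s - x| <= d by lra.
  have td' : `|t - y| <= d by lra.
  have [] := h _ _ sd' td'.
  have -> : x + (s - x) = s by ring.
  have -> : y + (t - y) = t by ring.
  move=> k1 k2.
  have := ler_wpM2l (ltW e2) (lerD sd td) => k3.
  by split; apply: le_trans k3.
have Y0 : y0 <= y0 <= y0 + b by lra.
have Y1 : y0 <= y0 + b <= y0 + b by lra.
have X0 : x0 <= x0 <= x0 + a by lra.
have X1 : x0 <= x0 + a <= x0 + a by lra.
have B1 : `|itg (v ^~ y0) x0 (x0 + a) - itg (v ^~ (y0 + b)) x0 (x0 + a) + p * b * a| <= e * (a + b) * a.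
  rewrite -itgB; [|by apply (h1 y0); lra|by apply (h1 (y0 + b)); lra].
  have := @itg_near_cst R (fun s => v s y0 - v s (y0 + b)) (- (p * b)) (e * (a + b)) x0 (x0 + a).
  have -> : x0 + a - x0 = a by ring.
  rewrite mulNr !opprK; apply; first lra.
    exact: cont_onB (h1 _ Y0).2 (h1 _ Y1).2.
  move=> s hs.
  have [_ +] := key s y0 hs Y0; have [_ +] := key s (y0 + b) hs Y1.
  rewrite !ler_norml => /andP[? ?] /andP[? ?]; apply/andP; split; lra.
have B2 : `|itg (u (x0 + a)) y0 (y0 + b) - itg (u x0) y0 (y0 + b) - p * a * b| <= e * (a + b) * b.
  rewrite -itgB; [|by apply (h2 (x0 + a)); lra|by apply (h2 x0); lra].
  have := @itg_near_cst R (fun t => u (x0 + a) t - u x0 t) (p * a) (e * (a + b)) y0 (y0 + b).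
  have -> : y0 + b - y0 = b by ring.
  apply; first lra.
    exact: cont_onB (h2 _ X1).1 (h2 _ X0).1.
  move=> s hs.
  have [+ _] := key x0 s X0 hs; have [+ _] := key (x0 + a) s X1 hs.
  rewrite !ler_norml => /andP[? ?] /andP[? ?]; apply/andP; split; lra.
move: B1 B2; rewrite /bdry_integral !ler_norml => /andP[? ?] /andP[? ?]; apply/andP; split; nra.
Qed.

(** The supremum of the left end points lies in all the nested intervals. *)
Lemma nested_point (x a : nat -> R) : (forall n, 0 <= a n) ->
  (forall n, x n <= x n.+1 /\ x n.+1 + a n.+1 <= x n + a n) ->
  exists c, forall n, x n <= c <= x n + a n.
Proof.
move=> a0 h.
have mono n m : (n <= m)%N -> x n <= x m /\ x m + a m <= x n + a n.
  elim: m => [|m IH]; first by rewrite leqn0 => /eqP ->.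
  rewrite leq_eqVlt => /orP[/eqP ->//|]; rewrite ltnS => /IH[h1 h2].
  by have [h3 h4] := h m; split; lra.
have ub n m : x m <= x n + a n.
  case: (leqP n m) => nm; first by have := (mono _ _ nm).2; have := a0 m; lra.
  by have := (mono _ _ (ltnW nm)).1; have := a0 n; lra.
exists (sup (range x)) => n; apply/andP; split.
  apply: ub_le_sup; last by exists n.
  by exists (x 0%N + a 0%N) => _ [m _ <-].
apply: ge_sup; first by exists (x 0%N), 0%N.
by move=> _ [m _ <-].
Qed.

Lemma le_four_max (E E1 E2 E3 E4 : R) : E <= E1 + E2 + (E3 + E4) ->
  E <= 4 * E1 \/ (E <= 4 * E2 \/ (E <= 4 * E3 \/ E <= 4 * E4)).
Proof.
move=> h; have [c1|c1] := leP E (4 * E1); first by left.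
have [c2|c2] := leP E (4 * E2); first by right; left.
have [c3|c3] := leP E (4 * E3); first by right; right; left.
right; right; right; lra.
Qed.

(** Halve the sides repeatedly, each time keeping a quarter whose integral is at
least a quarter of the previous one.  At the common point of these rectangles
[bdry_integral_local] makes the integrals smaller than any multiple of [4 ^- n]. *)
Theorem goursat u v x y a b : 0 <= a -> 0 <= b -> cauchy_riemann_on u v x y a b ->
  bdry_integral u v x y a b = 0.
Proof.
move=> a0 b0 hCR.
pose A n : R := a / 2 ^+ n; pose B n : R := b / 2 ^+ n.
have p2 n : 0 < 2 ^+ n :> R by rewrite exprn_gt0.
have A0 n : 0 <= A n by rewrite divr_ge0// ltW.
have B0 n : 0 <= B n by rewrite divr_ge0// ltW.
have AS n : A n = A n.+1 + A n.+1.
  by rewrite /A exprS invfM; field; rewrite gt_eqF.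
have BS n : B n = B n.+1 + B n.+1.
  by rewrite /B exprS invfM; field; rewrite gt_eqF.
have step n (z : R * R) : exists z' : R * R,
    cauchy_riemann_on u v z.1 z.2 (A n) (B n) ->
    [/\ z.1 <= z'.1, z'.1 + A n.+1 <= z.1 + A n,
        z.2 <= z'.2, z'.2 + B n.+1 <= z.2 + B n &
        `|bdry_integral u v z.1 z.2 (A n) (B n)| <= 4 * `|bdry_integral u v z'.1 z'.2 (A n.+1) (B n.+1)|].
  rewrite AS BS; case: z => z1 z2 /=.
  move: (A0 n.+1) (B0 n.+1); set a' := A n.+1; set b' := B n.+1 => a'0 b'0.
  have [hz|hz] := pselect (cauchy_riemann_on u v z1 z2 (a' + a') (b' + b')); last by exists (z1, z2).
  have := bdry_integral_split a'0 b'0 hz.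
  set E := bdry_integral u v z1 z2 _ _; set E1 := bdry_integral u v z1 z2 _ _.
  set E2 := bdry_integral u v _ z2 _ _; set E3 := bdry_integral u v z1 _ _ _; set E4 := bdry_integral u v _ _ _ _ => EE.
  have : `|E| <= `|E1| + `|E2| + (`|E3| + `|E4|).
    rewrite EE; apply: le_trans (ler_normD _ _) _.
    by apply: lerD; exact: ler_normD.
  move=> tri.
  have [c|[c|[c|c]]] := le_four_max tri; clear -a'0 b'0 c.
  - by exists (z1, z2); split => //=; rewrite lerD2l lerDl.
  - by exists (z1 + a', z2); split; rewrite /= ?addrA ?lexx ?lerDl// lerD2l lerDl.
  - by exists (z1, z2 + b'); split; rewrite /= ?addrA ?lexx ?lerDl// lerD2l lerDl.
  - by exists (z1 + a', z2 + b'); split; rewrite /= ?addrA ?lexx ?lerDl.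
have /choice[F HF] : forall nz : nat * (R * R), exists z' : R * R, _ :=
  fun nz => step nz.1 nz.2.
pose Z := fix Z n := if n is m.+1 then F (m, Z m) else (x, y).
have inv n : cauchy_riemann_on u v (Z n).1 (Z n).2 (A n) (B n) /\
    `|bdry_integral u v x y a b| <= 4 ^+ n * `|bdry_integral u v (Z n).1 (Z n).2 (A n) (B n)|.
  elim: n => [|n [IH1 IH2]]; first by rewrite /A /B expr0 !divr1 mul1r.
  have [/= k1 k2 k3 k4 k5] := HF (n, Z n) IH1.
  split; first by move=> s t hs ht; apply: IH1; lra.
  apply: le_trans IH2 _; rewrite exprSr -mulrA ler_wpM2l//.
have step' n := HF (n, Z n) (inv n).1.
have [cx hcx] : exists c, forall n, (Z n).1 <= c <= (Z n).1 + A n.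
  by apply: nested_point => // n; have [/= k1 k2 k3 k4 k5] := step' n.
have [cy hcy] : exists c, forall n, (Z n).2 <= c <= (Z n).2 + B n.
  by apply: nested_point => // n; have [/= k1 k2 k3 k4 k5] := step' n.
apply/eqP; rewrite -normr_eq0 eq_le normr_ge0 andbT.
apply/ler_addgt0Pr => e e0; rewrite add0r.
pose D := (a + b) ^+ 2 + 1.
have D0 : 0 < D by rewrite /D; have := sqr_ge0 (a + b); lra.
have hx0 : x <= cx <= x + a by have := hcx 0; rewrite /A expr0 divr1.
have hy0 : y <= cy <= y + b by have := hcy 0; rewrite /B expr0 divr1.
have [d d0 hd] := bdry_integral_local (hCR _ _ hx0 hy0) (divr_gt0 e0 D0).
have [n hn] : exists n, A n + B n <= d.
  exists (Num.truncn ((a + b) / d)).+1.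
  have k1 : (a + b) / d < (Num.truncn ((a + b) / d)).+1%:R.
    have ab0 : 0 <= (a + b) / d by rewrite divr_ge0; lra.
    by have /andP[] := truncn_itv ab0.
  set m := (Num.truncn _).+1 in k1 *.
  have k2 : m%:R <= 2 ^+ m :> R by rewrite -natrX ler_nat ltnW// ltn_expl.
  rewrite /A /B -mulrDl ler_pdivrMr// mulrC -ler_pdivrMr//; lra.
have := hd _ _ _ _ (A0 n) (B0 n) hn (hcx n) (hcy n) (inv n).1.
have -> : (A n + B n) ^+ 2 = (a + b) ^+ 2 / 4 ^+ n.
  rewrite /A /B -mulrDl exprMn exprVn -exprM mulnC exprM.
  by congr (_ / _ ^+ _); ring.
move=> h; apply: le_trans (inv n).2 _.
have p4 : 0 < 4 ^+ n :> R by rewrite exprn_gt0.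
apply: (@le_trans _ _ (4 ^+ n * (e / D * ((a + b) ^+ 2 / 4 ^+ n)))).
  by rewrite ler_wpM2l// ltW.
have -> : 4 ^+ n * (e / D * ((a + b) ^+ 2 / 4 ^+ n)) = e * ((a + b) ^+ 2 / D).
  by field; rewrite !gt_eqF.
rewrite -[leRHS]mulr1 ler_wpM2l//; first exact: ltW.
by rewrite ler_pdivrMr// mul1r /D; lra.
Qed.

End Goursat.

(** * Complex numbers and complex differentiability with real estimates *)

(** Stated over a [numFieldType] so as to serve both real and complex
derivatives. *)
Lemma is_derive_eps (K : numFieldType) (f : K -> K) (x D : K) : is_derive x 1 f D ->
  forall e : K, 0 < e -> exists2 d : K, 0 < d &
    forall h, `|h| <= d -> `|f (x + h) - f x - D * h| <= e * `|h|.
Proof.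
move=> [df <-] e e0.
have : h^-1 *: (f (h *: 1 + x) - f x) @[h --> 0^'] --> 'D_1 f x by exact: df.
move/cvgrPdist_le => /(_ e e0) /=.
rewrite near_withinE -filter_from_ballE => -[d /= d0 hd].
have d2 : 0 < d / 2 by rewrite divr_gt0.
exists (d / 2) => // h hh.
have [->|hn0] := eqVneq h 0; first by rewrite addr0 mulr0 !subrr normr0 mulr0.
have := hd h; rewrite /ball /= sub0r normrN => /(_ _ hn0).
have -> : (`|h| < d).
  apply: le_lt_trans hh _; rewrite ltr_pdivrMr// mulr_natr mulr2n ltrDl//.
move=> /(_ isT); rewrite (addrC (h *: 1)) /GRing.scale /= mulr1.
have -> : 'D_1 f x - h^-1 * (f (x + h) - f x) = - (h^-1 * (f (x + h) - f x - 'D_1 f x * h)).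
  by field.
by rewrite normrN normrM normfV ler_pdivrMl ?normr_gt0// (mulrC e).
Qed.

Section Conjugation.
Variable C : numClosedFieldType.
Implicit Types x y : C.
Lemma conjcD x y : (x + y)^* = x^* + y^*. Proof. exact: rmorphD. Qed.
Lemma conjcM x y : (x * y)^* = x^* * y^*. Proof. exact: rmorphM. Qed.
Lemma conjcN x : (- x)^* = - x^*. Proof. exact: rmorphN. Qed.
Lemma conjcB x y : (x - y)^* = x^* - y^*. Proof. exact: rmorphB. Qed.
Lemma conjcV x : (x^-1)^* = (x^*)^-1. Proof. exact: fmorphV. Qed.
Lemma conjcX x k : (x ^+ k)^* = (x^*) ^+ k. Proof. exact: rmorphXn. Qed.
Lemma conjc_nat k : (k%:R : C)^* = k%:R. Proof. exact: rmorph_nat. Qed.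
End Conjugation.

Section Modulus.
Variable R : realType.
Local Notation C := (Cplx R).
Implicit Types (z w : C) (x y : R).

Definition cRe z : R := complex.Re z.
Definition cIm z : R := complex.Im z.
(** An alias that fixes the type [Cplx R] of the result. *)
Definition cx x y : C := complex.Complex x y.
(** The modulus as a real number: the norm of [Cplx R] is complex valued. *)
Definition nrm z : R := Num.sqrt (cRe z ^+ 2 + cIm z ^+ 2).

Lemma normCE z : `|z| = ofReal (nrm z). Proof. exact: complex.normc_def. Qed.
Lemma ofReal_inj : injective (@ofReal R). Proof. by move=> x y []. Qed.
Lemma ofRealD x y : ofReal (x + y) = ofReal x + ofReal y.
Proof. exact: (raddfD (complex.real_complex R)). Qed.
Lemma ofRealM x y : ofReal (x * y) = ofReal x * ofReal y.
Proof. exact: (rmorphM (complex.real_complex R)). Qed.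
Lemma le_ofReal x y : (ofReal x <= ofReal y) = (x <= y).
Proof. exact: complex.lecR. Qed.
Lemma lt_ofReal x y : (ofReal x < ofReal y) = (x < y).
Proof. exact: complex.ltcR. Qed.
Lemma ofReal0 : ofReal 0 = 0 :> C. Proof. by []. Qed.
Lemma gt0_ofReal (e : C) : 0 < e -> exists2 x, 0 < x & e = ofReal x.
Proof.
case: e => a b; rewrite complex.ltcE /= => /andP[/eqP -> a0]; by exists a.
Qed.

Lemma nrm_ge0 z : 0 <= nrm z. Proof. exact: sqrtr_ge0. Qed.
Lemma nrmM z w : nrm (z * w) = nrm z * nrm w.
Proof. by apply: ofReal_inj; rewrite ofRealM -!normCE normrM. Qed.
Lemma nrmD z w : nrm (z + w) <= nrm z + nrm w.
Proof. by rewrite -le_ofReal ofRealD -!normCE ler_normD. Qed.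
Lemma nrmN z : nrm (- z) = nrm z.
Proof. by apply: ofReal_inj; rewrite -!normCE normrN. Qed.
Lemma nrm0 : nrm 0 = 0.
Proof. by apply: ofReal_inj; rewrite -normCE normr0. Qed.
Lemma nrm_eq0 z : (nrm z == 0) = (z == 0).
Proof. by rewrite -[in RHS]normr_eq0 normCE -ofReal0 (inj_eq ofReal_inj). Qed.
Lemma nrm_gt0 z : (0 < nrm z) = (z != 0).
Proof. by rewrite lt_def nrm_ge0 andbT nrm_eq0. Qed.
Lemma nrmV z : nrm z^-1 = (nrm z)^-1.
Proof.
have [->|z0] := eqVneq z 0; first by rewrite invr0 nrm0 invr0.
apply: (mulfI (x := nrm z)); first by rewrite nrm_eq0.
rewrite -nrmM !divff// ?nrm_eq0//.
by apply: ofReal_inj; rewrite -normCE normr1.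
Qed.
Lemma nrm_Re z : `|cRe z| <= nrm z.
Proof. by rewrite -sqrtr_sqr ler_wsqrtr// lerDl sqr_ge0. Qed.
Lemma nrm_Im z : `|cIm z| <= nrm z.
Proof. by rewrite -sqrtr_sqr ler_wsqrtr// lerDr sqr_ge0. Qed.
Lemma nrm_le z : nrm z <= `|cRe z| + `|cIm z|.
Proof.
have h : 0 <= `|cRe z| + `|cIm z| by rewrite addr_ge0.
rewrite -[leRHS]ger0_norm// -sqrtr_sqr ler_wsqrtr//.
rewrite sqrrD !real_normK ?num_real// lerD2r lerDl mulrn_wge0// mulr_ge0//.
Qed.
Lemma cReD z w : cRe (z + w) = cRe z + cRe w. Proof. by case: z w => ? ? []. Qed.
Lemma cImD z w : cIm (z + w) = cIm z + cIm w. Proof. by case: z w => ? ? []. Qed.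
Lemma cReN z : cRe (- z) = - cRe z. Proof. by case: z. Qed.
Lemma cImN z : cIm (- z) = - cIm z. Proof. by case: z. Qed.
Lemma cReM z w : cRe (z * w) = cRe z * cRe w - cIm z * cIm w. Proof. by case: z w => ? ? []. Qed.
Lemma cImM z w : cIm (z * w) = cRe z * cIm w + cIm z * cRe w. Proof. by case: z w => ? ? []. Qed.
Lemma cx_eta z : z = cx (cRe z) (cIm z). Proof. by case: z. Qed.
Lemma nrm_sq z : nrm z ^+ 2 = cRe z ^+ 2 + cIm z ^+ 2.
Proof. by rewrite sqr_sqrtr// addr_ge0// sqr_ge0. Qed.

Lemma cRect z : z = ofReal (cRe z) + 'i * ofReal (cIm z).
Proof. by rewrite -complex.complexiE; exact: complex.complexE. Qed.

Lemma ofReal_conj (x : R) : (ofReal x : C)^* = ofReal x.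
Proof. by apply: conj_Creal; apply/complex.complex_realP; eexists. Qed.

Lemma ofRealV (x : R) : ofReal x^-1 = (ofReal x)^-1 :> C.
Proof.
have [->|x0] := eqVneq x 0; first by rewrite invr0 ofReal0 invr0.
have x0' : ofReal x != 0 :> C by rewrite -ofReal0 (inj_eq ofReal_inj).
by apply: (mulfI x0'); rewrite -ofRealM !divff.
Qed.

Lemma ofReal_eq0 (x : R) : (ofReal x == 0 :> C) = (x == 0).
Proof. by rewrite -ofReal0 (inj_eq ofReal_inj). Qed.

Lemma ofRealN (x : R) : ofReal (- x) = - ofReal x :> C.
Proof. exact: (raddfN (complex.real_complex R)). Qed.

Lemma ofReal_neq0 (x : R) : (ofReal x != 0 :> C) = (x != 0).
Proof. by rewrite -ofReal0 (inj_eq ofReal_inj). Qed.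

Lemma nrm_conj (z : C) : nrm z^* = nrm z.
Proof. by apply: ofReal_inj; rewrite -!normCE norm_conjC. Qed.

Lemma mul_conj_nrm (z : C) : z * z^* = ofReal (nrm z ^+ 2).
Proof. by rewrite -normCK normCE expr2 expr2 ofRealM. Qed.

Lemma cRe_le_nrm (z : C) : cRe z <= nrm z.
Proof. by apply: le_trans (nrm_Re z); exact: ler_norm. Qed.

Lemma nrm_ofReal_ge0 (a : R) : 0 <= a -> nrm (ofReal a) = a.
Proof. by move=> a0; apply: ofReal_inj; rewrite -normCE ger0_norm// -ofReal0 le_ofReal. Qed.

Lemma nrm_nat k : nrm (k%:R : C) = k%:R.
Proof.
apply: ofReal_inj; rewrite -normCE normr_nat; symmetry.
exact: (rmorph_nat (complex.real_complex R) k).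
Qed.

(** The epsilons are real, so that estimates take place in a total order. *)
Definition cdiff (g : C -> C) z := exists D, forall e : R, 0 < e ->
  exists2 d : R, 0 < d & forall w, nrm w <= d ->
    nrm (g (z + w) - g z - D * w) <= e * nrm w.

Lemma differentiable_cdiff (g : C -> C) z : differentiable g z -> cdiff g z.
Proof.
move/derivable1_diffP/derivableP/is_derive_eps => hD; exists ('D_1 g z) => e e0.
have e0' : 0 < ofReal e by rewrite -ofReal0 lt_ofReal.
have [d /gt0_ofReal[d' d0 ->] hd] := hD _ e0'; exists d' => // w hw.
by rewrite -le_ofReal ofRealM -!normCE; apply: hd; rewrite normCE le_ofReal.
Qed.

Lemma cdiff_cont g z : cdiff g z -> forall e : R, 0 < e -> exists2 d : R, 0 < d &
  forall w, nrm w <= d -> nrm (g (z + w) - g z) <= e.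
Proof.
move=> [D /(_ 1 ltr01)[d d0 hd]] e e0.
have N0 : 0 < 1 + nrm D by have := nrm_ge0 D; lra.
exists (Num.min d (e / (1 + nrm D))) => [|w]; first by rewrite lt_min d0 divr_gt0.
rewrite le_min => /andP[/hd h1 h2].
have -> : g (z + w) - g z = (g (z + w) - g z - D * w) + D * w by ring.
apply: le_trans (nrmD _ _) _; rewrite nrmM.
by move: h2; rewrite ler_pdivlMr//; lra.
Qed.

Lemma cdiff_lin (g : C -> C) c b z0 z : cdiff g z -> cdiff (fun w => c * g w + b * (w - z0)) z.
Proof.
move=> [D hD]; exists (c * D + b) => e e0.
have N0 : 0 < 1 + nrm c by have := nrm_ge0 c; lra.
have [d d0 hd] := hD _ (divr_gt0 e0 N0); exists d => // w /hd h.
have -> : c * g (z + w) + b * (z + w - z0) - (c * g z + b * (z - z0)) - (c * D + b) * w =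
  c * (g (z + w) - g z - D * w) by ring.
rewrite nrmM; apply: le_trans (ler_wpM2l (nrm_ge0 _) h) _.
rewrite mulrA ler_wpM2r ?nrm_ge0// mulrA ler_pdivrMr//.
have := nrm_ge0 c; nra.
Qed.

End Modulus.

(** * The mean value property *)

Section MeanValue.
Variable R : realType.
Local Notation C := (Cplx R).
Implicit Types (z w : C) (x y s t h k : R) (g : C -> C).

(** The exponential of [s + i t]; [z0 + cexp s t] are logarithmic polar
coordinates around [z0]. *)
Definition cexp s t : C := cx (expR s * cos t) (expR s * sin t).

Lemma cexpD s t h k : cexp (s + h) (t + k) = cexp s t * cexp h k.
Proof.
rewrite [RHS]cx_eta cReM cImM /cexp /= expRD cosD sinD.
by congr cx; ring.
Qed.

Lemma nrm_cexp s t : nrm (cexp s t) = expR s.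
Proof.
rewrite /nrm /= !exprMn -mulrDr cos2Dsin2 mulr1 sqrtr_sqr ger0_norm// expR_ge0.
Qed.

Lemma cexp2pi s : cexp s (0 + pi *+ 2) = cexp s 0.
Proof. by rewrite /cexp cosD2pi sinD2pi. Qed.

Lemma first_order_prod (E c s h k e : R) : 0 <= e <= 1 / 2 -> `|h| <= e ->
  `|E - 1 - h| <= e * `|h| -> `|c - 1| <= e * `|k| -> `|s - k| <= e * `|k| ->
  nrm (cx (E * c) (E * s) - 1 - cx h k) <= 8 * e * (`|h| + `|k|).
Proof.
move=> /andP[e0 e1] he hE hc hs.
have hE1 : `|E - 1| <= 2 * `|h|.
  have -> : E - 1 = (E - 1 - h) + h by ring.
  apply: le_trans (ler_normD _ _) _; have := normr_ge0 h; nra.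
have hE2 : `|E| <= 2.
  have -> : E = (E - 1) + 1 by ring.
  apply: le_trans (ler_normD _ _) _; rewrite normr1; lra.
apply: le_trans (nrm_le _) _.
rewrite !cReD !cImD !cReN !cImN /=.
have -> : E * c - 1 - h = E * (c - 1) + (E - 1 - h) by ring.
have -> : E * s - 0 - k = E * (s - k) + (E - 1) * k by ring.
have := ler_normD (E * (c - 1)) (E - 1 - h).
have := ler_normD (E * (s - k)) ((E - 1) * k).
rewrite !normrM.
have A1 : `|E| * `|c - 1| <= 2 * (e * `|k|) by apply: ler_pM.
have A2 : `|E| * `|s - k| <= 2 * (e * `|k|) by apply: ler_pM.
have A3 : `|E - 1| * `|k| <= 2 * e * `|k|.
  by apply: ler_wpM2r => //; lra.
have := normr_ge0 h; have := normr_ge0 k; nra.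
Qed.

Lemma cexp_first_order (e : R) : 0 < e -> exists2 d : R, 0 < d &
  forall h k, `|h| <= d -> `|k| <= d ->
  nrm (cexp h k - 1 - cx h k) <= e * (`|h| + `|k|).
Proof.
move=> e0; pose e1 := Num.min (e / 8) (1 / 2).
have e10 : 0 < e1 by rewrite lt_min; apply/andP; split; lra.
have e1e : e1 <= e / 8 by rewrite ge_min lexx.
have e11 : e1 <= 1 / 2 by rewrite ge_min lexx orbT.
clearbody e1.
have [d1 d10 hd1] := is_derive_eps (is_derive_expR (0 : R)) e10.
have [d2 d20 hd2] := is_derive_eps (is_derive_sin (0 : R)) e10.
have [d3 d30 hd3] := is_derive_eps (is_derive_cos (0 : R)) e10.
exists (Num.min (Num.min d1 e1) (Num.min d2 d3)); first by rewrite !lt_min d10 d20 d30 e10.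
move=> h k; rewrite !le_min => /andP[/andP[/hd1 h1 h1'] _] /andP[_ /andP[/hd2 h2 /hd3 h3]].
move: h1 h2 h3; rewrite !add0r expR0 sin0 cos0 !oppr0 !(mul0r, addr0, subr0, mul1r) => h1 h2 h3.
have H : 0 <= e1 <= 1 / 2 by rewrite ltW.
apply: le_trans (first_order_prod H h1' h1 h3 h2) _.
by apply: ler_wpM2r; [rewrite addr_ge0|lra].
Qed.

(** The chain rule for [g (z0 + exp (s + i t))]: near [(s, t)] the exponential is
[cexp s t * (1 + (h + i k) + o)] by [cexpD] and [cexp_first_order]. *)
Lemma cdiff_cauchy_riemann g z0 s t : cdiff g (z0 + cexp s t) ->
  cauchy_riemann (fun s t => cRe (g (z0 + cexp s t))) (fun s t => cIm (g (z0 + cexp s t))) s t.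
Proof.
set c := cexp s t; move=> [D hD].
exists (cRe (D * c)), (cIm (D * c)) => e e0.
have c0 : 0 < nrm c by rewrite nrm_cexp expR_gt0.
have D0 : 0 < 1 + nrm (D * c) by have := nrm_ge0 (D * c); lra.
pose e1 := e / (4 * nrm c).
have e10 : 0 < e1 by rewrite divr_gt0// mulr_gt0.
have [d d0 {}hD] := hD _ e10.
pose e2 := Num.min 1 (e / 2 / (1 + nrm (D * c))).
have e20 : 0 < e2 by rewrite lt_min ltr01 /= divr_gt0// divr_gt0.
have e21 : e2 <= 1 by rewrite ge_min lexx.
have e22 : e2 * (1 + nrm (D * c)) <= e / 2.
  by rewrite -ler_pdivlMr// ge_min lexx orbT.
clearbody e2.
have [d' d'0 hE] := cexp_first_order e20.
exists (Num.min d' (d / (4 * nrm c))).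
  by rewrite lt_min d'0 divr_gt0// mulr_gt0.
move=> h k; rewrite !le_min => /andP[h1 h2] /andP[k1 k2].
move: (hE h k h1 k1); rewrite cexpD -/c; set E := cexp h k => {}hE.
have E1 : nrm (E - 1) <= 2 * (`|h| + `|k|).
  have -> : E - 1 = (E - 1 - cx h k) + cx h k by ring.
  apply: le_trans (nrmD _ _) _; have := nrm_le (cx h k) => /=.
  have := normr_ge0 h; have := normr_ge0 k; nra.
have w1 : nrm (c * (E - 1)) <= d.
  rewrite nrmM; apply: le_trans (ler_wpM2l (ltW c0) E1) _.
  by move: h2 k2; rewrite !ler_pdivlMr ?mulr_gt0//; nra.
have key : nrm (g (z0 + c * E) - g (z0 + c) - D * c * cx h k) <= e * (`|h| + `|k|).
  have -> : g (z0 + c * E) - g (z0 + c) - D * c * cx h k =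
     (g (z0 + c + c * (E - 1)) - g (z0 + c) - D * (c * (E - 1))) + D * c * (E - 1 - cx h k).
    have -> : z0 + c + c * (E - 1) = z0 + c * E by ring.
    ring.
  apply: le_trans (nrmD _ _) _.
  have B1 := hD _ w1.
  have B2 : nrm (D * c * (E - 1 - cx h k)) <= e / 2 * (`|h| + `|k|).
    rewrite nrmM; apply: le_trans (ler_wpM2l (nrm_ge0 _) hE) _.
    rewrite mulrA ler_wpM2r ?addr_ge0//; nra.
  have B3 : e1 * nrm (c * (E - 1)) <= e / 2 * (`|h| + `|k|).
    rewrite nrmM mulrA.
    have -> : e1 * nrm c = e / 4 by rewrite /e1; field; rewrite gt_eqF.
    apply: le_trans (ler_wpM2l _ E1) _; lra.
  lra.
split.
  have := le_trans (nrm_Re _) key.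
  by rewrite !cReD !cReN cReM.
have := le_trans (nrm_Im _) key.
by rewrite !cImD !cImN cImM /= (addrC (_ * k)).
Qed.

(** In logarithmic polar coordinates [g] is [2 pi]-periodic in [t], so the
horizontal sides of a rectangle of height [2 pi] contribute opposite integrals
and Goursat's theorem says that the average over the circle of radius [exp s]
does not depend on [s].  When [s] tends to minus infinity it tends to the value
at the centre. *)
Lemma mean_value g z0 s : (forall t' t, t' <= s -> cdiff g (z0 + cexp t' t)) ->
  cdiff g z0 ->
  itg (fun t => cRe (g (z0 + cexp s t))) 0 (0 + pi *+ 2) = cRe (g z0) * (pi *+ 2).
Proof.
move=> hg hz0.
pose u s t := cRe (g (z0 + cexp s t)).
change (itg (u s) 0 (0 + pi *+ 2) = cRe (g z0) * (pi *+ 2)).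
pose v s t := cIm (g (z0 + cexp s t)).
have pi0 : 0 < pi *+ 2 :> R by rewrite mulrn_wgt0// pi_gt0.
have hCR s' t : s' <= s -> cauchy_riemann u v s' t by move=> hs; apply: cdiff_cauchy_riemann; exact: hg.
have cst s' : s' <= s -> itg (u s') 0 (0 + pi *+ 2) = itg (u s) 0 (0 + pi *+ 2).
  move=> hs; have a0 : 0 <= s - s' by rewrite subr_ge0.
  have := @goursat R u v s' 0 (s - s') (pi *+ 2) a0 (ltW pi0).
  have -> : bdry_integral u v s' 0 (s - s') (pi *+ 2) = itg (u s) 0 (0 + pi *+ 2) - itg (u s') 0 (0 + pi *+ 2).
    rewrite /bdry_integral; have -> : s' + (s - s') = s by ring.
    have -> : v ^~ (0 + pi *+ 2) = v ^~ 0 by apply/funext => x; rewrite /v cexp2pi.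
    by rewrite subrr add0r.
  move=> H; apply/esym/eqP; rewrite -subr_eq0; apply/eqP/H.
  by move=> x t /andP[_ hx] _; apply: hCR; rewrite addrC subrK in hx.
apply/eqP; rewrite -subr_eq0 -normr_eq0 eq_le normr_ge0 andbT.
apply/ler_addgt0Pr => e e0; rewrite (add0r e).
have [d d0 hd] := cdiff_cont hz0 (divr_gt0 e0 pi0).
pose s' := Num.min s (ln d).
have s's : s' <= s by rewrite ge_min lexx.
rewrite -(cst _ s's).
have pi0' : 0 <= 0 + pi *+ 2 :> R by rewrite add0r ltW.
have cu : cont_on (u s') 0 (0 + pi *+ 2).
  by move=> t _; have [_ _ +] := cauchy_riemann_continuous (hCR s' t s's).
have := itg_near_cst (c := cRe (g z0)) (M := e / (pi *+ 2)) pi0' cu.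
have -> : 0 + pi *+ 2 - 0 = pi *+ 2 :> R by ring.
rewrite divfK ?gt_eqF//; apply => t _.
rewrite /u -cReN -cReD; apply: le_trans (nrm_Re _) _; apply: hd.
rewrite nrm_cexp -[leRHS]lnK ?posrE// ler_expR.
by rewrite ge_min lexx orbT.
Qed.

End MeanValue.

(** * The maximum principle *)

Section MaximumPrinciple.
Variable R : realType.
Local Notation C := (Cplx R).
Implicit Types (z w : C) (g : C -> C) (p : R * R).

(** Identifies the plane with [R * R], where compactness comes from products of
segments. *)
Definition toC p : C := cx p.1 p.2.

Lemma toC_cRe_cIm z : toC (cRe z, cIm z) = z. Proof. by case: z. Qed.

Lemma nrm_toC_le p : nrm (toC p) <= 2 * `|p|.
Proof.
apply: le_trans (nrm_le _) _; rewrite mulr_natl mulr2n /=.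
by apply: lerD; rewrite prod_normE le_max lexx ?orbT.
Qed.

Lemma cdiff_continuous_nrm g p : cdiff g (toC p) -> {for p, continuous (fun p => nrm (g (toC p)))}.
Proof.
move=> /cdiff_cont hg; apply/cvgrPdist_le => /= e e0.
have [d d0 hd] := hg e e0.
near=> q.
have qd : `|q - p| <= d / 2.
  rewrite distrC; near: q; apply: (@cvgr_dist_le _ _ _ (nbhs p) _ id p) => //.
  by rewrite divr_gt0.
have := hd (toC q - toC p).
have -> : toC p + (toC q - toC p) = toC q by ring.
have -> : toC q - toC p = toC (q - p) by [].
have qd' : nrm (toC (q - p)) <= d by apply: le_trans (nrm_toC_le _) _; lra.
move=> /(_ qd') h; rewrite ler_norml; apply/andP; split.
  rewrite lerNl opprB; have := nrmD (g (toC q) - g (toC p)) (g (toC p)).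
  by rewrite subrK; lra.
have := nrmD (g (toC p) - g (toC q)) (g (toC q)).
have : nrm (g (toC p) - g (toC q)) <= e by rewrite -nrmN opprB.
by rewrite subrK; lra.
Unshelve. all: by end_near. Qed.

(** The points of [K] are either points where the bound holds or interior.
If the bound failed somewhere, [|g z| + del * |z|^2] for a small [del > 0] would
attain its maximum over [K] at an interior point [z1].  There the real part of
the holomorphic function [c g z + 2 del (conj z1) (z - z1)], with [c] the unit
number making [c g z1] positive, would be smaller on a circle than at its
centre by the positive amount [del r^2], against the mean value property. *)
Theorem maximum_principle (K : set (R * R)) g (M : R) : compact K -> 0 <= M ->
  (forall p, K p -> cdiff g (toC p)) ->
  (forall p, K p -> nrm (g (toC p)) <= M \/
     exists2 r : R, 0 < r & forall q, nrm (toC q - toC p) <= r -> K q) ->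
  forall p, K p -> nrm (g (toC p)) <= M.
Proof.
move=> cK M0 dg bd p0 Kp0; rewrite leNgt; apply/negP => gp0.
have K0 : K !=set0 by exists p0.
pose sq p : R := p.1 * p.1 + p.2 * p.2.
have csq : continuous sq.
  move=> p; apply: cvgD; apply: cvgM; (exact: cvg_fst || exact: cvg_snd).
have [pm Kpm hpm] : exists2 c, c \in K & forall t, t \in K -> sq t <= sq c.
  by apply: compact_EVT_max => //; apply: continuous_subspaceT.
set B := sq pm in hpm.
have B0 : 0 <= B by rewrite addr_ge0 ?sqr_ge0// -expr2 sqr_ge0.
pose del := (nrm (g (toC p0)) - M) / (2 * (B + 1)).
have del0 : 0 < del by rewrite divr_gt0//; lra.
have delB : del * B < nrm (g (toC p0)) - M.
  rewrite /del mulrAC ltr_pdivrMr; nra.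
pose phi p := nrm (g (toC p)) + del * sq p.
have [p1 Kp1 hp1] : exists2 c, c \in K & forall t, t \in K -> phi t <= phi c.
  apply: compact_EVT_max => //; apply: continuous_in_subspaceT => p Kp.
  apply: cvgD; first by apply: cdiff_continuous_nrm; apply: dg; rewrite inE in Kp.
  by apply: cvgM; [exact: cvg_cst|exact: csq].
have Mp1 : M < nrm (g (toC p1)).
  have := hp1 p0; rewrite inE => /(_ Kp0); rewrite /phi.
  have : 0 <= sq p0 by rewrite addr_ge0 // -expr2 sqr_ge0.
  have := hpm p1 Kp1; nra.
rewrite inE in Kp1.
have [|[r r0 hr]] := bd _ Kp1; first by move=> /le_lt_trans /(_ Mp1); rewrite ltxx.
set z1 := toC p1 in Mp1 hr; set N := nrm (g z1) in Mp1.
have N0 : 0 < N by exact: le_lt_trans Mp1.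
pose c : C := cx (cRe (g z1) / N) (- (cIm (g z1) / N)).
pose b : C := cx (2 * del * p1.1) (- (2 * del * p1.2)).
have NN : cRe (g z1) ^+ 2 + cIm (g z1) ^+ 2 = N * N by rewrite -nrm_sq expr2.
have nc : nrm c = 1.
  rewrite /nrm /c /=; apply/eqP; rewrite -sqrtr1 eqr_sqrt ?addr_ge0 ?sqr_ge0//; apply/eqP.
  rewrite sqrrN !expr_div_n -mulrDl NN; field; by rewrite gt_eqF.
pose G z := c * g z + b * (z - z1).
have Gz1 : cRe (G z1) = N.
  rewrite /G subrr mulr0 addr0 cReM /c /= mulNr opprK mulrAC (mulrAC (cIm _)) -mulrDl -!expr2 NN.
  by field; rewrite gt_eqF.
have inK t' t : t' <= ln r -> K (cRe (z1 + cexp t' t), cIm (z1 + cexp t' t)).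
  move=> ht; apply: hr; rewrite toC_cRe_cIm addrC addKr nrm_cexp.
  by rewrite -[leRHS]lnK ?posrE// ler_expR.
have hG t' t : t' <= ln r -> cdiff G (z1 + cexp t' t).
  move=> /(inK _ t)/dg; rewrite toC_cRe_cIm; exact: cdiff_lin.
have hG1 : cdiff G z1 by apply: cdiff_lin; exact: dg.
have MV := mean_value hG hG1.
have pi0 : 0 < pi *+ 2 :> R by rewrite mulrn_wgt0// pi_gt0.
have cu : cont_on (fun t => cRe (G (z1 + cexp (ln r) t))) 0 (0 + pi *+ 2).
  move=> t _; have [_ _ +] := cauchy_riemann_continuous (cdiff_cauchy_riemann (hG (ln r) t (lexx _))); by [].
have le_circle t : 0 <= t <= 0 + pi *+ 2 -> cRe (G (z1 + cexp (ln r) t)) <= N - del * r ^+ 2.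
  move=> _.
  set w := cexp (ln r) t.
  have := hp1 (cRe (z1 + w), cIm (z1 + w)).
  rewrite inE => /(_ (inK _ _ (lexx _))); rewrite /phi toC_cRe_cIm -/z1 -/N /sq; cbn [fst snd].
  rewrite /G cReD.
  have -> : z1 + w - z1 = w by ring.
  have := nrm_Re (c * g (z1 + w)); rewrite nrmM nc mul1r => /ler_normlW.
  have := nrm_sq w; rewrite /w nrm_cexp lnK ?posrE// -/w.
  rewrite cReD cImD (cReM b).
  have -> : cRe b = 2 * del * p1.1 by [].
  have -> : cIm b = - (2 * del * p1.2) by [].
  have -> : cRe z1 = p1.1 by [].
  have -> : cIm z1 = p1.2 by [].
  move=> hw hc hm; have := congr1 (fun x => del * x) hw; lra.
have := itg_le cu (@cont_on_cst R (N - del * r ^+ 2) 0 (0 + pi *+ 2)) le_circle.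
rewrite MV itg_cst; last by rewrite add0r ltW.
have -> : 0 + pi *+ 2 - 0 = pi *+ 2 :> R by ring.
rewrite Gz1.
rewrite ler_pM2r//; have : 0 < del * r ^+ 2 by rewrite mulr_gt0// exprn_gt0.
lra.
Qed.

End MaximumPrinciple.

(** * Lower bounds along families of analytic curves *)

Section Curves.
Variable R : realType.
Local Notation C := (Cplx R).
Implicit Types (z w s t : C) (p q : R * R).

Lemma nrm_continuous : continuous (@nrm R : C -> R).
Proof.
move=> z; apply/(@cvgrPdist_le _ _ _ (nbhs z) (nbhs_filter z)) => /= e e0.
have e0' : 0 < ofReal e :> C by rewrite -ofReal0 lt_ofReal.
apply/nbhs_ballP; exists (ofReal e) => // w /=.
rewrite normCE lt_ofReal => /ltW h.
rewrite ler_norml; apply/andP; split.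
  have := nrmD (w - z) z; rewrite subrK.
  have : nrm (w - z) <= e by rewrite -nrmN opprB.
  lra.
have := nrmD (z - w) w; rewrite subrK; lra.
Qed.

Lemma toC_continuous : continuous (@toC R : R * R -> C).
Proof.
move=> p; apply/cvgrPdist_le => /= e /gt0_ofReal[e' e0 ->].
near=> q.
have qd : `|p - q| <= e' / 2.
  near: q; apply: (@cvgr_dist_le _ _ _ (nbhs p) _ id p) => //.
  by rewrite divr_gt0.
rewrite normCE le_ofReal; have -> : toC p - toC q = toC (p - q) by [].
by apply: le_trans (nrm_toC_le _) _; lra.
Unshelve. all: by end_near. Qed.

Lemma nrm_toC_continuous : continuous (fun p : R * R => nrm (toC p)).
Proof. by move=> p; apply: continuous_comp; [exact: toC_continuous|exact: nrm_continuous]. Qed.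

Definition annulus (r1 r2 : R) : set (R * R) := [set p | r1 <= nrm (toC p) <= r2].

Lemma annulus_compact r1 r2 : compact (annulus r1 r2).
Proof.
apply: (@subclosed_compact _ _ (`[- r2, r2]%classic `*` `[- r2, r2]%classic)).
- have -> : annulus r1 r2 = (fun p : R * R => nrm (toC p)) @^-1` `[r1, r2]%classic.
    by apply/seteqP; split => p /=; rewrite in_itv.
  apply: closed_comp; last exact: interval_closed.
  by move=> p _; exact: nrm_toC_continuous.
- apply: compact_setX; exact: segment_compact.
- move=> p /andP[_ h]; split => /=; rewrite in_itv /= -ler_norml.
    exact: le_trans (nrm_Re (toC p)) h.
  exact: le_trans (nrm_Im (toC p)) h.
Qed.

Lemma differentiable_inv_curve n (f : 'rV[C]_n -> C) (a b : 'rV[C]_n) (sigma : C -> C) z :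
  differentiable sigma z -> differentiable f (sigma z *: a + z *: b) ->
  f (sigma z *: a + z *: b) != 0 ->
  cdiff (fun z => (f (sigma z *: a + z *: b))^-1) z.
Proof.
move=> ds df f0; apply: differentiable_cdiff.
have d1 : differentiable (fun z : C => sigma z *: a) z by apply: differentiableZl.
have d2 : differentiable (fun z : C => z *: b) z by apply: differentiableZl.
have d3 : differentiable (fun z : C => sigma z *: a + z *: b) z := differentiableD d1 d2.
have d4 : differentiable (fun z : C => f (sigma z *: a + z *: b)) z := differentiable_comp d3 df.
exact: (differentiableV d4 f0).
Qed.

(** The maximum principle for [1 / f] along the curve
[z |-> sigma z *: a + z *: b]. *)
Lemma curve_lower_bound n (f : 'rV[C]_n -> C) (a b : 'rV[C]_n) (sigma : C -> C)
    (K : set (R * R)) (c : R) : compact K -> 0 < c ->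
  (forall p, K p -> [/\ differentiable sigma (toC p),
     differentiable f (sigma (toC p) *: a + toC p *: b) &
     f (sigma (toC p) *: a + toC p *: b) != 0]) ->
  (forall p, K p -> c <= nrm (f (sigma (toC p) *: a + toC p *: b)) \/
     exists2 r : R, 0 < r & forall q, nrm (toC q - toC p) <= r -> K q) ->
  forall p, K p -> c <= nrm (f (sigma (toC p) *: a + toC p *: b)).
Proof.
move=> cK c0 hK bd p Kp.
have [_ _ fp0] := hK p Kp.
rewrite -lef_pV2 ?posrE ?nrm_gt0// -nrmV.
apply: (@maximum_principle R K (fun z => (f (sigma z *: a + z *: b))^-1)) => //.
- by rewrite invr_ge0 ltW.
- by move=> q /hK[? ? ?]; exact: differentiable_inv_curve.
- move=> q Kq; have [h|h] := bd q Kq; [left|by right].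
  have [_ _ fq0] := hK q Kq.
  by rewrite nrmV lef_pV2 ?posrE ?nrm_gt0.
Qed.

(** Compactness: the bound is uniform for [s] in a disc and [t] on a circle. *)
Lemma tube_lower_bound n (f : 'rV[C]_n -> C) (a b : 'rV[C]_n) (e r : R) :
  (forall s t, nrm s <= e -> nrm t = r ->
     differentiable f (s *: a + t *: b) /\ f (s *: a + t *: b) != 0) ->
  exists2 c : R, 0 < c & forall s t, nrm s <= e -> nrm t = r ->
    c <= nrm (f (s *: a + t *: b)).
Proof.
move=> hf.
pose K : set ((R * R) * (R * R)) := annulus 0 e `*` annulus r r.
have cK : compact K by apply: compact_setX; exact: annulus_compact.
have inK s t : nrm s <= e -> nrm t = r -> K ((cRe s, cIm s), (cRe t, cIm t)).
  by move=> hs ht; split; rewrite /annulus /= !toC_cRe_cIm ?nrm_ge0 ?hs ?ht ?lexx.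
have Kin x : K x -> nrm (toC x.1) <= e /\ nrm (toC x.2) = r.
  by move=> [/= /andP[_ h1] /andP[h2 h3]]; split => //; apply/eqP; rewrite eq_le h2 h3.
have [[x0 Kx0]|K0] := pselect (exists x, K x); last first.
  by exists 1 => // s t hs ht; case: K0; eexists; exact: (inK s t).
have [x1 Kx1 hx1] : exists2 c, c \in K & forall y, y \in K ->
    nrm (f (toC c.1 *: a + toC c.2 *: b)) <= nrm (f (toC y.1 *: a + toC y.2 *: b)).
  apply: (compact_EVT_min (f := fun y : (R * R) * (R * R) => nrm (f (toC y.1 *: a + toC y.2 *: b)))) => //.
    by exists x0.
  apply: continuous_in_subspaceT => x; rewrite inE => /Kin[h1 h2].
  have [df _] := hf _ _ h1 h2.
  apply: continuous_comp; last exact: nrm_continuous.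
  apply: (@continuous_comp _ _ _ (fun y : (R * R) * (R * R) => toC y.1 *: a + toC y.2 *: b)).
    apply: cvgD; apply: cvgZr_tmp => //.
      by apply: (@continuous_comp _ _ _ fst); [exact: cvg_fst|exact: toC_continuous].
    by apply: (@continuous_comp _ _ _ snd); [exact: cvg_snd|exact: toC_continuous].
  exact: differentiable_continuous.
rewrite inE in Kx1; have [h1 h2] := Kin _ Kx1; have [_ f0] := hf _ _ h1 h2.
exists (nrm (f (toC x1.1 *: a + toC x1.2 *: b))); first by rewrite nrm_gt0.
move=> s t hs ht; have := hx1 ((cRe s, cIm s), (cRe t, cIm t)); rewrite inE => /(_ (inK _ _ hs ht)).
by rewrite !toC_cRe_cIm.
Qed.

End Curves.

Section Support.
Variables (R : realType) (n : nat).
Local Notation C := (Cplx R).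
Local Notation V := 'rV[C]_n.
Implicit Types (a b z : V) (s t : C) (f : V -> C).

(** A polydisc of the plane spanned by [a] and [b] fits in a neighbourhood of 0. *)
Lemma nbhs0_plane (W : set V) a b : nbhs (0 : V) W -> exists2 r : R, 0 < r &
  forall s t, nrm s <= r -> nrm t <= r -> W (s *: a + t *: b).
Proof.
move=> /nbhs_ballP[e /= e0 hW].
have N0 : 0 < `|a| + `|b| + 1 by rewrite ltr_wpDl// addr_ge0.
have [r r0 hr] := gt0_ofReal (divr_gt0 e0 N0).
exists r => // s t hs ht; apply: hW.
rewrite -ball_normE /ball_ /= sub0r normrN.
apply: le_lt_trans (ler_normD _ _) _; rewrite !normrZ.
apply: (@le_lt_trans _ _ (ofReal r * (`|a| + `|b|))).
  by rewrite mulrDr; apply: lerD; apply: ler_wpM2r => //; rewrite normCE le_ofReal.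
rewrite -hr mulrAC ltr_pdivrMr//.
by rewrite ltr_pM2l// ltrDl.
Qed.

Lemma differentiable_small f a b (c : R) : differentiable f 0 -> f 0 = 0 -> 0 < c ->
  exists2 r : R, 0 < r &
  forall s t, nrm s <= r -> nrm t <= r -> nrm (f (s *: a + t *: b)) < c.
Proof.
move=> /differentiable_continuous cf f0 c0.
apply: (@nbhs0_plane [set z | nrm (f z) < c]).
have c0' : 0 < ofReal c :> C by rewrite -ofReal0 lt_ofReal.
have /cvgrPdist_lt/(_ _ c0') := cf; rewrite f0.
by apply: filterS => z; rewrite sub0r normrN normCE lt_ofReal.
Qed.

Section Core.
Variables (f : V -> C) (r : R).
Hypothesis r0 : 0 < r.
Hypothesis f0 : f 0 = 0.
Implicit Types rho : C -> C -> R.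

Definition zeros_in_nonneg a b rho := forall s t, nrm s <= r -> nrm t <= r ->
  differentiable f (s *: a + t *: b) /\ (f (s *: a + t *: b) = 0 -> 0 <= rho s t).

(** With [h < 0], this makes [rho] negative near the axis [s = 0]. *)
Definition neg_near_axis rho (L h : R) := forall s t,
  rho s t <= L * nrm s * (nrm s + nrm t) + h * nrm t ^+ 2.

Lemma neg_axis_lower_bound a b rho L h : zeros_in_nonneg a b rho -> 0 <= L -> h < 0 ->
  neg_near_axis rho L h ->
  exists e c : R, [/\ 0 < e, e <= r, 0 < c &
    forall s t, nrm s <= e -> nrm t = r -> c <= nrm (f (s *: a + t *: b))].
Proof.
move=> hz L0 h0 hax.
have L1 : 0 < 2 * L + 1 by lra.
pose e := Num.min r (- h * r / (2 * L + 1)).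
have e0 : 0 < e by rewrite lt_min r0 divr_gt0// mulr_gt0// oppr_gt0.
have er : e <= r by rewrite ge_min lexx.
have eh : e * (2 * L + 1) <= - h * r by rewrite -ler_pdivlMr// ge_min lexx orbT.
have [c c0 hc] : exists2 c : R, 0 < c & forall s t, nrm s <= e -> nrm t = r ->
    c <= nrm (f (s *: a + t *: b)).
  apply: tube_lower_bound => s t hs ht.
  have htr : nrm t <= r by rewrite ht.
  have [df pos] := hz s t (le_trans hs er) htr.
  split=> //; apply/eqP => /pos; apply/negP; rewrite -ltNge.
  apply: le_lt_trans (hax s t) _; rewrite ht.
  have s0 := nrm_ge0 s.
  have : L * nrm s * (nrm s + r) <= L * e * (2 * r).
    rewrite -!mulrA ler_wpM2l// ler_pM//; first by rewrite addr_ge0// ltW.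
    by rewrite mulr_natl mulr2n lerD2r (le_trans hs er).
  have : e * (2 * L + 1) * r <= - h * r * r by rewrite ler_wpM2r// ltW.
  have : 0 < e * r by rewrite mulr_gt0.
  rewrite expr2; lra.
by exists e, c.
Qed.

(** The discs [s = e] are bounded by circles close to [s = 0, |t| = r], where
[|f| >= c]; their centres tend to 0, where [f] vanishes. *)
Lemma no_disc_family a b rho L h : zeros_in_nonneg a b rho -> 0 <= L -> h < 0 ->
  neg_near_axis rho L h ->
  (forall (e : R) t, 0 < e -> rho (ofReal e) t < 0) -> False.
Proof.
move=> hz L0 h0 hax neg.
have [e [c [e0 er c0 hc]]] := neg_axis_lower_bound hz L0 h0 hax.
have r00 : nrm (0 : C) <= r by rewrite nrm0 ltW.
have df0 : differentiable f 0 by have := (hz 0 0 r00 r00).1; rewrite !scale0r addr0.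
have [e' e'0 he'] := differentiable_small a b df0 f0 c0.
pose d := Num.min e e'.
have d0 : 0 < d by rewrite lt_min e0.
have [de de'] : d <= e /\ d <= e' by rewrite !ge_min !lexx orbT.
clearbody d.
have nd : nrm (ofReal d) = d by apply: (@ofReal_inj R); rewrite -normCE ger0_norm// -ofReal0 le_ofReal ltW.
have := he' (ofReal d) 0; rewrite nd nrm0 => /(_ de' (ltW e'0)); apply/negP; rewrite -leNgt.
change (c <= nrm (f ((fun=> ofReal d) (toC (0 : R, 0 : R)) *: a + toC (0 : R, 0 : R) *: b))).
refine (@curve_lower_bound R n f a b (fun=> ofReal d) (annulus 0 r) c (@annulus_compact R 0 r) c0 _ _ (0, 0) _).
- move=> p /andP[_ hp]; have hd : nrm (ofReal d) <= r by rewrite nd (le_trans de).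
  have [df pos] := hz (ofReal d) (toC p) hd hp.
  split=> //; apply/eqP => /pos; by apply/negP; rewrite -ltNge; apply: neg.
- move=> p /andP[_]; rewrite le_eqVlt => /orP[/eqP hp|hp].
    by left; apply: hc => //; rewrite nd.
  right; exists (r - nrm (toC p)); first by rewrite subr_gt0.
  move=> q hq; rewrite /annulus /= nrm_ge0 /=.
  have := nrmD (toC q - toC p) (toC p); rewrite subrK; lra.
- by rewrite /annulus /= nrm_ge0 /= (_ : toC (0, 0) = 0)// nrm0 ltW.
Qed.

(** The annuli [s t = - e^2] are bounded by circles close to [s = 0, |t| = r] and
to [t = 0, |s| = r], and contain the points [(- e, e)], which tend to 0. *)
Lemma no_annulus_family a b rho L h h' : zeros_in_nonneg a b rho -> 0 <= L -> h < 0 -> h' < 0 ->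
  neg_near_axis rho L h -> neg_near_axis (fun s t => rho t s) L h' ->
  (forall (e : R) t, 0 < e -> t != 0 -> rho (- ofReal (e ^+ 2) / t) t < 0) -> False.
Proof.
move=> hz L0 h0 h'0 hax hax' neg.
have [e1 [c1 [e10 e1r c10 hc1]]] := neg_axis_lower_bound hz L0 h0 hax.
have hz' : zeros_in_nonneg b a (fun s t => rho t s).
  by move=> s t hs ht; rewrite addrC; apply: hz.
have [e2 [c2 [e20 e2r c20 hc2]]] := neg_axis_lower_bound hz' L0 h'0 hax'.
have r00 : nrm (0 : C) <= r by rewrite nrm0 ltW.
have df0 : differentiable f 0 by have := (hz 0 0 r00 r00).1; rewrite !scale0r addr0.
pose c := Num.min c1 c2.
have c0 : 0 < c by rewrite lt_min c10.
have [cc1 cc2] : c <= c1 /\ c <= c2 by rewrite !ge_min !lexx orbT.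
clearbody c.
have [e3 e30 he3] := differentiable_small a b df0 f0 c0.
pose d := Num.min (Num.min e1 e2) e3.
have d0 : 0 < d by rewrite !lt_min e10 e20.
have [de1 de2 de3] : [/\ d <= e1, d <= e2 & d <= e3].
  by rewrite !ge_min !lexx !orbT.
clearbody d.
have dr : d <= r := le_trans de1 e1r.
have d2r : d ^+ 2 / r <= d by rewrite ler_pdivrMr// expr2 ler_wpM2l// ltW.
have d2r0 : 0 < d ^+ 2 / r by rewrite divr_gt0// exprn_gt0.
have nR (x : R) : 0 <= x -> nrm (ofReal x) = x.
  by move=> x0; apply: (@ofReal_inj R); rewrite -normCE ger0_norm// -ofReal0 le_ofReal.
pose sg (t : C) : C := - ofReal (d ^+ 2) / t.
have nsg t : nrm (sg t) = d ^+ 2 / nrm t by rewrite /sg nrmM nrmN nrmV nR// sqr_ge0.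
have inK t : d ^+ 2 / r <= nrm t -> nrm (sg t) <= r /\ t != 0.
  move=> ht; have t0 : 0 < nrm t := lt_le_trans d2r0 ht.
  rewrite -nrm_gt0 nsg; split => //.
  by rewrite ler_pdivrMr// mulrC -ler_pdivrMr.
have mid : c <= nrm (f (sg (toC (d, 0)) *: a + toC (d, 0) *: b)).
  apply: (@curve_lower_bound R n f a b sg (annulus (d ^+ 2 / r) r) c (@annulus_compact R _ _) c0).
  - move=> p /andP[hp1 hp2]; have [h1 h2] := inK _ hp1.
    have [df pos] := hz _ _ h1 hp2.
    split; [|exact: df|by apply/eqP => /pos; apply/negP; rewrite -ltNge; apply: neg].
    have dV : differentiable (fun t : C => t^-1) (toC p) := differentiable_Rinv h2.
    exact: (differentiableM (differentiable_cst (- ofReal (d ^+ 2)) _) dV).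
  - move=> p /andP[]; rewrite le_eqVlt => /orP[/eqP hp _|hp1].
      left; apply: le_trans cc2 _; rewrite addrC; apply: hc2.
        by rewrite -hp; apply: le_trans d2r _.
      by rewrite nsg -hp; field; rewrite !gt_eqF.
    rewrite le_eqVlt => /orP[/eqP hp|hp2].
      left; apply: le_trans cc1 _; apply: hc1 => //.
      by rewrite nsg hp; apply: le_trans d2r _.
    right; exists (Num.min (r - nrm (toC p)) (nrm (toC p) - d ^+ 2 / r)).
      by rewrite lt_min !subr_gt0 hp1 hp2.
    move=> q; rewrite le_min => /andP[q1 q2]; rewrite /annulus /=.
    have := nrmD (toC q - toC p) (toC p); rewrite subrK => k1.
    have := nrmD (toC p - toC q) (toC q); rewrite subrK -(nrmN (_ - _)) opprB => k2.
    by apply/andP; split; lra.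
  - rewrite /annulus /=; have -> : toC (d, 0) = ofReal d by [].
    by rewrite nR ?(ltW d0)// d2r dr.
move: mid; apply/negP; rewrite -ltNge; apply: he3.
  rewrite nsg; have -> : toC (d, 0) = ofReal d by [].
  by rewrite nR ?(ltW d0)// expr2 mulfK ?gt_eqF.
have -> : toC (d, 0) = ofReal d by [].
by rewrite nR ?(ltW d0).
Qed.

End Core.
End Support.

(** * From supporting hypersurfaces to a condition on planes *)

Section Forms.
Variables (R : realType) (V : lmodType (Cplx R)).
Local Notation C := (Cplx R).
Implicit Types (B S : V -> V -> C) (a b u v w z : V) (s t c : C).

Definition sym_bilin B :=
  (forall c u v w, B (c *: u + v) w = c * B u w + B v w) /\ (forall u v, B u v = B v u).

Definition herm_sesq S :=
  (forall c u v w, S (c *: u + v) w = c * S u w + S v w) /\ (forall u v, S u v = (S v u)^*).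

Definition independent2 a b := forall s t, s *: a + t *: b = 0 -> s = 0 /\ t = 0.

(** Where [|B w w| <= S w w], the function [Re (B z z) + S z z] is nonnegative on
the whole complex line of [w]. *)
Definition supports B S := forall a b, independent2 a b ->
  exists s t, ((s != 0) || (t != 0)) /\
    let w := s *: a + t *: b in `|B w w| <= S w w.

Definition linear_form (l : V -> C) := forall c u v, l (c *: u + v) = c * l u + l v.

Lemma linear_form_at0 l : linear_form l -> l 0 = 0.
Proof.
move=> h; have := h 1 0 0; rewrite scaler0 addr0 mul1r => /eqP.
by rewrite -subr_eq0 opprD addNKr oppr_eq0 => /eqP.
Qed.

Lemma linear_formZ l : linear_form l -> forall c u, l (c *: u) = c * l u.
Proof. by move=> h c u; rewrite -[c *: u]addr0 h (linear_form_at0 h) addr0. Qed.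

Lemma linear_formD l : linear_form l -> forall u v, l (u + v) = l u + l v.
Proof. by move=> h u v; rewrite -[u]scale1r h mul1r scale1r. Qed.

Lemma sym_bilin_linear B : sym_bilin B -> forall w, linear_form (B w).
Proof. by move=> [l c] w k u v; rewrite !(c w) l. Qed.

Lemma sym_bilinE B : sym_bilin B -> forall s t a b,
  B (s *: a + t *: b) (s *: a + t *: b) =
    s ^+ 2 * B a a + 2 * s * t * B a b + t ^+ 2 * B b b.
Proof.
move=> sB s t a b; have lB := sym_bilin_linear sB; have [_ c] := sB.
rewrite lB (linear_formZ (lB _)) !(c (s *: a + t *: b)) !lB !(linear_formZ (lB _)) (c b a); ring.
Qed.

Lemma herm_sesqE S : herm_sesq S -> forall s t a b,
  S (s *: a + t *: b) (s *: a + t *: b) =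
    s * s^* * S a a + s * t^* * S a b + t * s^* * (S a b)^* + t * t^* * S b b.
Proof.
move=> [l c] s t a b.
have lZ k u w : S (k *: u) w = k * S u w.
  by rewrite -[k *: u]addr0 l (@linear_form_at0 (S^~ w)) ?addr0// => k' u' v'; rewrite l.
rewrite l lZ (c a) (c b) !l !lZ !conjcD !conjcM -!(c _ _) (c b a); ring.
Qed.

Lemma herm_sesq_real S : herm_sesq S -> forall a, S a a = ofReal (cRe (S a a)).
Proof.
move=> [_ c] a; have := c a a; case: (S a a) => x y [/eqP]; rewrite eq_sym => h.
have -> // : y = 0; apply/eqP; move: h.
by rewrite -subr_eq0 -opprD oppr_eq0 -mulr2n mulrn_eq0 /=.
Qed.

End Forms.

Section SupportForms.
Variables (R : realType) (n : nat).
Local Notation C := (Cplx R).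
Local Notation V := 'rV[C]_n.
Implicit Types (B S : V -> V -> C) (a b u v w z : V) (s t c : C).

Definition rho2 B S a b s t : R := let w := s *: a + t *: b in cRe (B w w + S w w).

(** All terms of the form other than [S b b * |t|^2] contain a factor [s], because
[B b b = 0]. *)
Lemma rho2_neg_near_axis B S a b : sym_bilin B -> herm_sesq S -> B b b = 0 ->
  exists2 L : R, 0 <= L & neg_near_axis (rho2 B S a b) L (cRe (S b b)).
Proof.
move=> sB hS Bbb.
exists (nrm (B a a) + 2 * nrm (B a b) + nrm (S a a) + 2 * nrm (S a b)).
  by rewrite !addr_ge0// ?mulr_ge0// nrm_ge0.
move=> s t; rewrite /rho2 /= sym_bilinE// herm_sesqE// Bbb mulr0 addr0.
rewrite !cReD.
have h1 : cRe (s ^+ 2 * B a a) <= nrm s * nrm s * nrm (B a a).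
  by apply: le_trans (cRe_le_nrm _) _; rewrite expr2 !nrmM.
have n2 : nrm (2 : C) = 2.
  by apply: (@ofReal_inj R); rewrite -normCE normr_nat -natr1 (natrD _ 1 1) ofRealD.
have h2 : cRe (2 * s * t * B a b) <= 2 * nrm s * nrm t * nrm (B a b).
  by apply: le_trans (cRe_le_nrm _) _; rewrite !nrmM n2.
have h3 : cRe (s * s^* * S a a) <= nrm s * nrm s * nrm (S a a).
  by apply: le_trans (cRe_le_nrm _) _; rewrite !nrmM nrm_conj.
have h4 : cRe (s * t^* * S a b) <= nrm s * nrm t * nrm (S a b).
  by apply: le_trans (cRe_le_nrm _) _; rewrite !nrmM nrm_conj.
have h5 : cRe (t * s^* * (S a b)^*) <= nrm t * nrm s * nrm (S a b).
  by apply: le_trans (cRe_le_nrm _) _; rewrite !nrmM !nrm_conj.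
have h6 : cRe (t * t^* * S b b) = cRe (S b b) * nrm t ^+ 2.
  by rewrite mul_conj_nrm cReM /=; ring.
rewrite h6.
have := nrm_ge0 s; have := nrm_ge0 t; have := nrm_ge0 (B a a); have := nrm_ge0 (B a b).
have := nrm_ge0 (S a a); have := nrm_ge0 (S a b).
move: (nrm s) (nrm t) (nrm (B a a)) (nrm (B a b)) (nrm (S a a)) (nrm (S a b)) h1 h2 h3 h4 h5.
move=> x y A D E F h1 h2 h3 h4 h5 F0 E0 D0 A0 y0 x0.
have k1 : 0 <= x * x * D by rewrite !mulr_ge0.
have k2 : 0 <= x * x * F by rewrite !mulr_ge0.
have k3 : 0 <= x * y * A by rewrite !mulr_ge0.
have k4 : 0 <= x * y * E by rewrite !mulr_ge0.
lra.
Qed.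

Section Germ.
Variables (B S : V -> V -> C) (f : V -> C) (W : set V).
Hypotheses (sB : sym_bilin B) (hS : herm_sesq S).
Hypotheses (W0 : nbhs (0 : V) W) (df : forall z, W z -> differentiable f z) (f0 : f 0 = 0).
Hypothesis fpos : forall z, W z -> f z = 0 -> 0 <= cRe (B z z + S z z).

Definition neg_plane a b := forall s t, (s != 0) || (t != 0) ->
  let w := s *: a + t *: b in cRe (S w w) < nrm (B w w).

Lemma neg_plane_axis a b : neg_plane a b -> B b b = 0 -> cRe (S b b) < 0.
Proof.
move=> h Bbb; have := h 0 1; rewrite oner_eq0 orbT /= scale0r add0r scale1r Bbb nrm0.
exact.
Qed.

Lemma neg_plane_swap a b : neg_plane a b -> neg_plane b a.
Proof. by move=> h s t st /=; rewrite addrC; apply: h; rewrite orbC. Qed.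

Lemma rho2_lt0 a b s t : neg_plane a b -> (s != 0) || (t != 0) ->
  (let w := s *: a + t *: b in cIm (B w w) = 0 /\ cRe (B w w) <= 0) -> rho2 B S a b s t < 0.
Proof.
move=> h st /= [i_neq0 r0]; have := h s t st; rewrite /rho2 /= cReD.
have -> : nrm (B (s *: a + t *: b) (s *: a + t *: b)) = - cRe (B (s *: a + t *: b) (s *: a + t *: b)).
  by rewrite /nrm i_neq0 expr0n addr0 sqrtr_sqr ler0_norm.
lra.
Qed.

Lemma zeros_in_nonneg_rho2 a b : exists2 r : R, 0 < r & zeros_in_nonneg f r a b (rho2 B S a b).
Proof.
have [r r0 hr] := nbhs0_plane a b W0; exists r => // s t hs ht.
by have Wst := hr s t hs ht; split; [exact: df|exact: fpos].
Qed.

Lemma no_neg_plane_disc a b : neg_plane a b -> B b b = 0 -> B a b = 0 ->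
  cIm (B a a) = 0 -> cRe (B a a) <= 0 -> False.
Proof.
move=> h Bbb Bab Ia Ra.
have [r r0 hz] := zeros_in_nonneg_rho2 a b.
have [L L0 hL] := @rho2_neg_near_axis B S a b sB hS Bbb.
apply: (no_disc_family r0 f0 hz L0 (neg_plane_axis h Bbb) hL) => e t e0.
apply: rho2_lt0 => //=.
  by rewrite -nrm_eq0 -(inj_eq (@ofReal_inj R)) -normCE normr_eq0 -ofReal0 (inj_eq (@ofReal_inj R)) gt_eqF.
rewrite sym_bilinE// Bab Bbb !mulr0 !addr0 expr2 -ofRealM cReM cImM /= Ia; split; first by ring.
by rewrite mul0r subr0 mulr_ge0_le0// mulr_ge0// ltW.
Qed.

Lemma no_neg_plane_annulus a b : neg_plane a b -> B b b = 0 -> B a a = 0 ->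
  2 * B a b = 1 -> False.
Proof.
move=> h Bbb Baa Bab.
have [r r0 hz] := zeros_in_nonneg_rho2 a b.
have [L L0 hL] := @rho2_neg_near_axis B S a b sB hS Bbb.
have [L' L'0 hL'] := @rho2_neg_near_axis B S b a sB hS Baa.
pose M := L + L'.
have widen (K : R) rho h' : K <= M -> neg_near_axis rho K h' -> neg_near_axis rho M h'.
  move=> KM hK s t; apply: le_trans (hK s t) _; rewrite lerD2r -!mulrA ler_wpM2r//.
  by rewrite mulr_ge0 ?addr_ge0 ?nrm_ge0.
have hM : neg_near_axis (rho2 B S a b) M (cRe (S b b)) by apply: widen hL; rewrite lerDl.
have hM' : neg_near_axis (fun s t => rho2 B S a b t s) M (cRe (S a a)).
  have -> : (fun s t => rho2 B S a b t s) = rho2 B S b a.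
    by apply/funext => s; apply/funext => t; rewrite /rho2 /= (addrC (t *: a)).
  by apply: widen hL'; rewrite /M lerDr.
have M0 : 0 <= M by rewrite addr_ge0.
apply: (no_annulus_family r0 f0 hz M0 (neg_plane_axis h Bbb)
  (neg_plane_axis (neg_plane_swap h) Baa) hM hM') => e t e0 t0.
apply: rho2_lt0 => //=; first by rewrite t0 orbT.
rewrite sym_bilinE// Baa Bbb !mulr0 add0r addr0.
have -> : 2 * (- ofReal (e ^+ 2) / t) * t * B a b = - ofReal (e ^+ 2) * (2 * B a b) by field.
rewrite Bab mulr1.
by rewrite cReN cImN /= oppr0; split => //; rewrite oppr_le0 sqr_ge0.
Qed.

Lemma neg_plane_basis a b (p q p' q' : C) : neg_plane a b -> p * q' - q * p' != 0 ->
  neg_plane (p *: a + q *: b) (p' *: a + q' *: b).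
Proof.
move=> h d s t st /=.
have -> : s *: (p *: a + q *: b) + t *: (p' *: a + q' *: b) =
  (s * p + t * p') *: a + (s * q + t * q') *: b.
  by rewrite !scalerDr !scalerA !scalerDl addrACA.
apply: h; apply: contraT; rewrite negb_or !negbK => /andP[/eqP h1 /eqP h2].
have e1 : s * (p * q' - q * p') = 0.
  have -> : s * (p * q' - q * p') = (s * p + t * p') * q' - (s * q + t * q') * p' by ring.
  by rewrite h1 h2; ring.
have e2 : t * (p * q' - q * p') = 0.
  have -> : t * (p * q' - q * p') = (s * q + t * q') * p - (s * p + t * p') * q by ring.
  by rewrite h1 h2; ring.
move: e1 e2 => /eqP; rewrite mulf_eq0 (negbTE d) orbF => /eqP e1 /eqP.
rewrite mulf_eq0 (negbTE d) orbF => /eqP e2; by move: st; rewrite e1 e2 eqxx.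
Qed.

(** An isotropic vector [b] of [B] in the plane completes to a basis in which [B]
is either a multiple of [s^2], made nonpositive by scaling, or [s t]. *)
Lemma no_neg_plane_isotropic a b : neg_plane a b -> B b b = 0 -> False.
Proof.
move=> h Bbb.
have E x y := sym_bilinE sB x y a b.
have [Bab|Bab] := eqVneq (B a b) 0.
  have [Baa|Baa] := eqVneq (B a a) 0.
    by apply: (no_neg_plane_disc h) => //; rewrite Baa.
  pose k := sqrtC (- (B a a)^*).
  have k2 : k ^+ 2 = - (B a a)^* by rewrite sqrtCK.
  have k0 : k != 0 by rewrite -sqrf_eq0 k2 oppr_eq0 conjC_eq0.
  have hk : neg_plane (k *: a + 0 *: b) (0 *: a + 1 *: b).
    by apply: neg_plane_basis => //; rewrite mulr1 mul0r subr0.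
  rewrite !scale0r scale1r addr0 add0r in hk.
  have Bk : B (k *: a) (k *: a) = - ofReal (nrm (B a a) ^+ 2).
    have := E k 0; rewrite scale0r addr0 => ->.
    by rewrite k2 Bab Bbb -mul_conj_nrm; ring.
  apply: (no_neg_plane_disc hk) => //.
  - have [_ c] := sB.
    by rewrite c (linear_formZ (sym_bilin_linear sB b)) c Bab mulr0.
  - by rewrite Bk cImN /= oppr0.
  - by rewrite Bk cReN /= oppr_le0 sqr_ge0.
have t0 : 2 != 0 :> C by rewrite pnatr_eq0.
pose p := (2 * B a b)^-1; pose q := - (B a a) / (4 * B a b ^+ 2).
have p0 : p != 0 by rewrite invr_eq0 mulf_neq0.
have hk : neg_plane (p *: a + q *: b) (0 *: a + 1 *: b).
  by apply: neg_plane_basis => //; rewrite mulr1 mulr0 subr0.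
rewrite scale0r scale1r add0r in hk.
apply: (no_neg_plane_annulus hk) => //.
  by rewrite E Bbb /p /q; field; rewrite Bab.
have [_ c] := sB.
rewrite c (sym_bilin_linear sB b) (linear_formZ (sym_bilin_linear sB b)) (c b a) Bbb mulr0 addr0 /p.
by field.
Qed.

(** Every complex plane contains an isotropic vector of [B], since a quadratic
equation over [Cplx R] has a root. *)
Theorem supports_of_germ : supports B S.
Proof.
move=> a b ab; apply: contrapT => H.
have h : neg_plane a b.
  move=> s t st /=; rewrite ltNge; apply/negP => hle; apply: H; exists s, t; split=> //=.
  by rewrite (herm_sesq_real hS) normCE le_ofReal.
have E x y := sym_bilinE sB x y a b.
have [Bbb|Bbb] := eqVneq (B b b) 0; first exact: no_neg_plane_isotropic h Bbb.
pose d := sqrtC (B a b ^+ 2 - B a a * B b b).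
have d2 : d ^+ 2 = B a b ^+ 2 - B a a * B b b by rewrite sqrtCK.
pose q := (- B a b + d) / B b b.
have hk : neg_plane (0 *: a + 1 *: b) (1 *: a + q *: b).
  by apply: neg_plane_basis => //; rewrite mul0r sub0r mulr1 oppr_eq0 oner_eq0.
apply: (no_neg_plane_isotropic hk).
rewrite E expr1n !mul1r mulr1.
have -> : B a a = (B a b ^+ 2 - d ^+ 2) / B b b by rewrite d2; field.
by rewrite /q; field.
Qed.

End Germ.
End SupportForms.

(** * Real quadratic polynomials in complex coordinates *)

Section QuadraticPolynomials.
Variables (R : realType) (n : nat).
Local Notation C := (Cplx R).
Local Notation V := 'rV[C]_n.
Implicit Types (rho : rpoly R n) (z w : V).

Local Notation XX k := (mpolyX R (mnm1 k)).

Definition quad_sum (s : seq (R * 'I_(n + n) * 'I_(n + n))) : rpoly R n :=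
  \sum_(x <- s) x.1.1 *: (XX x.1.2 * XX x.2).

Lemma mnm_deg2 (m : multinom (n + n)) : mdeg m = 2%N ->
  exists kl : 'I_(n + n) * 'I_(n + n), mpolyX R m = XX kl.1 * XX kl.2.
Proof.
move=> m2.
have [k mk] : exists k, (0 < m k)%N.
  apply: contrapT => H; have : mdeg m == 0%N.
    rewrite mdegE; apply/eqP; apply: big1 => i _; apply/eqP; rewrite -leqn0 leqNgt.
    by apply/negP => h; apply: H; exists i.
  by rewrite m2.
have mE : m = mnm_add (mnm_sub m (mnm1 k)) (mnm1 k).
  by apply/mnmP => i; rewrite !mnmE subnK//; case: eqP => [<-|].
have : mdeg (mnm_sub m (mnm1 k)) == 1%N.
  by move: m2; rewrite {1}mE mdegD mdeg1 addn1 => -[->].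
move=> /mdeg1P[l /eqP hl]; exists (l, k) => /=.
by rewrite {1}mE mpolyXD hl.
Qed.

Lemma homog2_quad_sum rho : rho \is ishomog1 2 mdeg -> exists s, rho = quad_sum s.
Proof.
move=> /dhomogP; rewrite {2}(mpolyE rho); elim: (msupp rho) => [|m l IH] h.
  by exists [::]; rewrite /quad_sum !big_nil.
have [s hs] : exists s, \sum_(m <- l) mcoeff m rho *: mpolyX R m = quad_sum s.
  by apply: IH => m' m'l; apply: h; rewrite inE m'l orbT.
have [[k1 k2] /= hk] := mnm_deg2 (h m (mem_head _ _)).
by exists ((mcoeff m rho, k1, k2) :: s); rewrite /quad_sum !big_cons /= hk -[in RHS]/(quad_sum s) hs.
Qed.

(** The real coordinate with index [k] is the real part of [cform k], as
[Im z = Re (- i z)]. *)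
Definition cform (k : 'I_(n + n)) z : C :=
  match fintype.split k with inl j => z 0 j | inr j => - 'i * z 0 j end.

Lemma cformE k z : real_coords z 0 k = cRe (cform k z).
Proof.
rewrite /cform /real_coords !mxE; case: (fintype.split k) => j; rewrite mxE //.
by rewrite -complex.complexiE; case: (z 0 j) => x y; rewrite /cRe /cIm /=; ring.
Qed.

Lemma cform_linear k c z w : cform k (c *: z + w) = c * cform k z + cform k w.
Proof. by rewrite /cform; case: (fintype.split k) => j; rewrite !mxE; ring. Qed.

Lemma reval_quad_sum s z :
  reval (quad_sum s) z = \sum_(x <- s) x.1.1 * (real_coords z 0 x.1.2 * real_coords z 0 x.2).
Proof.
rewrite /reval /quad_sum raddf_sum; apply: eq_bigr => x _.
by rewrite /= mevalZ mevalM !mevalXU.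
Qed.

Lemma cRe_sum (I : Type) (r : seq I) (F : I -> C) :
  cRe (\sum_(i <- r) F i) = \sum_(i <- r) cRe (F i).
Proof.
elim: r => [|a r IH]; first by rewrite !big_nil.
by rewrite !big_cons cReD IH.
Qed.

(** A product of two real parts is [Re u * Re v = Re (u v + u (conj v)) / 2];
symmetrising the two terms gives [B] and [S]. *)
Theorem forms_of_quadratic rho : rho \is ishomog1 2 mdeg ->
  exists B S : V -> V -> C, [/\ sym_bilin B, herm_sesq S &
    forall z, reval rho z = cRe (B z z + S z z)].
Proof.
move=> /homog2_quad_sum[s ->].
exists (fun z w => \sum_(x <- s) ofReal (x.1.1 / 4) *
  (cform x.1.2 z * cform x.2 w + cform x.2 z * cform x.1.2 w)).
exists (fun z w => \sum_(x <- s) ofReal (x.1.1 / 4) *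
  (cform x.1.2 z * (cform x.2 w)^* + cform x.2 z * (cform x.1.2 w)^*)).
split.
- split=> [c u v w|u v].
    rewrite mulr_sumr -big_split /=; apply: eq_bigr => x _; rewrite !cform_linear; ring.
  by apply: eq_bigr => x _; ring.
- split=> [c u v w|u v].
    rewrite mulr_sumr -big_split /=; apply: eq_bigr => x _; rewrite !cform_linear; ring.
  rewrite rmorph_sum; apply: eq_bigr => x _.
  rewrite /= conjcM conjcD !conjcM !conjCK.
  have -> : (ofReal (x.1.1 / 4))^* = ofReal (x.1.1 / 4) :> C.
    by apply: conj_Creal; apply/complex.complex_realP; eexists.
  ring.
- move=> z; rewrite -big_split /= cRe_sum reval_quad_sum; apply: eq_bigr => x _.
  rewrite !cformE; move: (cform x.1.2 z) (cform x.2 z) => u v.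
  have cj (w : C) : w^* = cx (cRe w) (- cIm w) by case: w.
  by rewrite !(cReD, cReM, cImM, cImD) /= !cj /=; field.
Qed.

Definition real_unit (k : 'I_(n + n)) : V := of_real_coords (delta_mx 0 k).

Lemma real_coords_shift z (t : R) k l :
  real_coords (z + ofReal t *: real_unit k) 0 l = real_coords z 0 l + t * (l == k)%:R.
Proof.
rewrite /real_coords !mxE; case: (splitP l) => j hj; rewrite !mxE /=.
  have -> : l = lshift n j by apply: val_inj.
  by case: (z 0 j) => x y /=; rewrite mul0r subr0.
have -> : l = rshift n j by apply: val_inj.
by case: (z 0 j) => x y /=; rewrite mul0r addr0.
Qed.

Lemma reval_taylor rho z k : rho \is ishomog1 2 mdeg -> exists c : R, forall t,
  reval rho (z + ofReal t *: real_unit k) =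
    reval rho z + t * reval (mderiv k rho) z + t ^+ 2 * c.
Proof.
move=> /homog2_quad_sum[s ->].
exists (\sum_(x <- s) x.1.1 * ((x.1.2 == k)%:R * (x.2 == k)%:R)) => t.
have -> : reval (mderiv k (quad_sum s)) z = \sum_(x <- s) x.1.1 *
   ((x.1.2 == k)%:R * real_coords z 0 x.2 + real_coords z 0 x.1.2 * (x.2 == k)%:R).
  have dX (i : 'I_(n + n)) : mderiv k (XX i) = (i == k)%:R *: 1.
    rewrite mderivX mnm1E; case: eqP => [->|_]; last by rewrite !scale0r.
    congr (_ *: _); rewrite -(mpolyX0 (n + n) R); congr (mpolyX R _).
    by apply/mnmP => j; rewrite !mnmE subnn.
  rewrite /reval /quad_sum; elim: s => [|x s IH]; first by rewrite !big_nil mderiv0 meval0.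
  rewrite !big_cons mderivD mevalD IH; congr (_ + _).
  by rewrite mderivZ mderivM !dX mevalZ mevalD !mevalM !mevalZ !meval1 !mevalXU !mulr1.
rewrite !reval_quad_sum !mulr_sumr -!big_split /=; apply: eq_bigr => x _.
by rewrite !real_coords_shift; ring.
Qed.

(** A zero of a semidefinite form is an extremum. *)
Lemma semidefinite_critical rho z k (e : R) : rho \is ishomog1 2 mdeg -> e != 0 ->
  (forall w, 0 <= e * reval rho w) -> reval rho z = 0 -> reval (mderiv k rho) z = 0.
Proof.
move=> h2 e0 pos rz; have [c hc] := reval_taylor z k h2.
set d := reval (mderiv k rho) z in hc *; apply/eqP; apply: contraT => d0.
have key t : 0 <= t * (e * d) + t ^+ 2 * (e * c).
  by have := pos (z + ofReal t *: real_unit k); rewrite hc rz; lra.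
have ed0 : e * d != 0 by rewrite mulf_neq0.
move: (e * d) (e * c) key ed0 => D A key D0.
pose t := - D / (1 + `|A|).
have A0 : 0 < 1 + `|A| by rewrite ltr_pwDl.
have := key t; have -> : t * D + t ^+ 2 * A = - (D ^+ 2 * (1 + `|A| - A) / (1 + `|A|) ^+ 2).
  by rewrite /t; field; rewrite gt_eqF.
rewrite oppr_ge0 leNgt => /negP[]; rewrite divr_gt0 ?exprn_gt0// mulr_gt0//.
  by rewrite lt_def sqr_ge0 sqrf_eq0 D0.
have := ler_norm A; lra.
Qed.

End QuadraticPolynomials.

(** * Cones of one complex variable *)

Section Cones.
Variables (R : realType) (n : nat).
Local Notation C := (Cplx R).
Local Notation V := 'rV[C]_n.
Implicit Types (rho : rpoly R n) (z w : V) (M : set V).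

Definition lin (c : 'I_n -> C) z : C := \sum_j c j * z 0 j.

Lemma real_algebraic_hyperplane (c : 'I_n -> C) :
  real_algebraic [set z : V | cRe (lin c z) = 0].
Proof.
pose p : rpoly R n := \sum_j (cRe (c j) *: mpolyX R (mnm1 (lshift n j))
                              - cIm (c j) *: mpolyX R (mnm1 (rshift n j))).
have pE z : reval p z = cRe (lin c z).
  rewrite /lin cRe_sum /reval /p raddf_sum; apply: eq_bigr => j _.
  rewrite /= mevalB !mevalZ !mevalXU /real_coords row_mxEl row_mxEr !mxE cReM //.
exists 1%N, (fun=> p); apply/seteqP; split => z /=.
  by move=> h _; rewrite pE.
by move=> /(_ ord0); rewrite pE.
Qed.

Lemma lin_onto (c : 'I_n -> C) j (y : C) : c j != 0 -> exists z, lin c z = y.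
Proof.
move=> cj; exists (\row_i (if i == j then y / c j else 0)).
rewrite /lin (bigD1 j) //= mxE eqxx big1 ?addr0; first by rewrite mulrC divfK.
by move=> i ij; rewrite mxE (negbTE ij) mulr0.
Qed.

Lemma linZ (c : 'I_n -> C) m z : lin (fun j => m * c j) z = m * lin c z.
Proof. by rewrite /lin mulr_sumr; apply: eq_bigr => j _; rewrite mulrA. Qed.

Lemma cone_not_semidefinite M rho (e : R) : quadratic_cone M rho -> e != 0 ->
  (forall w, 0 <= e * reval rho w) -> False.
Proof.
move=> [h2 ME _ _ [z Mz [k /eqP dk]]] e0 pos; apply: dk.
by apply: (semidefinite_critical k h2 e0 pos); move: Mz; rewrite ME.
Qed.

(** Such a form depends on the two real variables [Re l], [Im l].  It is
semidefinite if [|al| <= |ka|], and the differential of [rho] then vanishes on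
the cone; otherwise it is a product of two independent real linear forms, and
the cone is the union of two distinct hyperplanes. *)
Lemma cone_not_one_variable M rho (c : 'I_n -> C) (al : C) (ka : R) : quadratic_cone M rho ->
  (forall z, reval rho z = cRe (al * lin c z ^+ 2) + ka * nrm (lin c z) ^+ 2) -> False.
Proof.
move=> hM hr.
have bound z : `|cRe (al * lin c z ^+ 2)| <= nrm al * nrm (lin c z) ^+ 2.
  by apply: le_trans (nrm_Re _) _; rewrite nrmM expr2 nrmM -expr2.
have [hk|hk] := leP (nrm al) `|ka|.
  have [k0|k0] := leP 0 ka.
    apply: (cone_not_semidefinite hM (oner_neq0 R)) => w; rewrite mul1r hr.
    have := bound w; rewrite ler_norml => /andP[h1 _].
    have : nrm al * nrm (lin c w) ^+ 2 <= ka * nrm (lin c w) ^+ 2.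
      by rewrite ler_wpM2r ?sqr_ge0// -(ger0_norm k0).
    lra.
  have N1 : (-1 : R) != 0 by rewrite oppr_eq0 oner_neq0.
  apply: (cone_not_semidefinite hM N1) => w; rewrite mulN1r hr.
  have := bound w; rewrite ler_norml => /andP[_ h1].
  have : nrm al * nrm (lin c w) ^+ 2 <= - ka * nrm (lin c w) ^+ 2.
    by rewrite ler_wpM2r ?sqr_ge0// -(ltr0_norm k0).
  lra.
have [[j cj]|c0] := pselect (exists j, c j != 0); last first.
  apply: (cone_not_semidefinite hM (oner_neq0 R)) => w; rewrite mul1r hr.
  have -> : lin c w = 0.
    apply: big1 => j _; have -> : c j = 0 by apply/eqP; apply: contra_notT c0 => ?; exists j.
    by rewrite mul0r.
  by rewrite expr0n mulr0 nrm0 expr0n mulr0 addr0.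
set a := nrm al in hk bound.
have a0 : 0 < a by exact: le_lt_trans (normr_ge0 _) hk.
move: hk; rewrite ltr_norml => /andP[k1 k2].
have al0 : al != 0 by rewrite -nrm_gt0.
pose m := sqrtC (al / ofReal a).
have a0' : ofReal a != 0 :> C by rewrite -ofReal0 (inj_eq (@ofReal_inj R)) gt_eqF.
have m2 : al = ofReal a * m ^+ 2 by rewrite /m sqrtCK mulrC divfK.
have nR : nrm (ofReal a) = a.
  by apply: (@ofReal_inj R); rewrite -normCE ger0_norm// -ofReal0 le_ofReal ltW.
have nm : nrm m ^+ 2 = 1.
  have : nrm al = a * nrm m ^+ 2 by rewrite {1}m2 nrmM nR expr2 nrmM -expr2.
  by rewrite -/a => /eqP; rewrite -{1}[a]mulr1 (inj_eq (mulfI (lt0r_neq0 a0))) => /eqP.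
have m0 : m != 0 by rewrite -nrm_eq0 -sqrf_eq0 nm oner_neq0.
pose p := Num.sqrt (a + ka); pose q := Num.sqrt (a - ka).
have p0 : 0 < p by rewrite sqrtr_gt0; lra.
have q0 : 0 < q by rewrite sqrtr_gt0; lra.
have p2 : p ^+ 2 = a + ka by rewrite sqr_sqrtr//; lra.
have q2 : q ^+ 2 = a - ka by rewrite sqr_sqrtr//; lra.
pose c1 j := cx p q * (m * c j); pose c2 j := cx p (- q) * (m * c j).
have l1 z : cRe (lin c1 z) = p * cRe (m * lin c z) - q * cIm (m * lin c z).
  by rewrite /c1 (linZ (fun j => m * c j)) linZ cReM.
have l2 z : cRe (lin c2 z) = p * cRe (m * lin c z) + q * cIm (m * lin c z).
  by rewrite /c2 (linZ (fun j => m * c j)) linZ cReM /= mulNr opprK.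
have rE z : reval rho z = cRe (lin c1 z) * cRe (lin c2 z).
  rewrite hr l1 l2 {1}m2.
  have -> : nrm (lin c z) ^+ 2 = nrm (m * lin c z) ^+ 2.
    by rewrite nrmM exprMn nm mul1r.
  have -> : ofReal a * m ^+ 2 * lin c z ^+ 2 = ofReal a * (m * lin c z * (m * lin c z)) by ring.
  rewrite nrm_sq cReM mul0r subr0 (cReM (m * lin c z)) /=.
  set x := cRe _; set y := cIm _.
  have -> : (p * x - q * y) * (p * x + q * y) = p ^+ 2 * x ^+ 2 - q ^+ 2 * y ^+ 2 by ring.
  by rewrite p2 q2; ring.
have [_ ME [_ _ irr] _ _] := hM.
have MU : M = [set z | cRe (lin c1 z) = 0] `|` [set z | cRe (lin c2 z) = 0].
  rewrite ME; apply/seteqP; split => z /=; rewrite rE.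
    by move=> /eqP; rewrite mulf_eq0 => /orP[/eqP h|/eqP h]; [left|right].
  by case=> ->; rewrite ?mul0r ?mulr0.
have [z hz] := @lin_onto c j (cx q (- p) / m) cj.
have [w hw] := @lin_onto c j (cx q p / m) cj.
have ez : m * lin c z = cx q (- p) by rewrite hz mulrC divfK.
have ew : m * lin c w = cx q p by rewrite hw mulrC divfK.
have pq : 0 < p * q by rewrite mulr_gt0.
have z2 : cRe (lin c2 z) = 0 by rewrite l2 ez /=; ring.
have w1 : cRe (lin c1 w) = 0 by rewrite l1 ew /=; ring.
have Mz : M z by rewrite MU; right.
have Mw : M w by rewrite MU; left.
have [MS|MS] := irr _ _ (real_algebraic_hyperplane c1) (real_algebraic_hyperplane c2) MU.
  by move: Mz; rewrite MS /= l1 ez /=; nra.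
by move: Mw; rewrite MS /= l2 ew /=; nra.
Qed.

End Cones.

(** * Two-sided support *)

Section SupportsOfCone.
Variables (R : realType) (n : nat).
Local Notation C := (Cplx R).
Local Notation V := 'rV[C]_n.

Lemma cRe_continuous : continuous (@cRe R : C -> R).
Proof.
move=> z; apply/(@cvgrPdist_le _ _ _ (nbhs z) (nbhs_filter z)) => /= e e0.
have e0' : 0 < ofReal e :> C by rewrite -ofReal0 lt_ofReal.
apply/nbhs_ballP; exists (ofReal e) => // w /=.
rewrite normCE lt_ofReal => /ltW; apply: le_trans.
by rewrite -cReN -cReD nrm_Re.
Qed.

Lemma continuous_sum_products (T : topologicalType) (I : Type) (s : seq I) (c : I -> R)
    (F G : I -> T -> R) : (forall i, continuous (F i)) -> (forall i, continuous (G i)) ->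
  continuous (fun z => \sum_(i <- s) c i * (F i z * G i z)).
Proof.
move=> cF cG; elim: s => [|i s IH] z.
  have -> : (fun z => \sum_(i <- [::]) c i * (F i z * G i z)) = (fun=> 0).
    by apply/funext => w; rewrite big_nil.
  exact: cvg_cst.
have -> : (fun z => \sum_(i <- i :: s) c i * (F i z * G i z)) =
    (fun z => c i * (F i z * G i z) + \sum_(i <- s) c i * (F i z * G i z)).
  by apply/funext => w; rewrite big_cons.
apply: cvgD; last exact: IH.
by apply: cvgM; [exact: cvg_cst|apply: cvgM; [exact: cF|exact: cG]].
Qed.

Lemma continuous_opp_fun (T : topologicalType) (g : T -> R) :
  continuous g -> continuous (fun z => - g z).
Proof. by move=> cg z; apply: cvgN; exact: cg. Qed.

Lemma reval_continuous (rho : rpoly R n) : rho \is ishomog1 2 mdeg ->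
  continuous (reval rho : V -> R).
Proof.
move=> /homog2_quad_sum[s ->].
have -> : reval (quad_sum s) = (fun z : V => \sum_(x <- s) x.1.1 *
    (cRe (cform x.1.2 z) * cRe (cform x.2 z))).
  by apply/funext => z; rewrite reval_quad_sum; apply: eq_bigr => x _; rewrite !cformE.
have cX (k : 'I_(n + n)) : continuous (fun z : V => cRe (cform k z)).
  move=> z; apply: (@continuous_comp _ _ _ (cform k)); last exact: cRe_continuous.
  rewrite /cform; case: (fintype.split k) => j; first exact: coord_continuous.
  apply: (@continuous_comp _ _ _ (fun z : V => z 0 j) ( *%R (- 'i))).
    exact: coord_continuous.
  exact: mulrl_continuous.
by apply: continuous_sum_products => x; exact: cX.
Qed.

Lemma closure_ge0 (g : V -> R) (A : set V) z : continuous g -> (forall w, A w -> 0 < g w) ->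
  closure A z -> 0 <= g z.
Proof.
move=> cg pos cz; rewrite leNgt; apply/negP => gz.
have : nbhs z [set w | g w < 0].
  have g0 : 0 < - g z by rewrite oppr_gt0.
  have /(@cvgrPdist_lt _ _ _ (nbhs z) (nbhs_filter z))/(_ _ g0) := cg z.
  apply: filterS => w; rewrite distrC ltr_norml /= => /andP[_ ?]; lra.
by move=> /cz [w [/pos h1]] /= h2; lra.
Qed.

(** On the closure of [g > 0] one has [g >= 0], so the zeros of a local equation
of [A] satisfy the hypothesis of [supports_of_germ]. *)
Lemma supports_of_hypersurface (g : V -> R) (A Om : set V) (B S : V -> V -> C) :
  continuous g -> sym_bilin B -> herm_sesq S -> (forall z, g z = cRe (B z z + S z z)) ->
  open Om -> Om 0 -> hypersurface_germ A ->
  A `&` Om `<=` closure [set z | Om z /\ 0 < g z] -> supports B S.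
Proof.
move=> cg sB hS gE oO O0 [U [f [[oU U0] df f0 _ AU]]] sub.
apply: (@supports_of_germ _ _ B S f (U `&` Om)) => //.
- by apply: filterI; apply: open_nbhs_nbhs.
- by move=> z [Uz _]; exact: df.
- move=> z [Uz Oz] fz; rewrite -gE.
  have [Az _] : (A `&` U) z by rewrite AU.
  by apply: (@closure_ge0 g) (sub z _) => // w [].
Qed.

Theorem two_sided_supports (rho : rpoly R n) (B S : V -> V -> C) :
  rho \is ishomog1 2 mdeg -> sym_bilin B -> herm_sesq S ->
  (forall z, reval rho z = cRe (B z z + S z z)) -> two_sided_support rho ->
  supports B S /\ supports (fun u v => - B u v) (fun u v => - S u v).
Proof.
move=> h2 sB hS rE [Om [Ap [Am [[oO O0] hp hm subp subm]]]].
have cr := reval_continuous h2.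
split; first exact: supports_of_hypersurface hp subp.
apply: (@supports_of_hypersurface (fun z => - reval rho z) Am Om) => //.
- exact: continuous_opp_fun.
- have [l c] := sB; split=> *; last by rewrite c.
  by rewrite l; ring.
- have [l c] := hS; split=> [*|u v]; first by rewrite l; ring.
  by rewrite c conjcN.
- by move=> z; rewrite rE !(cReD, cReN); ring.
- move=> z /subm; congr (closure _ z).
  by apply/seteqP; split=> w /= [? ?]; split => //; lra.
Qed.

End SupportsOfCone.

(** * Linear equivalences *)

Section LinearEquivalence.
Variable R : realType.
Local Notation C := (Cplx R).

Lemma differentiable_mulmx n (P : 'M[C]_n) (z : 'rV[C]_n) :
  differentiable (fun z : 'rV[C]_n => z *m P) z.
Proof.
have -> : (fun z : 'rV[C]_n => z *m P) = \sum_(i < n) (fun z : 'rV[C]_n => z 0 i *: row i P).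
  by apply/funext => w; rewrite fct_sumE mulmx_sum_row.
apply: differentiable_sum => i; apply: differentiableZl.
exact: differentiable_coord.
Qed.

Lemma biholomorphic_linear n (P : 'M[C]_n) (M M' : set 'rV[C]_n) : P \in unitmx ->
  (forall z, M z <-> M' (z *m P)) -> biholomorphic M M'.
Proof.
move=> uP h; exists setT, setT, (fun z => z *m P), (fun z => z *m invmx P).
split.
- by split=> //; exact: openT.
- by split=> z _; exact: differentiable_mulmx.
- by split=> z _; split => //; rewrite ?mulmxK// mulmxKV.
- exact: mul0mx.
- apply/seteqP; split => w /=.
    by move=> [z [Mz _] <-]; split => //; apply/h.
  move=> [Mw _]; exists (w *m invmx P); last by rewrite mulmxKV.
  by split=> //; apply/h; rewrite mulmxKV.
Qed.

Lemma linear_form_mulmx n (l : 'rV[C]_n -> C) : linear_form l ->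
  forall z, l z = \sum_i z 0 i * l (delta_mx 0 i).
Proof.
move=> h z.
rewrite {1}(row_sum_delta z).
elim: (index_enum _) => [|i s IH]; first by rewrite !big_nil (linear_form_at0 h).
by rewrite !big_cons h IH.
Qed.

Definition linearly_equivalent n (M M' : set 'rV[C]_n) :=
  exists2 P : 'M[C]_n, P \in unitmx & forall z, M z <-> M' (z *m P).

Lemma linearly_equivalent_biholomorphic n (M M' : set 'rV[C]_n) :
  linearly_equivalent M M' -> biholomorphic M M'.
Proof. by move=> [P uP h]; exact: biholomorphic_linear uP h. Qed.

Lemma linearly_equivalent_trans n (M M' M'' : set 'rV[C]_n) :
  linearly_equivalent M M' -> linearly_equivalent M' M'' -> linearly_equivalent M M''.
Proof.
move=> [P uP h] [P' uP' h']; exists (P *m P'); first by rewrite unitmx_mul uP.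
by move=> z; rewrite h h' mulmxA.
Qed.

Definition jointly_onto n k (l : 'I_k -> 'rV[C]_n -> C) :=
  forall y : 'I_k -> C, exists z, forall j, l j z = y j.

Definition forms_mx n k (l : 'I_k -> 'rV[C]_n -> C) : 'M[C]_(n, k) :=
  \matrix_(i, j) l j (delta_mx 0 i).

Lemma forms_mxE n k (l : 'I_k -> 'rV[C]_n -> C) : (forall j, linear_form (l j)) ->
  forall z, z *m forms_mx l = \row_j l j z.
Proof.
move=> lin z; apply/rowP => j; rewrite !mxE (linear_form_mulmx (lin j)).
by apply: eq_bigr => i _; rewrite mxE.
Qed.

Lemma jointly_onto_rank n k (l : 'I_k -> 'rV[C]_n -> C) :
  (forall j, linear_form (l j)) -> jointly_onto l -> \rank (forms_mx l) = k.
Proof.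
move=> lin onto.
apply/eqP; change (row_full (forms_mx l)); rewrite -sub1mx; apply/row_subP => j.
have [z hz] := onto (fun i => (1%:M : 'M[C]_k) j i).
have -> : row j (1%:M : 'M[C]_k) = z *m forms_mx l.
  by rewrite forms_mxE//; apply/rowP => i; rewrite !mxE hz !mxE.
exact: submxMl.
Qed.

Lemma jointly_onto_leq n k (l : 'I_k -> 'rV[C]_n -> C) :
  (forall j, linear_form (l j)) -> jointly_onto l -> (k <= n)%N.
Proof. by move=> lin /(jointly_onto_rank lin) {1}<-; exact: rank_leq_row. Qed.

(** Linear forms that are jointly onto extend to linear coordinates of the whole
space, of which they are the first [k]. *)
Lemma linearly_equivalent_cylinder n k (le : (k <= n)%N) (l : 'I_k -> 'rV[C]_n -> C)
    (M : set 'rV[C]_n) (M' : set 'rV[C]_k) :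
  (forall j, linear_form (l j)) -> jointly_onto l ->
  (forall z, M z <-> M' (\row_j l j z)) -> linearly_equivalent M (cylinder le M').
Proof.
move=> lin onto h.
pose L := forms_mx l.
have rL : \rank L = k := jointly_onto_rank lin onto.
pose U : 'M[C]_(k, n) := \matrix_(i, j) (i == j :> nat)%:R.
have UV : U *m U^T = 1%:M.
  apply/matrixP => i j; rewrite !mxE (bigD1 (widen_ord le i)) //= big1.
    by rewrite !mxE /= eqxx mul1r addr0 eq_sym.
  move=> a /eqP ha; rewrite !mxE; case: eqP => [ia|_]; last by rewrite mul0r.
  by case: ha; apply: val_inj.
have rU : \rank U = k.
  by apply/eqP; apply/row_freeP; exists U^T.
have [g ug Ug] : {g : 'M[C]_n | g \in unitmx & U *m (U^T *m L^T) = U *m g}.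
  by apply: complete_unitmx; rewrite mulmxA UV mul1mx mxrank_tr rU.
exists g^T; first by rewrite unitmx_tr.
move=> z; rewrite h /cylinder /=.
have -> // : (\row_j (z *m g^T) 0 (widen_ord le j)) = \row_j l j z.
rewrite -(forms_mxE lin) -/L -[L]trmxK -[L^T]mul1mx -UV -mulmxA Ug trmx_mul mulmxA.
apply/rowP => j; rewrite mxE [RHS]mxE (bigD1 (widen_ord le j)) //= big1 ?addr0.
  by rewrite !mxE eqxx mulr1.
move=> a /eqP ha; rewrite !mxE; case: eqP => [ja|_]; last by rewrite mulr0.
by case: ha; apply: val_inj.
Qed.

End LinearEquivalence.

(** * Diagonalization of complex symmetric and hermitian forms *)

Section Diagonalization.
Variable R : realType.
Local Notation C := (Cplx R).

Lemma sym_bilin_matrix n (B : 'rV[C]_n -> 'rV[C]_n -> C) : sym_bilin B ->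
  exists2 Q : 'M[C]_n, Q^T = Q & forall z w, B z w = (z *m Q *m w^T) 0 0.
Proof.
move=> [l c]; exists (\matrix_(i, j) B (delta_mx 0 i) (delta_mx 0 j)).
  by apply/matrixP => i j; rewrite !mxE c.
move=> z w; rewrite (linear_form_mulmx (l := fun z => B z w)) => [|k u v]; last exact: l.
rewrite -mulmxA mxE; apply: eq_bigr => i _; congr (_ * _).
rewrite c (linear_form_mulmx (l := fun w => B w _)) => [|k u v]; last exact: l.
by rewrite mxE; apply: eq_bigr => j _; rewrite !mxE mulrC c.
Qed.

Lemma herm_sesq_matrix n (S : 'rV[C]_n -> 'rV[C]_n -> C) : herm_sesq S ->
  exists2 H : 'M[C]_n, map_mx (@Num.conj C) H^T = H &
    forall z w, S z w = (z *m H *m map_mx (@Num.conj C) w^T) 0 0.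
Proof.
move=> [l c]; exists (\matrix_(i, j) S (delta_mx 0 i) (delta_mx 0 j)).
  by apply/matrixP => i j; rewrite !mxE -c.
move=> z w; rewrite (linear_form_mulmx (l := fun z => S z w)) => [|k u v]; last exact: l.
rewrite -mulmxA mxE; apply: eq_bigr => i _; congr (_ * _).
rewrite c (linear_form_mulmx (l := fun w => S w _)) => [|k u v]; last exact: l.
rewrite mxE rmorph_sum; apply: eq_bigr => j _; rewrite !mxE /= conjcM -c; exact: mulrC.
Qed.

(** The spectral theorem. *)
Lemma herm_diag n (S : 'rV[C]_n -> 'rV[C]_n -> C) : herm_sesq S ->
  exists2 P : 'M[C]_n, P \in unitmx & exists d : 'I_n -> R,
    forall y, S (y *m P) (y *m P) = \sum_j ofReal (d j) * (y 0 j * (y 0 j)^*).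
Proof.
move=> /herm_sesq_matrix[H HH SE].
have hH : H \is hermsymmx by apply/is_hermitianmxP; rewrite expr0 scale1r HH.
have rd := hermitian_spectral_diag_real hH.
have /hermitian_normalmx/orthomx_spectralP HE := hH.
set P := spectralmx H in HE; set D := spectral_diag H in HE rd.
have uP : P \is unitarymx := spectral_unitarymx H.
exists P; first exact: spectral_unit.
exists (fun j => cRe (D 0 j)) => y.
rewrite SE HE trmx_mul map_mxM !mulmxA mulmxK ?spectral_unit//.
have -> : map_mx (@Num.conj C) P^T = invmx P by rewrite invmx_unitary.
rewrite mulmxK ?spectral_unit// mul_mx_diag mxE; apply: eq_bigr => j _; rewrite !mxE.
have -> : ofReal (cRe (D 0 j)) = D 0 j.
  by apply: complex.RRe_real; move/mxOverP: rd; apply.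
by rewrite mulrCA mulrA.
Qed.

(** Polarization. *)
Lemma sym_anisotropic n (Q : 'M[C]_n) : Q^T = Q -> Q != 0 ->
  exists v : 'rV[C]_n, (v *m Q *m v^T) 0 0 != 0.
Proof.
move=> sQ Q0; apply: contrapT => H.
have q0 (v : 'rV[C]_n) : (v *m Q *m v^T) 0 0 = 0.
  by apply/eqP; apply: contra_notT H => ?; exists v.
have e i j : (delta_mx 0 i *m Q *m (delta_mx 0 j)^T : 'M[C]_1) 0 0 = Q i j.
  by rewrite -rowE trmx_delta -colE !mxE.
move/eqP: Q0; apply; apply/matrixP => i j; rewrite mxE.
have := q0 (delta_mx 0 i + delta_mx 0 j).
have entry (A A' : 'M[C]_1) : (A + A') 0 0 = A 0 0 + A' 0 0 by rewrite mxE.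
have tD (a b : 'rV[C]_n) : (a + b)^T = a^T + b^T by apply/matrixP => x y; rewrite !mxE.
rewrite tD mulmxDr !mulmxDl !entry !e.
have := q0 (delta_mx 0 i); rewrite e => ->; have := q0 (delta_mx 0 j); rewrite e => ->.
have -> : Q j i = Q i j by rewrite -[in LHS]sQ mxE.
rewrite add0r addr0 -mulr2n => /eqP; rewrite mulrn_eq0 /= => /eqP; done.
Qed.

(** Induction on the dimension: a vector with [v Q v^T = 1] is made the first
basis vector, and the rest of its row and column is cleared by [E]. *)
Lemma sym_diag n (Q : 'M[C]_n) : Q^T = Q -> exists2 P : 'M[C]_n, P \in unitmx &
  exists2 k : nat, (k <= n)%N & P *m Q *m P^T = pid_mx k.
Proof.
elim: n Q => [|n IH] Q sQ.
  by exists 1%:M; [exact: unitmx1|exists 0%N => //; rewrite [LHS]flatmx0 [RHS]flatmx0].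
have [->|Q0] := eqVneq Q 0.
  exists 1%:M; [exact: unitmx1|exists 0%N => //].
  by rewrite mulmx0 mul0mx pid_mx_0.
have [v0 hv0] := sym_anisotropic sQ Q0.
pose k := (sqrtC ((v0 *m Q *m v0^T) 0 0))^-1.
pose v := k *: v0.
have hv : v *m Q *m v^T = 1%:M.
  apply/matrixP => i j; rewrite !ord1 /v linearZ /= -scalemxAr -!scalemxAl scalerA.
  rewrite mxE [RHS]mxE eqxx mulr1n /k -invfM -expr2 sqrtCK mulVf//.
have vn0 : v != 0.
  apply/eqP => v0E; move: hv; rewrite v0E !mul0mx => /matrixP /(_ 0 0).
  by rewrite !mxE eqxx /= => /eqP; rewrite eq_sym oner_eq0.
have [P1 uP1 hP1] : {g : 'M[C]_n.+1 | g \in unitmx &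
    (delta_mx 0 0 : 'rV[C]_n.+1) *m ((delta_mx 0 0 : 'rV[C]_n.+1)^T *m v) = delta_mx 0 0 *m g}.
  apply: complete_unitmx; rewrite mulmxA trmx_delta mul_delta_mx.
  have -> : delta_mx 0 0 = 1%:M :> 'M[C]_1.
    by apply/matrixP => i j; rewrite !ord1 !mxE.
  by rewrite mul1mx mxrank_delta rank_rV vn0.
have {}hP1 : row 0 P1 = v.
  rewrite rowE -hP1 mulmxA trmx_delta mul_delta_mx.
  have -> : delta_mx 0 0 = 1%:M :> 'M[C]_1.
    by apply/matrixP => i j; rewrite !ord1 !mxE.
  by rewrite mul1mx.
pose Q1 : 'M[C]_(1 + n) := P1 *m Q *m P1^T.
have sQ1 : Q1^T = Q1 by rewrite /Q1 !trmx_mul trmxK sQ mulmxA.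
have r0 : row 0 Q1 = v *m Q *m P1^T by rewrite /Q1 !row_mul hP1.
have Q1P : P1 *m Q *m P1^T = Q1 by [].
clearbody Q1.
have ul : ulsubmx Q1 = 1%:M.
  rewrite -hv; apply/matrixP => i j; rewrite !ord1.
  transitivity (row 0 Q1 0 0); first by rewrite !mxE; congr (Q1 _ _); apply: val_inj.
  rewrite r0 mxE [RHS]mxE; apply: eq_bigr => a _; congr (_ * _).
  by rewrite -hP1 !mxE.
have Q1E : Q1 = block_mx 1%:M (ursubmx Q1) (ursubmx Q1)^T (drsubmx Q1).
  have dl : dlsubmx Q1 = (ursubmx Q1)^T by rewrite trmx_ursub sQ1.
  by rewrite -[LHS]submxK ul dl.
set u := ursubmx Q1 in Q1E; set Q' := drsubmx Q1 in Q1E.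
pose E : 'M[C]_(1 + n) := block_mx 1%:M 0 (- u^T) 1%:M.
have uE : E \in unitmx by rewrite unitmxE det_lblock !det1 mulr1 unitr1.
have EQ : E *m Q1 *m E^T = block_mx 1%:M 0 0 (Q' - u^T *m u).
  have ET : E^T = block_mx 1%:M (- u) 0 1%:M.
    by rewrite /E tr_block_mx !trmx1 trmx0 [(- u^T)^T]raddfN /= trmxK.
  rewrite ET Q1E /E !mulmx_block.
  rewrite !(mul1mx, mulmx1, mul0mx, mulmx0, addr0, add0r, mulNmx, mulmxN).
  by rewrite !addNr mul0mx oppr0 add0r addrC.
have sQ' : (Q' - u^T *m u)^T = Q' - u^T *m u.
  by rewrite linearB /= trmx_mul trmxK /Q' trmx_drsub sQ1.
have [P2 uP2 [m mn hP2]] := IH _ sQ'.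
pose F : 'M[C]_(1 + n) := block_mx 1%:M 0 0 P2.
have uF : F \in unitmx by rewrite unitmxE det_lblock det1 mul1r -unitmxE.
exists (F *m E *m P1); first by rewrite !unitmx_mul uF uE uP1.
exists m.+1 => //.
have -> : F *m E *m P1 *m Q *m (F *m E *m P1)^T = F *m (E *m Q1 *m E^T) *m F^T.
  by rewrite -Q1P !trmx_mul !mulmxA.
rewrite EQ /F tr_block_mx !mulmx_block !trmx1 !trmx0.
rewrite !(mul1mx, mulmx1, mul0mx, mulmx0, addr0, add0r) hP2.
apply/matrixP => i j; rewrite [RHS]mxE; case: (@splitP 1 n i) => i' hi; case: (@splitP 1 n j) => j' hj.
- have -> : i = lshift n i' by apply: val_inj.
  have -> : j = lshift n j' by apply: val_inj.
  apply: (etrans (block_mxEul _ _ _ _ i' j')).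
  by rewrite mxE /= !ord1.
- have -> : i = lshift n i' by apply: val_inj.
  have -> : j = rshift 1 j' by apply: val_inj.
  apply: (etrans (block_mxEur _ _ _ _ i' j')).
  by rewrite mxE /= !ord1.
- have -> : i = rshift 1 i' by apply: val_inj.
  have -> : j = lshift n j' by apply: val_inj.
  apply: (etrans (block_mxEdl _ _ _ _ i' j')).
  by rewrite mxE /= !ord1.
- have -> : i = rshift 1 i' by apply: val_inj.
  have -> : j = rshift 1 j' by apply: val_inj.
  apply: (etrans (block_mxEdr _ _ _ _ i' j')).
  by rewrite mxE /= !add1n ltnS eqSS.
Qed.

Lemma sym_bilin_diag n (B : 'rV[C]_n -> 'rV[C]_n -> C) : sym_bilin B ->
  exists2 P : 'M[C]_n, P \in unitmx & exists2 k : nat, (k <= n)%N &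
    forall y, B (y *m P) (y *m P) = \sum_(j < n | (j < k)%N) y 0 j ^+ 2.
Proof.
move=> /sym_bilin_matrix[Q sQ BE]; have [P uP [k kn hP]] := sym_diag sQ.
exists P => //; exists k => // y.
rewrite BE trmx_mul.
have -> : y *m P *m Q *m (P^T *m y^T) = y *m (P *m Q *m P^T) *m y^T by rewrite !mulmxA.
rewrite hP mxE [RHS]big_mkcond /=; apply: eq_bigr => j _.
rewrite !mxE (bigD1 j) //= big1 ?addr0.
  by rewrite !mxE eqxx /=; case: ifP => _; rewrite ?mulr1 ?mulr0 ?mul0r ?expr2.
move=> i /eqP ij; rewrite !mxE; case: eqP => [h|]; last by rewrite mulr0.
by case: ij; apply: val_inj.
Qed.

End Diagonalization.

(** * Normal forms in the plane *)

Section Planar.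
Variable R : realType.
Local Notation C := (Cplx R).
Implicit Types (a b c s t x y z al be ga : C) (r : C -> C -> C).

Let sqr_i : 'i ^+ 2 = -1 :> C := sqrCi C.
Let i_neq0 : 'i != 0 :> C := neq0Ci C.
Let two0 : (2 : C) != 0.
Proof. by rewrite pnatr_eq0. Qed.

Ltac expand_conj :=
  rewrite ?ReE ?ImE !(conjcD, conjcB, conjcN, conjcM, conjcX, conjcV, conjCi, conjCK, conjc_nat, conjC1, conjC0).

Definition row2 x y : 'rV[C]_2 := \row_j (if j == 0 then x else y).

Lemma row2_0 x y : row2 x y 0 0 = x. Proof. by rewrite mxE. Qed.
Lemma row2_1 x y : row2 x y 0 1 = y. Proof. by rewrite mxE. Qed.

Definition planar_normal_form (M' : set 'rV[C]_2) : Prop :=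
  (exists A B : R, [/\ 0 <= B, B <= A, A <= 1 \/ A = B & M' = M11_1 A B])
  \/ (exists A : Cplx R, [/\ 0 < 'Re A, 0 <= 'Im A & M' = M11_2 A])
  \/ M' = @M11_3 R
  \/ (exists A : R, 0 < A /\ M' = M11_4 A)
  \/ M' = @M10_2 R
  \/ M' = @M00_1 R.

(** The cone of [r] in the plane becomes one of the normal forms after a linear
change of coordinates. *)
Definition normalizable r := exists2 M', planar_normal_form M' &
  exists a b c d, a * d - b * c != 0 /\
    forall s t, r s t = 0 <-> M' (row2 (a * s + b * t) (c * s + d * t)).

Lemma normalizable_subst r r' (k a b c d : C) : k != 0 -> a * d - b * c != 0 ->
  (forall s t, r s t = k * r' (a * s + b * t) (c * s + d * t)) -> normalizable r' -> normalizable r.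
Proof.
move=> k0 d0 h [M' nM' [a' [b' [c' [d' [d'0 h']]]]]].
exists M' => //; exists (a' * a + b' * c), (a' * b + b' * d), (c' * a + d' * c), (c' * b + d' * d).
split.
  have -> : (a' * a + b' * c) * (c' * b + d' * d) - (a' * b + b' * d) * (c' * a + d' * c) =
    (a' * d' - b' * c') * (a * d - b * c) by ring.
  by rewrite mulf_neq0.
move=> s t; rewrite h.
have -> : (k * r' (a * s + b * t) (c * s + d * t) = 0) <-> (r' (a * s + b * t) (c * s + d * t) = 0).
  split=> [/eqP|->]; last by rewrite mulr0.
  by rewrite mulf_eq0 (negbTE k0) => /eqP.
rewrite h'; have -> // : row2 (a' * (a * s + b * t) + b' * (c * s + d * t))
   (c' * (a * s + b * t) + d' * (c * s + d * t)) =
 row2 ((a' * a + b' * c) * s + (a' * b + b' * d) * t)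
   ((c' * a + d' * c) * s + (c' * b + d' * d) * t).
by congr row2; ring.
Qed.

Lemma phase a : exists2 m : C, m * m^* = 1 & a = ofReal (nrm a) * m ^+ 2.
Proof.
have [->|a0] := eqVneq a 0; first by exists 1; rewrite ?conjC1 ?mulr1// nrm0 ofReal0 mul0r.
have n0 : `|a| != 0 by rewrite normr_eq0.
exists (sqrtC (a / `|a|)); last by rewrite sqrtCK -normCE mulrC divfK.
have h : `|sqrtC (a / `|a|)| = 1.
  apply/eqP; rewrite -(@eqrXn2 _ 2) ?normr_ge0// -normrX sqrtCK expr1n.
  by rewrite normrM normfV normr_id divff.
by rewrite -normCK h expr1n.
Qed.

Definition rho_diag a b s t : C := 'Re (a * s ^+ 2 + b * t ^+ 2) + s * s^* - t * t^*.
(** The hermitian part [Im (s (conj t))] is invariant under real matrices of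
determinant 1 and under multiplication of both coordinates by a unit number. *)
Definition rho_im al be ga s t : C :=
  'Re (al * s ^+ 2 + 2 * be * s * t + ga * t ^+ 2) + 'Im (s * t^*).

Lemma unit_conj (m : C) : m * m^* = 1 -> m != 0 /\ m^* = m^-1.
Proof.
move=> h; have m0 : m != 0.
  by apply/eqP => m0; move: h; rewrite m0 mul0r => /eqP; rewrite eq_sym oner_eq0.
by split=> //; apply: (mulfI m0); rewrite h divff.
Qed.

Lemma normalizable_rho_diag_le a b : nrm b <= nrm a -> nrm a <= 1 \/ nrm a = nrm b -> normalizable (rho_diag a b).
Proof.
move=> ba h; exists (M11_1 (nrm a) (nrm b)).
  by left; exists (nrm a), (nrm b); split => //; exact: nrm_ge0.
have [m m1 ea] := phase a; have [m' m'1 eb] := phase b.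
have [m0 mc] := unit_conj m1; have [m'0 m'c] := unit_conj m'1.
exists m, 0, 0, m'; split; first by rewrite mulr0 subr0 mulf_neq0.
move=> s t; rewrite /M11_1 /= row2_0 row2_1 mul0r addr0 mul0r add0r.
rewrite /rho_diag {1}ea {1}eb !exprMn !mulrA !normCK.
have -> : m * s * (m * s)^* = s * s^* by rewrite conjcM mc; field.
by have -> : m' * t * (m' * t)^* = t * t^* by rewrite conjcM m'c; field.
Qed.

(** If the second coefficient is the larger one, [- rho] with the coordinates
exchanged and multiplied by [i] has the coefficients in the right order. *)
Lemma normalizable_rho_diag a b : (nrm b <= nrm a -> nrm a <= 1 \/ nrm a = nrm b) ->
  (nrm a <= nrm b -> nrm b <= 1 \/ nrm a = nrm b) -> normalizable (rho_diag a b).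
Proof.
move=> h1 h2; have [ba|ab] := leP (nrm b) (nrm a); first by apply: normalizable_rho_diag_le => //; exact: h1.
have g : normalizable (rho_diag b a).
  apply: normalizable_rho_diag_le; first exact: ltW.
  by case: (h2 (ltW ab)) => [|->]; [left|right].
apply: (normalizable_subst (k := -1) (a := 0) (b := 'i) (c := 'i) (d := 0) _ _ _ g).
- by rewrite oppr_eq0 oner_eq0.
- by rewrite mulr0 sub0r -expr2 sqrCi opprK oner_eq0.
move=> s t; rewrite /rho_diag !mul0r add0r addr0 !ReE !(conjcD, conjcM, conjcX, conjCi).
by field: sqr_i.
Qed.

(** With [s = x + y] and [t = - i (x - y)] the product [s t] becomes a multiple of
[x^2 - y^2] and [Im (s (conj t))] becomes [|x|^2 - |y|^2]. *)
Lemma normalizable_product be : normalizable (rho_im 0 be 0).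
Proof.
have g : normalizable (rho_diag (- (2 * 'i * be)) (2 * 'i * be)).
  by apply: normalizable_rho_diag; right; rewrite nrmN.
apply: (normalizable_subst (k := 1) (a := 1 / 2) (b := 'i / 2) (c := 1 / 2) (d := - 'i / 2) _ _ _ g).
- exact: oner_neq0.
- have -> : 1 / 2 * (- 'i / 2) - 'i / 2 * (1 / 2) = - 'i / 2 :> C by field.
  by rewrite mulf_neq0 ?oppr_eq0// invr_eq0.
move=> s t; rewrite /rho_im /rho_diag; expand_conj.
by field: sqr_i.
Qed.

Lemma normalizable_square_s al : normalizable (rho_im al 0 0).
Proof.
have [->|al0] := eqVneq al 0; first exact: normalizable_product.
pose m := sqrtC al.
have m2 : al = m ^+ 2 by rewrite sqrtCK.
have m0 : m != 0 by rewrite sqrtC_eq0.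
have mc0 : m^* != 0 by rewrite conjC_eq0.
exists (@M11_3 R); first by right; right; left.
exists m, 0, 0, (m^*)^-1; split; first by rewrite mulr0 subr0 mulf_neq0 ?invr_eq0.
move=> s t; rewrite /M11_3 /= row2_0 row2_1 mul0r addr0 mul0r add0r m2.
have -> // : 'Re ((m * s) ^+ 2) + 'Im (m * s * ((m^*)^-1 * t)^*) = rho_im (m ^+ 2) 0 0 s t.
rewrite /rho_im; expand_conj.
by field; rewrite m0.
Qed.

Lemma normalizable_swap al be ga : normalizable (rho_im ga (- be) al) -> normalizable (rho_im al be ga).
Proof.
move=> g; apply: (normalizable_subst (k := 1) (a := 0) (b := 1) (c := -1) (d := 0) _ _ _ g).
- exact: oner_neq0.
- by rewrite mul0r sub0r mul1r opprK oner_eq0.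
by move=> s t; rewrite /rho_im; expand_conj; field.
Qed.

Lemma root4 z : exists w : C, w ^+ 4 = z.
Proof. by exists (sqrtC (sqrtC z)); rewrite (exprM _ 2 2) !sqrtCK. Qed.

Lemma normalizable_conj_squares A : 0 < 'Re A -> normalizable (rho_im A 0 A^*).
Proof.
have base (A' : C) : 0 < 'Re A' -> 0 <= 'Im A' -> normalizable (rho_im A' 0 A'^*).
  move=> h1 h2; exists (M11_2 A'); first by right; left; exists A'.
  exists 1, 0, 0, 1; split; first by rewrite mulr1 mulr0 subr0 oner_neq0.
  move=> s t; rewrite /M11_2 /= row2_0 row2_1 !mul0r !mul1r addr0 add0r /rho_im.
  by have -> : A' * s ^+ 2 + 2 * 0 * s * t + A'^* * t ^+ 2 = A' * s ^+ 2 + A'^* * t ^+ 2 by ring.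
move=> hA; have [hI|hI] := real_leP (real0 C) (Creal_Im A); first exact: base.
apply: normalizable_swap; rewrite oppr0 -{2}[A]conjCK; apply: base; first by rewrite Re_conj.
by rewrite Im_conj oppr_ge0 ltW.
Qed.

(** The change [s = m s'], [t = t' / conj m] preserves [Im (s (conj t))]. *)
Lemma normalizable_scale al be ga (m : C) : m != 0 ->
  normalizable (rho_im (al * m ^+ 2) (be * m / m^*) (ga / m^* ^+ 2)) -> normalizable (rho_im al be ga).
Proof.
move=> m0 g; have mc0 : m^* != 0 by rewrite conjC_eq0.
apply: (normalizable_subst (k := 1) (a := m^-1) (b := 0) (c := 0) (d := m^*) _ _ _ g).
- exact: oner_neq0.
- by rewrite mulr0 subr0 mulf_neq0 ?invr_eq0.
by move=> s t; rewrite /rho_im; expand_conj; field; rewrite m0 mc0.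
Qed.

(** A scaling by a fourth root of [conj ga / al] makes the coefficients
conjugate; multiplication of both coordinates by [i] changes their sign, so
their real part may be taken nonnegative.  If it is 0 the form is a multiple of
[s^2 - t^2], a product. *)
Lemma normalizable_two_squares al ga : normalizable (rho_im al 0 ga).
Proof.
have [->|ga0] := eqVneq ga 0; first exact: normalizable_square_s.
have [->|al0] := eqVneq al 0.
  by apply: normalizable_swap; rewrite oppr0; exact: normalizable_square_s.
have [w w4] := root4 (ga^* / al).
have w0 : w != 0.
  apply/eqP => w0; move: w4; rewrite w0 expr0n /= => /esym/eqP.
  by rewrite mulf_eq0 conjC_eq0 invr_eq0 (negbTE ga0) (negbTE al0).
have wc0 : w^* != 0 by rewrite conjC_eq0.
apply: (normalizable_scale w0); rewrite !mul0r.
set A := al * w ^+ 2.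
have -> : ga / w^* ^+ 2 = A^*.
  have : (w ^+ 4)^* = ga / al^* by rewrite w4; expand_conj.
  rewrite conjcX => h.
  have alc : al^* != 0 by rewrite conjC_eq0.
  rewrite /A conjcM conjcX.
  have -> : ga = (w^*) ^+ 4 * al^* by rewrite h divfK.
  by field.
have [h|h|h] := real_ltgtP (real0 C) (Creal_Re A); first exact: normalizable_conj_squares.
  apply: (normalizable_scale i_neq0); rewrite !mul0r.
  have -> : A * 'i ^+ 2 = - A by rewrite sqr_i; ring.
  have -> : A^* / 'i^* ^+ 2 = (- A)^*.
    by rewrite conjCi conjcN sqrrN sqr_i; field.
  by apply: normalizable_conj_squares; rewrite raddfN /= oppr_gt0.
have Ac : A^* = - A.
  have := ReE A; rewrite -h => /esym/eqP; rewrite mulf_eq0 invr_eq0 (negbTE two0) orbF.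
  by rewrite addrC addr_eq0 => /eqP.
rewrite Ac.
apply: (normalizable_subst (k := 1) (a := 1) (b := -1) (c := 1 / 2) (d := 1 / 2) _ _ _ (normalizable_product A)).
- exact: oner_neq0.
- have -> : 1 * (1 / 2) - -1 * (1 / 2) = 1 :> C by field.
  exact: oner_neq0.
by move=> s t; rewrite /rho_im; expand_conj; field.
Qed.

(** A rotation makes the coefficient of [s t] a positive multiple of [i]; then a
real shear [t = t' + x s] makes that of [s^2] real.  Its sign can be changed by
passing to [- rho]. *)
Lemma normalizable_isotropic al be : normalizable (rho_im al be 0).
Proof.
have [->|be0] := eqVneq be 0; first exact: normalizable_square_s.
have base4 (a y : R) : a != 0 -> 0 < y -> normalizable (rho_im (ofReal a) (ofReal y * 'i / 2) 0).
  move=> a0 y0.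
  have pos (a' : R) : 0 < a' -> normalizable (rho_im (ofReal a') (ofReal y * 'i / 2) 0).
    move=> a'0; pose m : R := Num.sqrt a'.
    have m0 : 0 < m by rewrite sqrtr_gt0.
    have mm : ofReal a' = ofReal m ^+ 2 :> C.
      by rewrite expr2 -ofRealM -expr2 sqr_sqrtr// ltW.
    have m0' : ofReal m != 0 :> C by rewrite -ofReal0 (inj_eq (@ofReal_inj R)) gt_eqF.
    exists (M11_4 y); first by right; right; right; left; exists y.
    exists (ofReal m), 0, 0, (ofReal m)^-1; split.
      by rewrite mulr0 subr0 divff// oner_neq0.
    move=> s t; rewrite /M11_4 /= row2_0 row2_1 !mul0r addr0 add0r mm.
    set X := (X in _ <-> X = 0).
    have -> // : rho_im (ofReal m ^+ 2) (ofReal y * 'i / 2) 0 s t = X.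
    rewrite /X /rho_im; expand_conj; rewrite !ofReal_conj.
    by field; rewrite m0'.
  have [a1|a1] := ltP a 0; last by apply: pos; rewrite lt_def a0.
  have na : 0 < - a by rewrite oppr_gt0.
  apply: (normalizable_subst (k := -1) (a := 1) (b := 0) (c := 0) (d := -1) _ _ _ (pos _ na)).
    - by rewrite oppr_eq0 oner_neq0.
    - by rewrite mulr0 subr0 mul1r oppr_eq0 oner_neq0.
    move=> s t; rewrite /rho_im.
    have -> : ofReal (- a) = - ofReal a by rewrite /ofReal; apply/eqP; rewrite complex.eq_complex /= oppr0 !eqxx.
    by expand_conj; rewrite !ofReal_conj; field.
have [m m1 hm] := phase ('i / (2 * be)).
have [m0 mc] := unit_conj m1.
have nb0 : nrm ('i / (2 * be)) != 0.
  by rewrite nrm_eq0 mulf_neq0// invr_eq0 mulf_neq0.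
set k := nrm _ in hm nb0.
have kp : 0 < k by rewrite lt_def nb0 nrm_ge0.
have k0' : ofReal k != 0 :> C by rewrite -ofReal0 (inj_eq (@ofReal_inj R)).
apply: (normalizable_scale m0); rewrite mul0r.
have -> : be * m / m^* = ofReal k^-1 * 'i / 2.
  have -> : ofReal k^-1 = (ofReal k)^-1 :> C.
    by apply: (mulfI k0'); rewrite -ofRealM divff// divff.
  have -> : be * m / m^* = be * m ^+ 2 by rewrite mc; field.
  apply: (mulfI k0'); rewrite mulrCA -hm; field; rewrite k0'; exact: be0.
set a := al * m ^+ 2; set y := k^-1.
have y0 : 0 < y by rewrite invr_gt0.
have y0' : ofReal y != 0 :> C by rewrite -ofReal0 (inj_eq (@ofReal_inj R)) gt_eqF.
pose x : R := - cIm a / y.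
have ay : a = ofReal (cRe a) - ofReal y * ofReal x * 'i.
  have -> : ofReal y * ofReal x = - ofReal (cIm a) :> C.
    rewrite -ofRealM /x mulrCA divff ?gt_eqF// mulr1.
    by rewrite /ofReal; apply/eqP; rewrite complex.eq_complex /= oppr0 !eqxx.
  by rewrite {1}(cRect a); ring.
have g : normalizable (rho_im (ofReal (cRe a)) (ofReal y * 'i / 2) 0).
  have [a0|a0] := eqVneq (cRe a) 0; last exact: base4.
  by rewrite a0; exact: normalizable_product.
apply: (normalizable_subst (k := 1) (a := 1) (b := 0) (c := - ofReal x) (d := 1) _ _ _ g).
- exact: oner_neq0.
- by rewrite mul0r mulr1 subr0 oner_neq0.
move=> s t; rewrite {1}ay /rho_im; expand_conj; rewrite !ofReal_conj.
by field.
Qed.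

Definition supports_line (q h : C -> C -> C) :=
  exists s t, ((s != 0) || (t != 0)) /\ `|q s t| <= h s t.

(** If [|a| > 1] and [|a| > |b|] then [|a s^2 + b t^2| > |s|^2 - |t|^2] for all
[(s, t) <> 0]. *)
Lemma supports_diag_cond a b :
  supports_line (fun s t => a * s ^+ 2 + b * t ^+ 2) (fun s t => s * s^* - t * t^*) ->
  nrm b <= nrm a -> nrm a <= 1 \/ nrm a = nrm b.
Proof.
move=> [s [t [st]]] h ba.
have [|a1] := leP (nrm a) 1; first by left.
right; apply/eqP; rewrite eq_le ba andbT leNgt; apply/negP => ab.
have x0 := nrm_ge0 s; have y0 := nrm_ge0 t.
have h1 : nrm (a * s ^+ 2 + b * t ^+ 2) <= nrm s ^+ 2 - nrm t ^+ 2.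
  rewrite -le_ofReal -normCE; apply: le_trans h _.
  by rewrite !mul_conj_nrm /ofReal; rewrite complex.lecE /= subr0 !eqxx lexx.
have h2 : nrm (a * s ^+ 2) <= nrm (a * s ^+ 2 + b * t ^+ 2) + nrm (b * t ^+ 2).
  by rewrite -[X in nrm X <= _](addrK (b * t ^+ 2)) -(nrmN (b * t ^+ 2)); exact: nrmD.
have h3 := nrm_ge0 (a * s ^+ 2 + b * t ^+ 2).
move: h2; rewrite !expr2 !nrmM -!expr2 => h2.
have b0 := nrm_ge0 b.
have xy : nrm t ^+ 2 <= nrm s ^+ 2 by lra.
have xp : 0 < nrm s ^+ 2.
  rewrite lt_def sqr_ge0 andbT; apply/eqP => s2; move: st.
  have t2 : nrm t ^+ 2 = 0 by apply/eqP; rewrite eq_le sqr_ge0 andbT -s2.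
  move: s2 t2 => /eqP; rewrite sqrf_eq0 nrm_eq0 => -> /eqP.
  by rewrite sqrf_eq0 nrm_eq0 => ->.
have ty := sqr_ge0 (nrm t).
move: (nrm s ^+ 2) (nrm t ^+ 2) xy xp ty h1 h2 => X Y xy xp ty h1 h2.
have k1 : (nrm a - 1) * X <= (nrm b - 1) * Y by lra.
have [bb|bb] := leP (nrm b) 1.
  have : 0 < (nrm a - 1) * X by rewrite mulr_gt0// subr_gt0.
  have : (nrm b - 1) * Y <= 0 by rewrite mulr_le0_ge0// subr_le0.
  lra.
have : (nrm b - 1) * Y <= (nrm b - 1) * X by rewrite ler_wpM2l// subr_ge0 ltW.
have : (nrm b - 1) * X < (nrm a - 1) * X by rewrite ltr_pM2r// ltrD2r.
lra.
Qed.

Lemma normalizable_rho_diag_supports a b :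
  supports_line (fun s t => a * s ^+ 2 + b * t ^+ 2) (fun s t => s * s^* - t * t^*) ->
  supports_line (fun s t => a * s ^+ 2 + b * t ^+ 2) (fun s t => - (s * s^* - t * t^*)) ->
  normalizable (rho_diag a b).
Proof.
move=> h1 [s [t [st h2]]]; apply: normalizable_rho_diag; first exact: supports_diag_cond.
move=> ab; have : nrm b <= 1 \/ nrm b = nrm a; last by case=> ->; [left|right].
apply: supports_diag_cond => //; exists t, s; split; first by rewrite orbC.
by rewrite addrC -opprB.
Qed.

(** These are two real linear equations in three real unknowns.  In terms of the
form [p X^2 + 2 r X Y + s Y^2] with roots [xi] and [eta], the relation says that
[xi] and [eta] are orthogonal for the form with coefficients [al], [be], [ga]. *)
Lemma real_apolar al be ga : exists p r s : R,
  ((p != 0) || (r != 0) || (s != 0)) /\ al * ofReal s + ga * ofReal p = 2 * be * ofReal r.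
Proof.
pose f (i : 'I_3) : C := [eta fun=> ga with (1 : 'I_3) |-> - (2 * be), (2%:R : 'I_3) |-> al] i.
pose A : 'M[R]_(3, 2) := \matrix_(i, j) (if j == 0 then cRe (f i) else cIm (f i)).
have : kermx A != 0.
  by rewrite -mxrank_eq0 mxrank_ker subn_eq0 -ltnNge ltnS rank_leq_col.
move=> /rowV0Pn[v /sub_kermxP vA v0].
have eq0 : \sum_i ofReal (v 0 i) * f i = 0.
  have h0 := congr1 (fun M : 'M[R]_(1, 2) => M 0 0) vA.
  have h1 := congr1 (fun M : 'M[R]_(1, 2) => M 0 1) vA.
  move: h0 h1; rewrite /= !mxE => h0 h1.
  rewrite [LHS]cx_eta cRe_sum.
  have cIm_sum (F : 'I_3 -> C) : cIm (\sum_i F i) = \sum_i cIm (F i).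
    by elim: (index_enum _) => [|i l IH]; rewrite ?big_nil // !big_cons cImD IH.
  rewrite cIm_sum.
  have -> : \sum_i cRe (ofReal (v 0 i) * f i) = 0.
    rewrite -[RHS]h0; apply: eq_bigr => i _; rewrite !mxE /= cReM /=; ring.
  have -> : \sum_i cIm (ofReal (v 0 i) * f i) = 0.
    rewrite -[RHS]h1; apply: eq_bigr => i _; rewrite !mxE /= cImM /=; ring.
  by [].
exists (v 0 0), (v 0 1), (v 0 2%:R); split.
  apply: contraT; rewrite !negb_or !negbK => /andP[/andP[/eqP e0 /eqP e1] /eqP e2].
  case/negP: v0; apply/eqP/rowP => i; rewrite mxE.
  by case: i => -[|[|[|//]]] h; [rewrite -[RHS]e0|rewrite -[RHS]e1|rewrite -[RHS]e2];
    congr (v _ _); apply: val_inj.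
move: eq0; rewrite 3!big_ord_recl big_ord0 addr0 => eq0.
have e0 : ofReal (v 0 0) * ga + (ofReal (v 0 1) * - (2 * be) + ofReal (v 0 2%:R) * al) = 0.
  rewrite -[RHS]eq0; congr (_ * _ + (_ * _ + _ * _)); rewrite ?/f //=;
  congr (ofReal (v _ _)); apply: val_inj => //.
apply/eqP; rewrite -subr_eq0 -[X in _ == X]e0; apply/eqP; ring.
Qed.

Lemma normalizable_shift_s (x : R) al be ga :
  normalizable (rho_im al (be - al * ofReal x) (ga - 2 * be * ofReal x + al * ofReal x ^+ 2)) ->
  normalizable (rho_im al be ga).
Proof.
move=> g; apply: (normalizable_subst (k := 1) (a := 1) (b := ofReal x) (c := 0) (d := 1) _ _ _ g).
- exact: oner_neq0.
- by rewrite mulr0 mulr1 subr0 oner_neq0.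
by move=> s t; rewrite /rho_im; expand_conj; rewrite !ofReal_conj; field.
Qed.

Lemma normalizable_isotropic_t be ga : normalizable (rho_im 0 be ga).
Proof. by apply: normalizable_swap; exact: normalizable_isotropic. Qed.

(** When the roots of the apolar form are real and distinct, they form a real
basis, orthogonal for the quadratic part. *)
Lemma normalizable_rho_im_split (w : R) al be : w != 0 -> normalizable (rho_im al be (al * ofReal w ^+ 2)).
Proof.
rewrite -ofReal_neq0 => w0.
apply: (normalizable_subst (k := 1) (a := 1) (b := ofReal w) (c := - (2 * ofReal w)^-1) (d := 1 / 2) _ _ _
  (normalizable_two_squares (al / 2 + be / (2 * ofReal w)) (2 * ofReal w ^+ 2 * al - 2 * ofReal w * be))).
- exact: oner_neq0.
- have -> : 1 * (1 / 2) - ofReal w * - (2 * ofReal w)^-1 = 1 :> C by field.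
  exact: oner_neq0.
by move=> s t; rewrite /rho_im; expand_conj; rewrite !ofReal_conj; field.
Qed.

(** When the roots [zeta], [zeta'] of the apolar form are complex conjugate, the
corresponding coordinates diagonalise both the quadratic and the hermitian
part. *)
Lemma normalizable_rho_im_definite (r w : R) al be : 0 < w ->
  let q s t := al * s ^+ 2 + 2 * be * s * t + (2 * be * ofReal r - al * (ofReal r ^+ 2 + ofReal w ^+ 2)) * t ^+ 2 in
  supports_line q (fun s t => 'Im (s * t^*)) -> supports_line q (fun s t => - 'Im (s * t^*)) ->
  normalizable (rho_im al be (2 * be * ofReal r - al * (ofReal r ^+ 2 + ofReal w ^+ 2))).
Proof.
move=> wp q hp hm.
have w0 : ofReal w != 0 :> C by rewrite ofReal_neq0 gt_eqF.
have w4 : 4 * ofReal w != 0 :> C by rewrite mulf_neq0// pnatr_eq0.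
have w4p : 0 < 4 * ofReal w :> C by rewrite mulr_gt0// -ofReal0 lt_ofReal.
pose zeta := ofReal r + 'i * ofReal w; pose zeta' := ofReal r - 'i * ofReal w.
have ezz : zeta' - zeta != 0.
  have -> : zeta' - zeta = - 2 * 'i * ofReal w by rewrite /zeta /zeta'; ring.
  by rewrite !mulf_neq0// oppr_eq0.
pose be' := be - al * ofReal r.
pose a := 2 * ofReal w * al - 2 * 'i * be'; pose b := 2 * ofReal w * al + 2 * 'i * be'.
have qE s t : a * (s + zeta * t) ^+ 2 + b * (s + zeta' * t) ^+ 2 = 4 * ofReal w * q s t.
  rewrite /q /a /b /be' /zeta /zeta'; ring: sqr_i.
have hE s t : (s + zeta * t) * (s + zeta * t)^* - (s + zeta' * t) * (s + zeta' * t)^* =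
    4 * ofReal w * 'Im (s * t^*).
  by rewrite /zeta /zeta'; expand_conj; rewrite !ofReal_conj; field: sqr_i.
have nz s t : (s != 0) || (t != 0) -> (s + zeta * t != 0) || (s + zeta' * t != 0).
  move=> st; apply: contraT; rewrite negb_or !negbK => /andP[/eqP h1 /eqP h2].
  have t0 : t = 0.
    apply: (mulfI ezz); rewrite mulr0.
    have -> : (zeta' - zeta) * t = (s + zeta' * t) - (s + zeta * t) by ring.
    by rewrite h1 h2 subrr.
  by move: h1 st; rewrite t0 mulr0 addr0 => ->; rewrite eqxx.
have g : normalizable (rho_diag a b).
  apply: normalizable_rho_diag_supports.
    have [s [t [st h]]] := hp; exists (s + zeta * t), (s + zeta' * t); split; first exact: nz.
    by rewrite qE hE normrM (gtr0_norm w4p) ler_pM2l.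
  have [s [t [st h]]] := hm; exists (s + zeta * t), (s + zeta' * t); split; first exact: nz.
  by rewrite qE hE normrM (gtr0_norm w4p) -mulrN ler_pM2l.
apply: (normalizable_subst (k := (4 * ofReal w)^-1) (a := 1) (b := zeta) (c := 1) (d := zeta') _ _ _ g).
- by rewrite invr_eq0.
- by rewrite mulr1 mul1r.
move=> s t; rewrite !mul1r /rho_diag -addrA hE qE.
have -> : 'Re (4 * ofReal w * q s t) = 4 * ofReal w * 'Re (q s t).
  by expand_conj; rewrite !ofReal_conj; field.
rewrite -mulrDr mulrA mulVf// mul1r.
by rewrite /rho_im /q.
Qed.

(** The discriminant [D] of the apolar form decides between the three cases. *)
Theorem normalizable_rho_im al be ga :
  let q s t := al * s ^+ 2 + 2 * be * s * t + ga * t ^+ 2 in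
  supports_line q (fun s t => 'Im (s * t^*)) -> supports_line q (fun s t => - 'Im (s * t^*)) ->
  normalizable (rho_im al be ga).
Proof.
move=> /=.
have [p [r [s [prs]]]] := real_apolar al be ga.
have [pz|p0] := eqVneq p 0.
  rewrite pz eqxx /= in prs; rewrite pz ofReal0 mulr0 addr0 => e _ _.
  have [r0|r0] := eqVneq r 0.
    have s0 : s != 0.
      by apply: contraT => /negPn/eqP s0; move: prs; rewrite r0 s0 eqxx.
    have -> : al = 0.
      by move: e; rewrite r0 ofReal0 mulr0 => /eqP; rewrite mulf_eq0 ofReal_eq0 (negbTE s0) orbF => /eqP.
    exact: normalizable_isotropic_t.
  have r0' : ofReal r != 0 :> C by rewrite ofReal_neq0.
  apply: (@normalizable_shift_s (s / (2 * r))).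
  have xE : ofReal (s / (2 * r)) = ofReal s / (2 * ofReal r) :> C.
    rewrite ofRealM ofRealV ofRealM; congr (_ / (_ * _)).
    exact: (rmorph_nat (complex.real_complex R) 2).
  have -> : be - al * ofReal (s / (2 * r)) = 0.
    have -> : al * ofReal (s / (2 * r)) = be by rewrite xE mulrA e; field.
    by rewrite subrr.
  exact: normalizable_two_squares.
move=> e.
pose rr := r / p; pose D := rr ^+ 2 - s / p.
have p0' : ofReal p != 0 :> C by rewrite ofReal_neq0.
have DE : ofReal D = ofReal rr ^+ 2 - ofReal s / ofReal p :> C.
  by rewrite /D -[X in ofReal X]/(rr ^+ 2 + - (s / p)) ofRealD ofRealN ofRealM ofRealV expr2 ofRealM -expr2.
have rE : ofReal rr = ofReal r / ofReal p :> C by rewrite /rr ofRealM ofRealV.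
have gaE : ga = 2 * be * ofReal rr - al * (ofReal rr ^+ 2 - ofReal D).
  apply: (mulfI p0'); rewrite DE rE.
  have -> : ofReal p * ga = 2 * be * ofReal r - al * ofReal s by rewrite -e; ring.
  by field.
have [D0|D0] := leP 0 D.
  move=> _ _; apply: (@normalizable_shift_s rr).
  have -> : ga - 2 * be * ofReal rr + al * ofReal rr ^+ 2 = al * ofReal D by rewrite {1}gaE; ring.
  have [->|Dn0] := eqVneq D 0; first by rewrite ofReal0 mulr0; exact: normalizable_isotropic.
  have -> : ofReal D = ofReal (Num.sqrt D) ^+ 2 :> C.
    by rewrite expr2 -ofRealM -expr2 sqr_sqrtr.
  by apply: normalizable_rho_im_split; rewrite gt_eqF// sqrtr_gt0 lt_def Dn0.
have wD : ofReal D = - ofReal (Num.sqrt (- D)) ^+ 2 :> C.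
  by rewrite expr2 -ofRealM -expr2 sqr_sqrtr ?oppr_ge0 ?ltW// ofRealN opprK.
have wp : 0 < Num.sqrt (- D) by rewrite sqrtr_gt0 oppr_gt0.
move: gaE; rewrite wD opprK => ->.
exact: normalizable_rho_im_definite.
Qed.

(** The coordinates [s + t] and [- i (s - t)] turn [|s|^2 - |t|^2] into
[Im (s (conj t))]. *)
Theorem normalizable_hyperbolic al be ga :
  let q s t := al * s ^+ 2 + 2 * be * s * t + ga * t ^+ 2 in
  supports_line q (fun s t => s * s^* - t * t^*) ->
  supports_line q (fun s t => - (s * s^* - t * t^*)) ->
  normalizable (fun s t => 'Re (q s t) + (s * s^* - t * t^*)).
Proof.
move=> q hp hm.
(* coefficients in the coordinates x = s + t, y = - i (s - t) *)
pose al' := (al + 2 * be + ga) / 4; pose ga' := - (al - 2 * be + ga) / 4.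
pose be' := 'i * (al - ga) / 4.
pose q' s t := al' * s ^+ 2 + 2 * be' * s * t + ga' * t ^+ 2.
have qE s t : q s t = q' (s + t) (- 'i * (s - t)).
  by rewrite /q /q' /al' /be' /ga'; field: sqr_i.
have hE s t : s * s^* - t * t^* = 'Im ((s + t) * (- 'i * (s - t))^*).
  by expand_conj; field: sqr_i.
have nz s t : (s != 0) || (t != 0) -> (s + t != 0) || (- 'i * (s - t) != 0).
  move=> st; apply: contraT; rewrite negb_or !negbK mulf_eq0 oppr_eq0 (negbTE i_neq0) /=.
  rewrite subr_eq0 => /andP[h1 /eqP h2]; move: h1 st; rewrite h2 -mulr2n mulrn_eq0 /= => /eqP ->.
  by rewrite eqxx.
have g : normalizable (rho_im al' be' ga').
  apply: normalizable_rho_im.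
    have [s [t [st h]]] := hp; exists (s + t), (- 'i * (s - t)); split; first exact: nz.
    by rewrite -hE -/(q' _ _) -qE.
  have [s [t [st h]]] := hm; exists (s + t), (- 'i * (s - t)); split; first exact: nz.
  by rewrite -hE -/(q' _ _) -qE.
apply: (normalizable_subst (k := 1) (a := 1) (b := 1) (c := - 'i) (d := 'i) _ _ _ g).
- exact: oner_neq0.
- have -> : 1 * 'i - 1 * - 'i = 2 * 'i :> C by ring.
  by rewrite mulf_neq0.
move=> s t; rewrite hE qE mul1r !mul1r.
by have -> : - 'i * s + 'i * t = - 'i * (s - t) by ring.
Qed.

End Planar.

(** * Hermitian part of signature (1, 1) *)

Section Hyperbolic.
Variables (R : realType) (n : nat).
Local Notation C := (Cplx R).
Local Notation V := 'rV[C]_n.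
Implicit Types (B S : V -> V -> C) (x y : V -> C) (e u v w z : V) (s t c : C).

Definition cone_of B S : set V := [set z | 'Re (B z z) + S z z = 0].

Lemma sym_bilin_expand B : sym_bilin B -> forall s t a b u,
  B (s *: a + t *: b + u) (s *: a + t *: b + u) =
  s ^+ 2 * B a a + 2 * s * t * B a b + t ^+ 2 * B b b +
    2 * s * B a u + 2 * t * B b u + B u u.
Proof.
move=> sB s t a b u.
have := sym_bilinE sB 1 1 (s *: a + t *: b) u; rewrite !scale1r => ->.
have [_ c] := sB.
rewrite sym_bilinE// (c _ u) (linear_formD (sym_bilin_linear sB u)).
rewrite !(linear_formZ (sym_bilin_linear sB u)) !(c u); ring.
Qed.

Definition hyperbolic_coords S (x1 x2 : V -> C) e1 e2 :=
  [/\ linear_form x1, linear_form x2, x1 e1 = 1 /\ x2 e1 = 0, x1 e2 = 0 /\ x2 e2 = 1 &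
    forall z, S z z = x1 z * (x1 z)^* - x2 z * (x2 z)^*].

Lemma hyperbolic_coords_opp S x1 x2 e1 e2 : hyperbolic_coords S x1 x2 e1 e2 ->
  hyperbolic_coords (fun u v => - S u v) x2 x1 e2 e1.
Proof. by move=> [l1 l2 [? ?] [? ?] h]; split => // z; rewrite h opprB. Qed.

Section Coords.
Variables (B S : V -> V -> C) (x1 x2 : V -> C) (e1 e2 : V).
Hypotheses (sB : sym_bilin B) (sup : supports B S) (hyp : hyperbolic_coords S x1 x2 e1 e2).

Let l1 : linear_form x1. Proof. by case: hyp. Qed.
Let l2 : linear_form x2. Proof. by case: hyp. Qed.
Let x11 : x1 e1 = 1. Proof. by case: hyp => _ _ []. Qed.
Let x21 : x2 e1 = 0. Proof. by case: hyp => _ _ []. Qed.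
Let x12 : x1 e2 = 0. Proof. by case: hyp => _ _ _ []. Qed.
Let x22 : x2 e2 = 1. Proof. by case: hyp => _ _ _ []. Qed.
Let SE z : S z z = x1 z * (x1 z)^* - x2 z * (x2 z)^*. Proof. by case: hyp. Qed.

(** The plane of [u] and [e2] meets [|B w w| <= S w w] only in the line of [u],
since [S] is [- |t|^2] on it; and [S u u = 0]. *)
Lemma null_plane_isotropic u : x1 u = 0 -> x2 u = 0 -> B u u = 0.
Proof.
move=> u1 u2; have [->|u0] := eqVneq u 0.
  exact: (linear_form_at0 (sym_bilin_linear sB 0)).
have ind : independent2 u e2.
  move=> s t h; have t0 : t = 0.
    have := congr1 x2 h; rewrite l2 (linear_formZ l2) u2 x22 mulr0 add0r mulr1 => ->.
    by rewrite (linear_form_at0 l2).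
  split=> //; move: h; rewrite t0 scale0r addr0 => /eqP.
  by rewrite scaler_eq0 (negbTE u0) orbF => /eqP.
have [s [t [st /=]]] := sup ind.
rewrite SE !l1 !l2 !(linear_formZ l1) !(linear_formZ l2) u1 u2 x12 x22.
rewrite !(mulr0, add0r, mul0r, sub0r, mulr1) -normCK => h.
have t0 : t = 0.
  apply/eqP; rewrite -normr_eq0 -sqrf_eq0 eq_le exprn_ge0 ?normr_ge0// andbT.
  by rewrite -oppr_ge0; apply: le_trans h.
move: h st; rewrite t0 scale0r addr0 normr0 expr0n oppr0 eqxx orbF normr_le0 => h s0.
have E : B (s *: u) (s *: u) = s ^+ 2 * B u u.
  by have := sym_bilinE sB s 0 u u; rewrite scale0r addr0 => ->; ring.
by move: h; rewrite E mulf_eq0 sqrf_eq0 (negbTE s0) => /eqP.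
Qed.

(** In the plane of [e1 + u] and [e2] the vector given by the criterion has a
nonzero component along [e1 + u], which can be scaled to 1. *)
Lemma support_point u : x1 u = 0 -> x2 u = 0 -> exists t,
  `|B e1 e1 + 2 * t * B e1 e2 + t ^+ 2 * B e2 e2 + 2 * (B e1 u + t * B e2 u)| <= 1 - t * t^*.
Proof.
move=> u1 u2.
have X1 s t : x1 (s *: (e1 + u) + t *: e2) = s.
  by rewrite l1 (linear_formZ l1) (linear_formD l1) u1 x11 x12 addr0 mulr0 addr0 mulr1.
have X2 s t : x2 (s *: (e1 + u) + t *: e2) = t.
  by rewrite l2 (linear_formZ l2) (linear_formD l2) u2 x21 x22 addr0 mulr0 add0r mulr1.
have z1 : x1 0 = 0 by exact: linear_form_at0 l1.
have z2 : x2 0 = 0 by exact: linear_form_at0 l2.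
have ind : independent2 (e1 + u) e2.
  by move=> s t h; rewrite -(X1 s t) -{2}(X2 s t) h.
have [s [t [st /=]]] := sup ind.
rewrite SE X1 X2 => h.
have s0 : s != 0.
  apply/eqP => s0; move: h st; rewrite s0 mul0r sub0r eqxx /= -normCK => h /negP; apply.
  rewrite -normr_eq0 -sqrf_eq0 eq_le exprn_ge0 ?normr_ge0// andbT.
  by rewrite -oppr_ge0; apply: le_trans h.
exists (t / s).
have ss : 0 < s * s^* by rewrite -normCK exprn_gt0// normr_gt0.
rewrite -(ler_pM2l ss) -[X in X * `|_|](gtr0_norm ss) -normrM.
have sc0 : s^* != 0 by rewrite conjC_eq0.
have -> : s * s^* * (1 - t / s * (t / s)^*) = s * s^* - t * t^*.
  by rewrite conjcM conjcV; field; rewrite s0 sc0.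
apply: le_trans h.
have -> : s *: (e1 + u) + t *: e2 = s *: e1 + t *: e2 + s *: u by rewrite scalerDr addrAC.
rewrite sym_bilin_expand// !(linear_formZ (sym_bilin_linear sB _)).
have -> : B (s *: u) u = 0.
  by have [_ c] := sB; rewrite c (linear_formZ (sym_bilin_linear sB _)) null_plane_isotropic// mulr0.
set Y := B e1 e1 + _ + _ + _.
have -> : s ^+ 2 * B e1 e1 + 2 * s * t * B e1 e2 + t ^+ 2 * B e2 e2 +
    2 * s * (s * B e1 u) + 2 * t * (s * B e2 u) + s * 0 = s ^+ 2 * Y.
  by rewrite /Y; field.
by rewrite !normrM norm_conjC.
Qed.

Lemma nrm_unit_disc t (z : C) : `|z| <= 1 - t * t^* -> nrm t <= 1 /\ nrm z <= 1 - nrm t ^+ 2.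
Proof.
rewrite mul_conj_nrm normCE -[1]/(ofReal 1) => h.
have h' : nrm z <= 1 - nrm t ^+ 2.
  by rewrite -le_ofReal; move: h; rewrite -ofRealN -ofRealD.
split=> //; have := nrm_ge0 z => h0.
have : nrm t ^+ 2 <= 1 ^+ 2 by rewrite expr1n; lra.
by rewrite ler_sqr ?nnegrE ?nrm_ge0.
Qed.

(** Apply [support_point] to large multiples [W u]: [W |B e1 u + t B e2 u|] stays
bounded with [|t| <= 1], which is impossible if [|B e1 u| > |B e2 u|]. *)
Lemma coupling_le u : x1 u = 0 -> x2 u = 0 -> nrm (B e1 u) <= nrm (B e2 u).
Proof.
move=> u1 u2; rewrite leNgt; apply/negP => lt.
pose K := nrm (B e1 e1) + 2 * nrm (B e1 e2) + nrm (B e2 e2) + 1.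
have K0 : 0 < K.
  by rewrite ltr_wpDl// !addr_ge0 ?mulr_ge0 ?nrm_ge0.
pose d := nrm (B e1 u) - nrm (B e2 u).
have d0 : 0 < d by rewrite subr_gt0.
pose W := K / d.
have W0 : 0 < W by rewrite divr_gt0.
have [||t ht] := @support_point (ofReal W *: u).
- by rewrite (linear_formZ l1) u1 mulr0.
- by rewrite (linear_formZ l2) u2 mulr0.
have [t1 h] := nrm_unit_disc ht.
move: h; rewrite !(linear_formZ (sym_bilin_linear sB _)).
set q := B e1 e1 + _ + _.
have -> : 2 * (ofReal W * B e1 u + t * (ofReal W * B e2 u)) =
  2 * (ofReal W * (B e1 u + t * B e2 u)) by ring.
set p := B e1 u + _ => h.
have n2 : nrm (2 : C) = 2.
  by apply: (@ofReal_inj R); rewrite -normCE normr_nat; symmetry; exact: (rmorph_nat (complex.real_complex R) 2).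
have nW : nrm (ofReal W) = W.
  by apply: (@ofReal_inj R); rewrite -normCE ger0_norm// -ofReal0 le_ofReal ltW.
have pd : d <= nrm p.
  have := nrmD p (- (t * B e2 u)); rewrite /p addrK nrmN nrmM.
  have : nrm t * nrm (B e2 u) <= 1 * nrm (B e2 u) by rewrite ler_wpM2r ?nrm_ge0.
  rewrite /d; lra.
have qK : nrm q <= K - 1.
  rewrite /q /K addrK; apply: le_trans (nrmD _ _) _; apply: lerD.
    apply: le_trans (nrmD _ _) _; apply: lerD => //.
    rewrite !nrmM n2 -!mulrA ler_wpM2l// -[leRHS]mul1r ler_wpM2r ?nrm_ge0//.
  rewrite expr2 !nrmM -[leRHS]mul1r ler_wpM2r ?nrm_ge0// -[leRHS]mul1r ler_pM ?nrm_ge0//.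
have := nrmD (q + 2 * (ofReal W * p)) (- q).
have -> : q + 2 * (ofReal W * p) - q = 2 * (ofReal W * p) by ring.
rewrite nrmN !nrmM n2 nW => h2.
have h3 : K <= W * nrm p.
  by rewrite /W mulrAC ler_pdivlMr// ler_pM2l.
have := sqr_ge0 (nrm t); lra.
Qed.

End Coords.
End Hyperbolic.

Section HyperbolicCase.
Variables (R : realType) (n : nat).
Local Notation C := (Cplx R).
Local Notation V := 'rV[C]_n.
Implicit Types (B S : V -> V -> C) (x y : V -> C) (e u v w z : V) (s t c : C).

Definition classified (hn : (1 < n)%N) (N : set V) :=
  (exists M' : set 'rV[C]_2, planar_normal_form M' /\ linearly_equivalent N (cylinder hn M'))
  \/ ((exists k : nat, (2 < k <= n)%N /\ linearly_equivalent N (@re_sum_squares R n k))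
      \/ (exists hn3 : (3 <= n)%N, linearly_equivalent N (cylinder hn3 (@re_z1z2_z1cz3 R)))).

Lemma linear_form_comb x1 x2 a b : linear_form x1 -> linear_form x2 ->
  linear_form (fun z => a * x1 z + b * x2 z).
Proof. by move=> h1 h2 c u v; rewrite h1 h2; ring. Qed.

Lemma linearly_equivalent_planar (hn : (1 < n)%N) (N : set V) (r : C -> C -> C) x1 x2 e1 e2 :
  linear_form x1 -> linear_form x2 -> x1 e1 = 1 -> x2 e1 = 0 -> x1 e2 = 0 -> x2 e2 = 1 ->
  (forall z, N z <-> r (x1 z) (x2 z) = 0) -> normalizable r ->
  exists M', planar_normal_form M' /\ linearly_equivalent N (cylinder hn M').
Proof.
move=> l1 l2 x11 x21 x12 x22 hN [M' nM' [a [b [c [d [D h]]]]]].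
exists M'; split => //.
pose l (j : 'I_2) z := if j == 0 then a * x1 z + b * x2 z else c * x1 z + d * x2 z.
apply: (@linearly_equivalent_cylinder R n 2 hn l).
- move=> j; rewrite /l; case: (j == 0); exact: linear_form_comb.
- move=> y; pose p := (d * y 0 - b * y 1) / (a * d - b * c).
  pose q := (a * y 1 - c * y 0) / (a * d - b * c).
  exists (p *: e1 + q *: e2) => j.
  rewrite /l !l1 !l2 !(linear_formZ l1) !(linear_formZ l2) x11 x21 x12 x22.
  rewrite !(mulr0, mulr1, addr0, add0r).
  case: j => -[|[|//]] hj /=; rewrite /p /q.
    have -> : Ordinal hj = 0 by apply: val_inj.
    by field.
  have -> : Ordinal hj = 1 by apply: val_inj.
  by field.
- move=> z; rewrite hN h.
  have -> // : row2 (a * x1 z + b * x2 z) (c * x1 z + d * x2 z) = \row_j l j z.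
  by apply/rowP => j; rewrite !mxE /l.
Qed.

(** With [U = 1 + mu t], [support_point] for the vector [(W ga) u0] reads
[|ga (4 + W U) + O(U)| <= 2 Re U - |U|^2].  The right-hand side forces
[Re U >= 0], whence [|4 + W U| >= W |U|], and for large [W] this leaves only
[U = 0], where the left-hand side is [4 |ga|]. *)
Lemma no_residual_square B S x1 x2 e1 e2 u0 (mu al be ga : C) :
  sym_bilin B -> supports B S -> hyperbolic_coords S x1 x2 e1 e2 ->
  x1 u0 = 0 -> x2 u0 = 0 -> 2 * B e1 u0 = 1 -> 2 * B e2 u0 = mu -> nrm mu = 1 ->
  (forall t, B e1 e1 + 2 * t * B e1 e2 + t ^+ 2 * B e2 e2 =
     al * (1 + mu * t) ^+ 2 + be * (1 + mu * t) * (1 - mu * t) + ga * (1 - mu * t) ^+ 2) ->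
  ga = 0.
Proof.
move=> sB sup hyp u1 u2 h1 h2 nmu qE; apply/eqP; apply: contraT => ga0.
have [l1 l2 _ _ _] := hyp.
pose K := 2 * nrm al + 2 * nrm be + 6 * nrm ga.
have K0 : 0 <= K by rewrite !addr_ge0 ?mulr_ge0 ?nrm_ge0.
have g0 : 0 < nrm ga by rewrite nrm_gt0.
pose W := (3 + K) / nrm ga.
have W0 : 0 < W by rewrite divr_gt0// ltr_pwDl.
have [||t ht] := @support_point R n B S x1 x2 e1 e2 sB sup hyp ((ofReal W * ga) *: u0).
- by rewrite (linear_formZ l1) u1 mulr0.
- by rewrite (linear_formZ l2) u2 mulr0.
move: ht; rewrite qE !(linear_formZ (sym_bilin_linear sB _)).
set U := 1 + mu * t.
have -> : 1 - mu * t = 2 - U by rewrite /U; ring.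
have -> : 2 * (ofReal W * ga * B e1 u0 + t * (ofReal W * ga * B e2 u0)) = ofReal W * ga * U.
  have -> : 2 * (ofReal W * ga * B e1 u0 + t * (ofReal W * ga * B e2 u0)) =
     ofReal W * ga * (2 * B e1 u0 + t * (2 * B e2 u0)) by ring.
  by rewrite h1 h2 /U; ring.
pose X := al * U + be * (2 - U) - 4 * ga + ga * U.
have -> : al * U ^+ 2 + be * U * (2 - U) + ga * (2 - U) ^+ 2 + ofReal W * ga * U =
  ga * (4 + ofReal W * U) + U * X by rewrite /X; ring.
move=> /nrm_unit_disc[t1 hZ].
have ntU : nrm t ^+ 2 = (cRe U - 1) ^+ 2 + cIm U ^+ 2.
  have -> : nrm t = nrm (U - 1).
    have -> : U - 1 = mu * t by rewrite /U; ring.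
    by rewrite nrmM nmu mul1r.
  by rewrite nrm_sq cReD cImD cReN cImN /= oppr0 addr0.
have nU : nrm U ^+ 2 = cRe U ^+ 2 + cIm U ^+ 2 by rewrite nrm_sq.
have rhs : 1 - nrm t ^+ 2 = 2 * cRe U - nrm U ^+ 2 by rewrite ntU nU; ring.
rewrite rhs in hZ.
have nZ := nrm_ge0 (ga * (4 + ofReal W * U) + U * X).
have U0 := nrm_ge0 U.
have reU : 0 <= cRe U by have := sqr_ge0 (nrm U); lra.
have nU2 : nrm U <= 2.
  apply: le_trans (nrmD _ _) _; rewrite nrmM nmu mul1r (nrm_nat R 1); lra.
have n2U : nrm (2 - U) <= 2.
  have -> : 2 - U = 1 - mu * t by rewrite /U; ring.
  apply: le_trans (nrmD _ _) _; rewrite nrmN nrmM nmu mul1r (nrm_nat R 1); lra.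
have XK : nrm X <= K.
  have b1 : nrm (al * U) <= nrm al * 2 by rewrite nrmM ler_wpM2l ?nrm_ge0.
  have b2 : nrm (be * (2 - U)) <= nrm be * 2 by rewrite nrmM ler_wpM2l ?nrm_ge0.
  have b3 : nrm (- (4 * ga)) = 4 * nrm ga by rewrite nrmN nrmM nrm_nat.
  have b4 : nrm (ga * U) <= nrm ga * 2 by rewrite nrmM ler_wpM2l ?nrm_ge0.
  have := nrmD (al * U + be * (2 - U) - 4 * ga) (ga * U).
  have := nrmD (al * U + be * (2 - U)) (- (4 * ga)).
  have := nrmD (al * U) (be * (2 - U)).
  rewrite /X /K b3; lra.
have up : nrm ga * nrm (4 + ofReal W * U) <= nrm U * (2 + K).
  rewrite -nrmM.
  have := nrmD (ga * (4 + ofReal W * U) + U * X) (- (U * X)).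
  rewrite addrK nrmN (nrmM U X).
  have : nrm U * nrm X <= nrm U * K by rewrite ler_wpM2l.
  have := cRe_le_nrm U; have := sqr_ge0 (nrm U); lra.
have low : W * nrm U <= nrm (4 + ofReal W * U).
  have -> : W * nrm U = nrm (ofReal W * U) by rewrite nrmM nrm_ofReal_ge0 ?ltW.
  have sq : nrm (ofReal W * U) ^+ 2 <= nrm (4 + ofReal W * U) ^+ 2.
    have r4 : cRe (4 : C) = 4 /\ cIm (4 : C) = 0.
      have -> : (4 : C) = ofReal 4 by symmetry; exact: (rmorph_nat (complex.real_complex R) 4).
      by [].
    rewrite !nrm_sq (cReD 4) (cImD 4) r4.1 r4.2 !cReM !cImM /=.
    have : 0 <= W * cRe U by rewrite mulr_ge0// ltW.
    nra.
  by move: sq; rewrite ler_sqr ?nnegrE ?nrm_ge0.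
have key : (3 + K) * nrm U <= nrm U * (2 + K).
  apply: le_trans up; apply: le_trans (ler_wpM2l (ltW g0) low).
  have Wg : nrm ga * W = 3 + K by rewrite /W mulrC divfK ?gt_eqF.
  by rewrite mulrA Wg.
have Uz : U = 0 by apply/eqP; rewrite -nrm_eq0 eq_le U0 andbT; lra.
move: up; rewrite Uz nrm0 mul0r mulr0 addr0 nrm_nat.
have : 0 < nrm ga * 4 by rewrite mulr_gt0.
lra.
Qed.

(** Let [Z] be the subspace [x1 = x2 = 0] and [pr] the projection to it.  If [Z]
is orthogonal to [e1] for [B], then [rho] depends on [x1] and [x2] only.  If not,
[uu] in [Z] with [2 B e1 uu = 1] provides the factor [mu] of proportionality, of
modulus 1, and [x1], [x2] are replaced by [x1 + mu x2] and [x1 - mu x2]. *)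
Theorem hyperbolic_classified (hn : (1 < n)%N) B S x1 x2 e1 e2 : sym_bilin B ->
  supports B S -> supports (fun u v => - B u v) (fun u v => - S u v) ->
  hyperbolic_coords S x1 x2 e1 e2 -> classified hn (cone_of B S).
Proof.
move=> sB sup sup' hyp.
have sB' : sym_bilin (fun u v => - B u v).
  have [l c] := sB; split=> *; last by rewrite c.
  by rewrite l; ring.
have hyp' := hyperbolic_coords_opp hyp.
have [l1 l2 [x11 x21] [x12 x22] SE] := hyp.
have coup u : x1 u = 0 -> x2 u = 0 -> nrm (B e1 u) = nrm (B e2 u).
  move=> u1 u2; apply/eqP; rewrite eq_le (coupling_le sB sup hyp u1 u2).
  by have := coupling_le sB' sup' hyp' u2 u1; rewrite !nrmN.
pose pr z := z - (x1 z *: e1 + x2 z *: e2).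
have pr1 z : x1 (pr z) = 0.
  rewrite /pr (linear_formD l1) -scaleN1r (linear_formZ l1) l1 (linear_formZ l1) x11 x12.
  by rewrite mulr1 mulr0 addr0 mulN1r subrr.
have pr2 z : x2 (pr z) = 0.
  rewrite /pr (linear_formD l2) -scaleN1r (linear_formZ l2) l2 (linear_formZ l2) x21 x22.
  by rewrite mulr1 mulr0 add0r mulN1r subrr.
have dec z : z = x1 z *: e1 + x2 z *: e2 + pr z by rewrite /pr addrC subrK.
have BE z : B z z = B e1 e1 * x1 z ^+ 2 + 2 * B e1 e2 * x1 z * x2 z + B e2 e2 * x2 z ^+ 2 +
    2 * (x1 z * B e1 (pr z) + x2 z * B e2 (pr z)).
  rewrite {1 2}(dec z) sym_bilin_expand// (null_plane_isotropic sB sup hyp (pr1 z) (pr2 z)); ring.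
have [[u0 [u1 u2 u3]]|H] := pselect (exists u, [/\ x1 u = 0, x2 u = 0 & B e1 u != 0]); last first.
  have z1 u : x1 u = 0 -> x2 u = 0 -> B e1 u = 0.
    by move=> u1 u2; apply/eqP; apply: contra_notT H => h; exists u.
  have z2 u : x1 u = 0 -> x2 u = 0 -> B e2 u = 0.
    move=> u1 u2; apply/eqP; rewrite -nrm_eq0 -coup// z1//; exact/eqP/nrm0.
  left; apply: (linearly_equivalent_planar hn l1 l2 x11 x21 x12 x22 (r := fun s t =>
     'Re (B e1 e1 * s ^+ 2 + 2 * B e1 e2 * s * t + B e2 e2 * t ^+ 2) + (s * s^* - t * t^*))).
    by move=> z; rewrite /cone_of /= BE (z1 (pr z))// (z2 (pr z))// !mulr0 addr0 mulr0 addr0 SE.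
  have ind : independent2 e1 e2.
    move=> s t h; split.
      have := congr1 x1 h; rewrite l1 (linear_formZ l1) x11 x12 mulr0 addr0 mulr1 => ->.
      exact: linear_form_at0 l1.
    have := congr1 x2 h; rewrite l2 (linear_formZ l2) x21 x22 mulr0 add0r mulr1 => ->.
    exact: linear_form_at0 l2.
  have X1 s t : x1 (s *: e1 + t *: e2) = s.
    by rewrite l1 (linear_formZ l1) x11 x12 mulr0 addr0 mulr1.
  have X2 s t : x2 (s *: e1 + t *: e2) = t.
    by rewrite l2 (linear_formZ l2) x21 x22 mulr0 add0r mulr1.
  apply: normalizable_hyperbolic.
    have [s [t [st /= h]]] := sup _ _ ind; exists s, t; split => //.
    move: h; rewrite SE X1 X2 sym_bilinE//; congr (`|_| <= _); ring.
  have [s [t [st /= h]]] := sup' _ _ ind; exists s, t; split => //.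
  move: h; rewrite SE X1 X2 sym_bilinE// normrN; congr (`|_| <= _); ring.
pose uu := (2 * B e1 u0)^-1 *: u0.
have uu1 : x1 uu = 0 by rewrite (linear_formZ l1) u1 mulr0.
have uu2 : x2 uu = 0 by rewrite (linear_formZ l2) u2 mulr0.
have Buu : 2 * B e1 uu = 1 by rewrite (linear_formZ (sym_bilin_linear sB e1)); field.
pose mu := 2 * B e2 uu.
have nmu : nrm mu = 1 by rewrite nrmM -coup// -nrmM Buu (nrm_nat R 1).
have muE : 2 * B e2 uu = mu by [].
clearbody mu.
have mu0 : mu != 0 by rewrite -nrm_eq0 nmu oner_neq0.
have Bmu u : x1 u = 0 -> x2 u = 0 -> B e2 u = mu * B e1 u.
  move=> v1 v2; pose v := - (2 * B e1 u) *: uu + u.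
  have vv1 : x1 v = 0 by rewrite l1 uu1 v1 mulr0 addr0.
  have vv2 : x2 v = 0 by rewrite l2 uu2 v2 mulr0 addr0.
  have e1v : B e1 v = 0.
    rewrite /v (sym_bilin_linear sB) mulNr -mulrA (mulrCA 2) Buu; ring.
  have e2v : B e2 v = 0 by apply/eqP; rewrite -nrm_eq0 -coup// e1v nrm0.
  by move: e2v; rewrite /v (sym_bilin_linear sB) -muE => /eqP; rewrite addrC addr_eq0 => /eqP ->; ring.
pose al := B e1 e1 / 4 + B e1 e2 / (2 * mu) + B e2 e2 / (4 * mu ^+ 2).
pose be := B e1 e1 / 2 - B e2 e2 / (2 * mu ^+ 2).
pose ga := B e1 e1 / 4 - B e1 e2 / (2 * mu) + B e2 e2 / (4 * mu ^+ 2).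
have qE s t : B e1 e1 * s ^+ 2 + 2 * B e1 e2 * s * t + B e2 e2 * t ^+ 2 =
   al * (s + mu * t) ^+ 2 + be * (s + mu * t) * (s - mu * t) + ga * (s - mu * t) ^+ 2.
  by rewrite /al /be /ga; field.
have ga0 : ga = 0.
  apply: (no_residual_square sB sup hyp uu1 uu2 Buu muE nmu (al := al) (be := be)) => t.
  rewrite -qE; ring.
right; right.
pose U z := x1 z + mu * x2 z; pose W z := x1 z - mu * x2 z.
pose l3 z := 2 * B e1 z - 2 * B e1 e1 * x1 z - 2 * B e1 e2 * x2 z + al * U z + be * W z.
have lU : linear_form U by move=> c u v; rewrite /U l1 l2; ring.
have lW : linear_form W by move=> c u v; rewrite /W l1 l2; ring.
have ll3 : linear_form l3.
  by move=> c u v; rewrite /l3 lU lW l1 l2 (sym_bilin_linear sB); ring.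
pose l (j : 'I_3) := if j == 0 then U else if j == 1 then l3 else W.
have lin j : linear_form (l j) by rewrite /l; case: (j == 0) => //; case: (j == 1).
have onto : jointly_onto l.
  move=> y; pose p := (y 0 + y 2%:R) / 2; pose q := (y 0 - y 2%:R) / (2 * mu).
  pose c := y 1 - al * y 0 - be * y 2%:R.
  exists (p *: e1 + (q *: e2 + c *: uu)).
  have X1 : x1 (p *: e1 + (q *: e2 + c *: uu)) = p.
    by rewrite l1 l1 (linear_formZ l1) x11 x12 uu1; ring.
  have X2 : x2 (p *: e1 + (q *: e2 + c *: uu)) = q.
    by rewrite l2 l2 (linear_formZ l2) x21 x22 uu2; ring.
  have UE : U (p *: e1 + (q *: e2 + c *: uu)) = y 0 by rewrite /U X1 X2 /p /q; field.
  have WE : W (p *: e1 + (q *: e2 + c *: uu)) = y 2%:R by rewrite /W X1 X2 /p /q; field.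
  case=> -[|[|[|//]]] hj; rewrite /l /=.
  - have -> : Ordinal hj = 0 by apply: val_inj.
    exact: UE.
  - have -> : Ordinal hj = 1 by apply: val_inj.
    rewrite /l3 UE WE X1 X2 !(sym_bilin_linear sB) (linear_formZ (sym_bilin_linear sB e1)).
    have -> : 2 * (p * B e1 e1 + (q * B e1 e2 + c * B e1 uu)) =
      2 * p * B e1 e1 + 2 * q * B e1 e2 + c * (2 * B e1 uu) by ring.
    by rewrite Buu /c; ring.
  - have -> : Ordinal hj = 2%:R by apply: val_inj.
    exact: WE.
have hn3 := jointly_onto_leq lin onto.
exists hn3; apply: (linearly_equivalent_cylinder hn3 lin onto) => z.
rewrite /re_z1z2_z1cz3 /cone_of /= !mxE /l /=.
have Bpr : 2 * B e1 (pr z) = 2 * B e1 z - 2 * B e1 e1 * x1 z - 2 * B e1 e2 * x2 z.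
  rewrite /pr (linear_formD (sym_bilin_linear sB _)) -scaleN1r (linear_formZ (sym_bilin_linear sB _)).
  rewrite (sym_bilin_linear sB) (linear_formZ (sym_bilin_linear sB _)); ring.
have -> : B z z = U z * l3 z.
  rewrite BE (Bmu (pr z))// qE ga0 -/(U z) -/(W z) /l3 -Bpr /U; ring.
have -> : S z z = 'Re (U z * (W z)^*).
  rewrite SE ReE /U /W !(conjcD, conjcN, conjcM, conjCK).
  have [_ mc] : mu != 0 /\ mu^* = mu^-1.
    by apply: unit_conj; rewrite mul_conj_nrm nmu expr1n.
  by rewrite mc; field.
set X := U z * l3 z; set Y := U z * _.
by have -> : 'Re (X + Y) = 'Re X + 'Re Y by rewrite !ReE conjcD; field.
Qed.

End HyperbolicCase.

(** * The other signatures, and the classification *)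

Section Signatures.
Variables (R : realType) (n : nat).
Local Notation C := (Cplx R).
Local Notation V := 'rV[C]_n.
Implicit Types (B S : V -> V -> C) (x y : V -> C) (e u v w z : V) (s t c : C).

(** Excludes the forms of a single complex variable, the only ones outside the
list of normal forms. *)
Definition not_one_variable B S := forall (l : V -> C) (al : C) (ka : R), linear_form l ->
  ~ (forall z, cRe (B z z + S z z) = cRe (al * l z ^+ 2) + ka * nrm (l z) ^+ 2).

Definition oppf B : V -> V -> C := fun u v => - B u v.

Lemma oppfK B : oppf (oppf B) = B.
Proof. by apply/funext => u; apply/funext => v; rewrite /oppf opprK. Qed.

Lemma sym_bilin_opp B : sym_bilin B -> sym_bilin (oppf B).
Proof. by move=> [l c]; split=> *; rewrite /oppf ?l; [ring|rewrite c]. Qed.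

Lemma cone_of_opp B S : cone_of (oppf B) (oppf S) = cone_of B S.
Proof.
have ReN (z : C) : 'Re (- z) = - 'Re z by rewrite !ReE conjcN; field.
rewrite /cone_of /oppf; apply/seteqP; split => z /=; rewrite ReN => h.
  by rewrite -[LHS]opprK opprD h oppr0.
by rewrite -opprD h oppr0.
Qed.

Lemma not_one_variable_opp B S : not_one_variable B S -> not_one_variable (oppf B) (oppf S).
Proof.
move=> h l al ka ll H; apply: (h l (- al) (- ka) ll) => z.
by have := H z; rewrite /oppf mulNr !(cReD, cReN); lra.
Qed.

(** Where [x1 = 0] the criterion for [- rho] gives [|B w w| <= 0], hence
[B z z = x1 z * l z] for a linear form [l].  If [l] were a multiple of [x1], only
one variable would remain. *)
Lemma parabolic_classified (hn : (1 < n)%N) B S x1 e1 : sym_bilin B ->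
  supports (oppf B) (oppf S) -> linear_form x1 -> x1 e1 = 1 ->
  (forall z, S z z = x1 z * (x1 z)^*) -> not_one_variable B S ->
  classified hn (cone_of B S).
Proof.
move=> sB sup l1 x11 SE nov.
have null u : x1 u = 0 -> B u u = 0.
  move=> u1; have [->|u0] := eqVneq u 0; first exact: (linear_form_at0 (sym_bilin_linear sB 0)).
  have ind : independent2 u e1.
    move=> s t h; have t0 : t = 0.
      have := congr1 x1 h; rewrite l1 (linear_formZ l1) u1 x11 mulr0 add0r mulr1 => ->.
      exact: linear_form_at0 l1.
    split=> //; move: h; rewrite t0 scale0r addr0 => /eqP.
    by rewrite scaler_eq0 (negbTE u0) orbF => /eqP.
  have [s [t [st /=]]] := sup _ _ ind.
  rewrite /oppf SE !l1 !(linear_formZ l1) u1 x11 mulr0 add0r mulr1 -normCK normrN => h.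
  have t0 : t = 0.
    apply/eqP; rewrite -normr_eq0 -sqrf_eq0 eq_le exprn_ge0 ?normr_ge0// andbT.
    by rewrite -oppr_ge0; apply: le_trans h.
  move: h st; rewrite t0 scale0r addr0 normr0 expr0n oppr0 eqxx orbF normr_le0 => h s0.
  have E : B (s *: u) (s *: u) = s ^+ 2 * B u u.
    by have := sym_bilinE sB s 0 u u; rewrite scale0r addr0 => ->; ring.
  by move: h; rewrite E mulf_eq0 sqrf_eq0 (negbTE s0) => /eqP.
pose l z := 2 * B e1 z - B e1 e1 * x1 z.
have ll : linear_form l by move=> c u v; rewrite /l l1 (sym_bilin_linear sB); ring.
have pr0 z : x1 (z - x1 z *: e1) = 0.
  by rewrite (linear_formD l1) -scaleN1r !(linear_formZ l1) x11; ring.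
have BE z : B z z = x1 z * l z.
  have z0 := null _ (pr0 z).
  have := sym_bilinE sB 1 (- x1 z) z e1; rewrite scale1r scaleNr z0 => /esym/eqP.
  have [_ c] := sB.
  rewrite (c z e1) => /eqP h.
  have -> : B z z = (1 ^+ 2 * B z z + 2 * 1 * - x1 z * B e1 z + (- x1 z) ^+ 2 * B e1 e1) +
     x1 z * l z by rewrite /l; ring.
  by rewrite h add0r.
have [[u [u1 lu]]|H] := pselect (exists u, x1 u = 0 /\ l u != 0); last first.
  have l0 u : x1 u = 0 -> l u = 0.
    by move=> u1; apply/eqP; apply: contra_notT H => ?; exists u.
  case: (nov x1 (l e1) 1 l1) => z.
  have -> : l e1 * x1 z ^+ 2 = B z z.
    have := l0 _ (pr0 z); rewrite (linear_formD ll) -scaleN1r !(linear_formZ ll) mulN1r.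
    by move=> /eqP; rewrite subr_eq0 BE => /eqP ->; ring.
  by rewrite cReD SE mul_conj_nrm mul1r.
left; pose e2 := (l u)^-1 *: u; pose e1' := - l e1 *: e2 + e1.
have x12 : x1 e2 = 0 by rewrite (linear_formZ l1) u1 mulr0.
have l2 : l e2 = 1 by rewrite (linear_formZ ll) mulVf.
apply: (@linearly_equivalent_planar R n hn _ (fun s t => 'Re (s * t) + `|s| ^+ 2) x1 l e1' e2) => //.
- by rewrite l1 x12 mulr0 add0r.
- by rewrite ll l2 mulr1 addNr.
- by move=> z; rewrite /cone_of /= BE SE normCK.
exists (@M10_2 R); first by do 4 right; left.
exists 1, 0, 0, 1; split; first by rewrite mulr1 mulr0 subr0 oner_neq0.
by move=> s t; rewrite /M10_2 /= row2_0 row2_1 !mul0r !mul1r addr0 add0r.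
Qed.

Lemma cylinder_M00_1 (hn : (1 < n)%N) : cylinder hn (@M00_1 R) = re_sum_squares 2.
Proof.
rewrite /cylinder /M00_1 /re_sum_squares; apply/funext => z /=.
rewrite (big_ord_narrow hn) /= big_ord_recl big_ord1 !mxE.
by have -> : lift ord0 ord0 = 1 :> 'I_2 by exact: val_inj.
Qed.

(** Ranks 0 and 1 are forms of one variable. *)
Lemma pluriharmonic_classified (hn : (1 < n)%N) B S : sym_bilin B ->
  (forall z, S z z = 0) -> not_one_variable B S -> classified hn (cone_of B S).
Proof.
move=> sB S0 nov; have [P uP [k kn BE]] := sym_bilin_diag sB.
have Bz z : B z z = \sum_(j < n | (j < k)%N) (z *m invmx P) 0 j ^+ 2.
  by rewrite -BE mulmxKV.
have eqv : linearly_equivalent (cone_of B S) (@re_sum_squares R n k).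
  exists (invmx P); first by rewrite unitmx_inv.
  by move=> z; rewrite /cone_of /re_sum_squares /= S0 addr0 Bz.
have [k2|k2] := ltnP 2 k; first by right; left; exists k; rewrite k2.
have [k2'|k2'] := eqVneq k 2%N.
  left; exists (@M00_1 R); split; first by do 5 right.
  by rewrite cylinder_M00_1 -k2'.
have n0 : (0 < n)%N by exact: ltnW.
have k1 : (k <= 1)%N by rewrite -ltnS ltn_neqAle k2' k2.
pose l z := (z *m invmx P) 0 (Ordinal n0).
have ll : linear_form l by move=> c u v; rewrite /l mulmxDl -scalemxAl !mxE.
have [k0|k0] := posnP k.
  case: (nov l 0 0 ll) => z; rewrite S0 Bz k0 big_pred0 => [|j]; last by rewrite ltn0.
  by rewrite addr0 !mul0r addr0.
have kE : k = 1%N by apply/eqP; rewrite eqn_leq k1 k0.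
case: (nov l 1 0 ll) => z; rewrite S0 Bz kE addr0 mul1r mul0r addr0.
by rewrite (big_ord_narrow n0) big_ord1 /l; congr (cRe ((_ *m _) _ _ ^+ 2)); apply: val_inj.
Qed.

Definition diag_sesq (d : 'I_n -> R) : V -> V -> C :=
  fun u v => \sum_j ofReal (d j) * (u 0 j * (v 0 j)^*).

Lemma oppf_diag_sesq d : oppf (diag_sesq d) = diag_sesq (fun j => - d j).
Proof.
apply/funext => u; apply/funext => v; rewrite /oppf /diag_sesq -sumrN.
by apply: eq_bigr => j _; rewrite ofRealN mulNr.
Qed.

Lemma diag_sesqE2 d j k z : j != k -> (forall i, i != j -> i != k -> d i = 0) ->
  diag_sesq d z z = ofReal (d j) * (z 0 j * (z 0 j)^*) + ofReal (d k) * (z 0 k * (z 0 k)^*).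
Proof.
move=> jk h; rewrite /diag_sesq (bigD1 j) //= (bigD1 k) //= 1?eq_sym// big1 ?addr0//.
by move=> i /andP[ij ik]; rewrite h// ofReal0 mul0r.
Qed.

Lemma diag_sesqE1 d j z : (forall i, i != j -> d i = 0) ->
  diag_sesq d z z = ofReal (d j) * (z 0 j * (z 0 j)^*).
Proof.
move=> h; rewrite /diag_sesq (bigD1 j) //= big1 ?addr0// => i ij.
by rewrite h// ofReal0 mul0r.
Qed.

Lemma delta_comb (j k : 'I_n) s t : j != k ->
  (s *: delta_mx 0 j + t *: delta_mx 0 k : V) 0 j = s /\
  (s *: delta_mx 0 j + t *: delta_mx 0 k : V) 0 k = t /\
  forall i, i != j -> i != k -> (s *: delta_mx 0 j + t *: delta_mx 0 k : V) 0 i = 0.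
Proof.
move=> jk; rewrite !mxE !eqxx /= (negbTE jk) eq_sym (negbTE jk).
rewrite !(mulr0, mulr1, addr0, add0r); split => //; split => // i ij ik.
by rewrite !mxE /= (negbTE ij) (negbTE ik) !mulr0 addr0.
Qed.

(** Two negative squares would give a plane where [S] is negative definite. *)
Lemma supports_one_negative B d j k : supports B (diag_sesq d) -> d j < 0 -> d k < 0 -> j = k.
Proof.
move=> sup dj dk; apply/eqP; apply: contraT => jk.
have ind : independent2 (delta_mx 0 j : V) (delta_mx 0 k).
  by move=> s t h; have [h1 [h2 _]] := delta_comb s t jk; move: h1 h2; rewrite h !mxE.
have [s [t [st /=]]] := sup _ _ ind.
have [h1 [h2 h3]] := delta_comb s t jk.
set w := s *: _ + _ in h1 h2 h3 *.
have -> : diag_sesq d w w = ofReal (d j * nrm s ^+ 2 + d k * nrm t ^+ 2).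
  rewrite /diag_sesq (bigD1 j) //= (bigD1 k) //= 1?eq_sym// h1 h2 !mul_conj_nrm big1.
    by rewrite addr0 ofRealD !ofRealM.
  by move=> i /andP[ij ik]; rewrite h3// mul0r mulr0.
rewrite normCE le_ofReal => h; have := le_trans (nrm_ge0 _) h.
rewrite leNgt => /negP[].
have s2 := sqr_ge0 (nrm s); have t2 := sqr_ge0 (nrm t).
case/orP: st => h0.
  have : d j * nrm s ^+ 2 < 0 by rewrite nmulr_rlt0// exprn_gt0// nrm_gt0.
  have : d k * nrm t ^+ 2 <= 0 by rewrite nmulr_rle0.
  lra.
have : d k * nrm t ^+ 2 < 0 by rewrite nmulr_rlt0// exprn_gt0// nrm_gt0.
have : d j * nrm s ^+ 2 <= 0 by rewrite nmulr_rle0.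
lra.
Qed.

Lemma coord_scaled_linear (c : C) j : linear_form (fun z : V => c * z 0 j).
Proof. by move=> k u v; rewrite !mxE; ring. Qed.

Lemma sqrt_ofReal (a : R) : 0 < a -> ofReal (Num.sqrt a) != 0 :> C /\
  forall c, ofReal (Num.sqrt a) * c * (ofReal (Num.sqrt a) * c)^* = ofReal a * (c * c^*).
Proof.
move=> a0; split; first by rewrite ofReal_neq0 gt_eqF// sqrtr_gt0.
move=> c; rewrite conjcM ofReal_conj.
have -> : ofReal a = ofReal (Num.sqrt a) * ofReal (Num.sqrt a) :> C.
  by rewrite -ofRealM -expr2 sqr_sqrtr// ltW.
ring.
Qed.

Lemma diagonal_parabolic (hn : (1 < n)%N) B d j : sym_bilin B ->
  supports (oppf B) (oppf (diag_sesq d)) -> 0 < d j -> (forall i, i != j -> d i = 0) ->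
  not_one_variable B (diag_sesq d) -> classified hn (cone_of B (diag_sesq d)).
Proof.
move=> sB sup dj h nov; have [r0 rE] := sqrt_ofReal dj.
apply: (@parabolic_classified hn B _ (fun z => ofReal (Num.sqrt (d j)) * z 0 j)
  ((ofReal (Num.sqrt (d j)))^-1 *: delta_mx 0 j)) => //.
- exact: coord_scaled_linear.
- by rewrite !mxE !eqxx /= mulr1 divff.
- by move=> z; rewrite (diag_sesqE1 z h) rE.
Qed.

Theorem diagonal_classified (hn : (1 < n)%N) B d : sym_bilin B ->
  supports B (diag_sesq d) -> supports (oppf B) (oppf (diag_sesq d)) ->
  not_one_variable B (diag_sesq d) -> classified hn (cone_of B (diag_sesq d)).
Proof.
move=> sB sup sup' nov.
have negE i j : d i < 0 -> d j < 0 -> i = j := supports_one_negative sup.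
have posE i j : 0 < d i -> 0 < d j -> i = j.
  move=> h1 h2; move: sup'; rewrite oppf_diag_sesq => /supports_one_negative; apply; by rewrite oppr_lt0.
have [[j dj]|noj] := pselect (exists j, 0 < d j).
  have [[k dk]|nok] := pselect (exists k, d k < 0).
    have jk : j != k by apply/eqP => jk; move: dj; rewrite jk; lra.
    have h i : i != j -> i != k -> d i = 0.
      move=> ij ik; have [di|di|//] := ltgtP (d i) 0.
        by move: ik; rewrite (negE _ _ di dk) eqxx.
      by move: ij; rewrite (posE _ _ di dj) eqxx.
    have dk' : 0 < - d k by rewrite oppr_gt0.
    have [rj0 rjE] := sqrt_ofReal dj; have [rk0 rkE] := sqrt_ofReal dk'.
    apply: (@hyperbolic_classified R n hn B (diag_sesq d)
      (fun z => ofReal (Num.sqrt (d j)) * z 0 j) (fun z => ofReal (Num.sqrt (- d k)) * z 0 k)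
      ((ofReal (Num.sqrt (d j)))^-1 *: delta_mx 0 j)
      ((ofReal (Num.sqrt (- d k)))^-1 *: delta_mx 0 k) sB sup sup').
    split; [exact: coord_scaled_linear|exact: coord_scaled_linear| | |].
    - by rewrite !mxE !eqxx /= mulr1 divff// eq_sym (negbTE jk) !mulr0.
    - by rewrite !mxE !eqxx /= mulr1 divff// (negbTE jk) !mulr0.
    - by move=> z; rewrite (diag_sesqE2 z jk h) rjE rkE ofRealN mulNr opprK.
  apply: (@diagonal_parabolic hn B d j) => // i ij; have [di|di|//] := ltgtP (d i) 0.
    by case: nok; exists i.
  by move: ij; rewrite (posE _ _ di dj) eqxx.
have [[k dk]|nok] := pselect (exists k, d k < 0).
  rewrite -cone_of_opp oppf_diag_sesq; apply: (@diagonal_parabolic hn _ _ k).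
  - exact: sym_bilin_opp.
  - by rewrite -oppf_diag_sesq !oppfK.
  - by rewrite oppr_gt0.
  - move=> i ik; have [di|di|->] := ltgtP (d i) 0; last by rewrite oppr0.
      by move: ik; rewrite (negE _ _ di dk) eqxx.
    by case: noj; exists i.
  - by rewrite -oppf_diag_sesq; exact: not_one_variable_opp.
apply: pluriharmonic_classified => // z; apply: big1 => i _.
have -> : d i = 0; last by rewrite ofReal0 mul0r.
have [di|di|//] := ltgtP (d i) 0; first by case: nok; exists i.
by case: noj; exists i.
Qed.

Lemma classified_equiv (hn : (1 < n)%N) (N N' : set V) : linearly_equivalent N N' ->
  classified hn N' -> classified hn N.
Proof.
move=> e [[M' [nM' h]]|[[k [k2 h]]|[hn3 h]]].
- by left; exists M'; split => //; exact: linearly_equivalent_trans h.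
- by right; left; exists k; split => //; exact: linearly_equivalent_trans h.
- by right; right; exists hn3; exact: linearly_equivalent_trans h.
Qed.

Theorem cone_classified (hn : (1 < n)%N) (M : set V) (rho : rpoly R n) :
  quadratic_cone M rho -> two_sided_support rho -> classified hn M.
Proof.
move=> hM hsupp; have [h2 ME _ _ _] := hM.
have [B [S [sB hS rE]]] := forms_of_quadratic h2.
have [sup sup'] := two_sided_supports h2 sB hS rE hsupp.
have [P uP [d SE]] := herm_diag hS.
pose B' u v := B (u *m P) (v *m P).
have sB' : sym_bilin B'.
  by have [l c] := sB; split=> [k u v w|u v]; rewrite /B' ?mulmxDl -?scalemxAl ?l.
have ind a b : independent2 a b -> independent2 (a *m P) (b *m P).
  move=> ab s t; rewrite !scalemxAl -mulmxDl => h; apply: ab.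
  by rewrite -[LHS](mulmxK uP) h mul0mx.
have supd : supports B' (diag_sesq d).
  move=> a b /ind/sup[s [t [st /= h]]]; exists s, t; split => //=.
  by move: h; rewrite !scalemxAl -mulmxDl SE.
have supd' : supports (oppf B') (oppf (diag_sesq d)).
  move=> a b /ind/sup'[s [t [st /= h]]]; exists s, t; split => //=.
  by move: h; rewrite !scalemxAl -mulmxDl SE.
have nov : not_one_variable B' (diag_sesq d).
  move=> l al ka ll H; pose l' z := l (z *m invmx P).
  have ll' : linear_form l' by move=> c u v; rewrite /l' mulmxDl -scalemxAl ll.
  apply: (@cone_not_one_variable R n M rho (fun i => l' (delta_mx 0 i)) al ka hM) => z.
  have -> : lin (fun i => l' (delta_mx 0 i)) z = l' z.
    by rewrite (linear_form_mulmx ll'); apply: eq_bigr => i _; exact: mulrC.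
  by rewrite rE -H /B' /diag_sesq -SE mulmxKV.
apply: classified_equiv (diagonal_classified hn sB' supd supd' nov).
exists (invmx P); first by rewrite unitmx_inv.
move=> z; rewrite ME /cone_of /= /B' /diag_sesq -SE mulmxKV// rE.
rewrite (herm_sesq_real hS z) -complex.complexRe -[(complex.Re _)%:C%C]/(ofReal (cRe _)) -ofRealD cReD /=.
by split=> [->//|/(@ofReal_inj R)].
Qed.

End Signatures.

Theorem proposition7p1 (R : realType) (n : nat) (hn : (1 < n)%N)
    (M : set 'rV[Cplx R]_n) (rho : rpoly R n)
    (hM : quadratic_cone M rho) (hsupp : two_sided_support rho) :
  (exists M' : set 'rV[Cplx R]_2,
     ((exists A B : R, [/\ 0 <= B, B <= A, A <= 1 \/ A = B & M' = M11_1 A B])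
      \/ (exists A : Cplx R, [/\ 0 < 'Re A, 0 <= 'Im A & M' = M11_2 A])
      \/ M' = @M11_3 R
      \/ (exists A : R, 0 < A /\ M' = M11_4 A)
      \/ M' = @M10_2 R
      \/ M' = @M00_1 R)
     /\ biholomorphic M (cylinder hn M'))
  \/ ((exists k : nat, (2 < k <= n)%N /\ biholomorphic M (@re_sum_squares R n k))
      \/ (exists hn3 : (3 <= n)%N,
            biholomorphic M (cylinder hn3 (@re_z1z2_z1cz3 R)))).
Proof.
have [[M' [nM' h]]|[[k [k2 h]]|[hn3 h]]] := cone_classified hn hM hsupp.
- by left; exists M'; split => //; exact: linearly_equivalent_biholomorphic.
- by right; left; exists k; split => //; exact: linearly_equivalent_biholomorphic.
- by right; right; exists hn3; exact: linearly_equivalent_biholomorphic.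
Qed.
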